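(* For each $\eta\in(0,1)$ and each $\varepsilon>0$, $$\lim_{n\to\infty}\mathbb{P}\left(\sup_{\alpha\in[0,1-\eta]}\left|\frac{C_{n,\lceil\alpha n\rceil}}{n}-\frac{\alpha^2(\alpha^2-3\alpha+3)}{6(1-\alpha)^3}\right|\ge\varepsilon\right)=0,$$ where $C_{n,m}$ is the total displacement (total number of random walk steps) of the first $m$ particles in the one-dimensional drop-push model on a circle of $n$ sites.
   Context: Drop-push model: consider $n$ sites numbered $1,\dots,n$ arranged on a circle (periodic boundary conditions), all initially empty. Particles $1,2,\dots,n-1$ are dropped one after the other. Each site can hold at most one particle. Particle $k$ first drops on a site chosen uniformly at random among the $n$ sites, the choices being independent for different particles. If this site is empty the particle sticks there forever. If it is occupied, the particle performs a symmetric simple (nearest-neighbour) random walk on the circle, independent of everything else, until it first meets an empty site, where it sticks forever. Particle $k+1$ is dropped after particle $k$ has stuck. $M_{k,n}$ denotes the number of steps of the random walk made by the $k$-th particle before it sticks ($M_{k,n}=0$ if it drops on an empty site), and $C_{n,m}=\sum_{k=1}^m M_{k,n}$ (with $C_{n,0}=0$). *)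

(* Defs.v *)
From HB Require Import structures.
From mathcomp Require Import all_boot all_order all_algebra.
From mathcomp Require Import all_classical all_reals all_analysis.
Set Implicit Arguments.
Unset Strict Implicit.
Unset Printing Implicit Defensive.
Import Order.TTheory GRing.Theory Num.Theory.
Import numFieldNormedType.Exports.
Local Open Scope classical_set_scope.
Local Open Scope ring_scope.

(* A realization of the randomness is a pair (u, s): particle k (k = 1, 2, ...)
   is dropped on site u k, and its walk moves clockwise at step j.+1 iff s k j.
   The n sites on the circle are the elements of 'I_n, with cyclic successor
   and predecessor ordS and ord_pred. *)
Section dynamics.
Variable n : nat.
Implicit Types (x : 'I_n) (A : {set 'I_n}).

Fixpoint walk x (s : nat -> bool) (j : nat) : 'I_n :=
  if j is i.+1 then
    (if s i then ordS (walk x s i) else ord_pred (walk x s i))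
  else x.

Definition first_empty A x (s : nat -> bool) (j : nat) : Prop :=
  walk x s j \notin A /\ forall i, (i < j)%N -> walk x s i \in A.

(* If the walk never meets an empty site (a null event as long as A is not
   everything), no site is added to the occupied set. *)
Definition stick_site A x (s : nat -> bool) : {set 'I_n} :=
  [set y | `[< exists2 j, first_empty A x s j & walk x s j = y >]].

Variables (u : nat -> 'I_n) (s : nat -> nat -> bool).

Fixpoint occupied (k : nat) : {set 'I_n} :=
  if k is i.+1 then
    occupied i :|: stick_site (occupied i) (u k) (s k)
  else finset.set0.

(* M_{k,n}, for k >= 1; it is +oo if particle k never meets an empty site. *)
Definition displacement (R : realType) (k : nat) : \bar R :=
  ereal_inf [set (j%:R : R)%:E | j in
    first_empty (occupied k.-1) (u k) (s k)].

(* C_{n,m} *)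
Definition total_displacement (R : realType) (m : nat) : \bar R :=
  (\sum_(1 <= k < m.+1) displacement R k)%E.

End dynamics.

Section randomness.
Context {d : measure_display} {T : measurableType d} {R : realType}.

Definition mutually_independent (P : probability T R) (I : eqType)
    (D : set I) (F : I -> set (set T)) : Prop :=
  forall (r : seq I) (A : I -> set T), uniq r ->
    (forall i, i \in r -> D i /\ F i (A i)) ->
    P (\bigcap_(i in [set` r]) A i) = (\prod_(i <- r) P (A i))%E.

(* The index inl k stands for the random variable drop k, and inr (k, j) for
   step k j; the sigma-algebra generated by a variable with values in a finite
   set consists of the preimages of all subsets. *)
Definition source_events (n : nat) (drop : nat -> T -> 'I_n)
    (step : nat -> nat -> T -> bool) (i : nat + nat * nat) : set (set T) :=
  match i with
  | inl k => [set drop k @^-1` B | B in [set: set 'I_n]]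
  | inr (k, j) => [set step k j @^-1` B | B in [set: set bool]]
  end.

Definition particle (i : nat + nat * nat) : nat :=
  match i with inl k => k | inr (k, _) => k end.

(* The law of the randomness driving particles 1, ..., n.-1 on n sites; nothing
   is assumed about the variables with other particle indices. *)
Record drop_push_source (P : probability T R) (n : nat)
    (drop : nat -> T -> 'I_n) (step : nat -> nat -> T -> bool) : Prop := {
  drop_measurable : forall k x, (0 < k < n)%N ->
    measurable (drop k @^-1` [set x]) ;
  step_measurable : forall k j b, (0 < k < n)%N ->
    measurable (step k j @^-1` [set b]) ;
  drop_uniform : forall k x, (0 < k < n)%N ->
    P (drop k @^-1` [set x]) = (n%:R^-1)%:E ;
  step_symmetric : forall k j b, (0 < k < n)%N ->
    P (step k j @^-1` [set b]) = (2^-1)%:E ;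
  source_independent :
    mutually_independent P [set i | (0 < particle i < n)%N]
      (source_events drop step)
}.

End randomness.

Definition limit_profile (R : realType) (a : R) : R :=
  (a ^+ 2 * (a ^+ 2 - 3 * a + 3)) / (6 * (1 - a) ^+ 3).

(* sup_{a in [0, 1 - eta]} | C_{n, ceil (a n)} / n - limit_profile a | *)
Definition sup_deviation (R : realType) (n : nat) (u : nat -> 'I_n)
    (s : nat -> nat -> bool) (eta : R) : \bar R :=
  ereal_sup [set `| (n%:R^-1)%:E
                    * total_displacement u s R `|Num.ceil (a * n%:R)|%N
                    - (limit_profile a)%:E |%E | a in `[0, 1 - eta]].

(* Main.v *)
(* Cut the circle at its empty sites. Given the past, the next particle fills a
   given empty site with probability (x + y) / 2N, where x and y are the lengths
   of the two gaps that meet there, and makes on average sum_x (x^3 - x) / 6N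
   steps, the sum running over all the gaps x. The first fact forces the gaps
   present after k particles to be exchangeable, with a joint density
   proportional to a product of weights. A step therefore merges two gaps as in
   the additive coalescent, and the drifts of the power sums of the gaps are
   explicit. With r = N - k and mu_p = sum_x x^p / N, the drifts of mu_2^2 and
   mu_3 - 3 mu_2^2 are 4 / r and 3 / r times the functional itself, up to
   O(1 / N^2), while the jumps are O(1 / N). So mu_3 has distance O(N^(-1/2)) in
   L^2 to 3 (N / r)^4 - 2 (N / r)^3, and (mu_3 - 1) / 6 to the derivative of the
   limit profile f at k / N. This yields E (C_k - N f(k / N))^2 = O(N); a union
   bound over finitely many k, the monotonicity of C and the continuity of f
   finish the proof.

   Every walk is cut off after N^4 steps, so that only finitely many of the
   source variables matter. All that is needed about the walks are upper bounds,
   which come from superharmonic potentials on the gaps. *)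
Require Import Defs.
From HB Require Import structures.
From mathcomp Require Import all_boot all_order all_algebra.
From mathcomp Require Import all_classical all_reals all_analysis.
From mathcomp Require Import ring lra zify.
Import Order.TTheory GRing.Theory Num.Theory.
Import numFieldNormedType.Exports.
Local Open Scope classical_set_scope.
Local Open Scope ring_scope.

Set Implicit Arguments.
Unset Strict Implicit.
Unset Printing Implicit Defensive.

(** * Weighted sums over sequences of gaps *)

(** The eigenvalues come from the drifts: merging two exchangeable gaps a and b with bias a + b
    gives mu_2 the drift 2 mu_2 / r and mu_3 the drift 3 (mu_3 + mu_2^2) / r, up to lower order.
    This triangular system is diagonalised by mu_2^2 and mu_3 - 3 mu_2^2. Multiplied by (r / N)^4
    and (r / N)^3 these become approximate martingales, with the initial values 1 and -2, from which
    mu_3 is recovered.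

    The chain itself merges adjacent gaps only, so exchangeability is not visible step by step. It
    is built into an explicit sum, [law], which is shown to dominate the chain on nonnegative
    functionals that do not depend on the root. Such upper bounds suffice although the deviation is
    two-sided: only squares and probabilities are estimated, and a run that has been cut off counts
    as 0. The price of the cut-off is a separate bound on the probability that it occurs. *)

Section weights.
Variable R : realFieldType.

(* The solution of wt_rec with wt 1 = 1, that is c^(c-2) / (c-1)!, by iteration. *)
Fixpoint wtn (i c : nat) : R :=
  if i is i'.+1 then
    if c == 1%N then 1
    else c%:R / (2 * (c%:R - 1)) * \sum_(a < c.+1) wtn i' a * wtn i' (c - a)%N
  else 0.

Definition wt c := wtn c c.

Lemma wtn0 i : wtn i 0 = 0.
Proof. by case: i => //= i; rewrite mul0r mul0r. Qed.

(** Fuel c is enough: the recursion calls smaller arguments, except at the two ends of the sum,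
    where the other factor is the weight of 0. *)
Lemma wtn_stable c i j : (c <= i)%N -> (c <= j)%N -> wtn i c = wtn j c.
Proof.
elim/ltn_ind: c i j => -[|[|c]] IH [|i] [|j] // ci cj; rewrite ?wtn0 //=.
congr (_ * _); apply: eq_bigr => -[a /= ac] _.
have [->|a0] := eqVneq a 0%N; first by rewrite !wtn0 !mul0r.
have [->|ac2] := eqVneq a c.+2; first by rewrite subnn !wtn0 !mulr0.
by congr (_ * _); apply: IH; lia.
Qed.

Lemma wtnS i c : wtn i.+1 c.+2 =
  c.+2%:R / (2 * (c.+2%:R - 1)) * \sum_(a < c.+3) wtn i a * wtn i (c.+2 - a)%N.
Proof. by []. Qed.

Arguments wtn : simpl never.

Lemma wtE c i : (c <= i)%N -> wt c = wtn i c.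
Proof. by move=> ci; apply: wtn_stable. Qed.

Lemma wt0 : wt 0 = 0. Proof. by []. Qed.
Lemma wt1 : wt 1 = 1. Proof. by []. Qed.

Lemma wtn_ge0 i c : 0 <= wtn i c.
Proof.
elim: i c => // i IH [|[|c]] //; first by rewrite wtn0.
rewrite wtnS.
apply: mulr_ge0; last by apply: sumr_ge0 => a _; apply: mulr_ge0.
by rewrite divr_ge0 // mulr_ge0 // subr_ge0 ler1n.
Qed.

Lemma wt_ge0 c : 0 <= wt c. Proof. exact: wtn_ge0. Qed.

(** Combinatorially, [wt c] is the number of rooted labelled trees on c vertices over c!, and
    cutting one of the 2 (c - 1) oriented edges of a labelled tree leaves two rooted trees. *)
Lemma wt_rec c :
  c%:R * \sum_(a < c.+1) wt a * wt (c - a)%N = 2 * (c%:R - 1) * wt c.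
Proof.
case: c => [|[|c]]; first by rewrite wt0 mul0r mulr0.
  by rewrite !big_ord_recl big_ord0 /= !wt0 subrr; ring.
have nz : 2 * (c.+2%:R - 1) != 0 :> R.
  by rewrite mulf_neq0 ?pnatr_eq0 // subr_eq0 pnatr_eq1.
rewrite /(wt c.+2) wtnS mulrA mulrCA mulfV // mulr1; congr (_ * _).
apply: eq_bigr => -[a /= ac] _.
have [->|a0] := eqVneq a 0%N; first by rewrite [wt 0]wt0 [wtn _ 0]wtn0 !mul0r.
have [->|ac2] := eqVneq a c.+2; first by rewrite subnn [wt 0]wt0 [wtn _ 0]wtn0 !mulr0.
by congr (_ * _); apply: wtE; lia.
Qed.

End weights.

Section list_sum.
Variables (R : realFieldType) (N : nat).
Implicit Types (Phi Psi : seq nat -> R).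
Local Notation wt := (wt R).

(* As wt 0 = 0, only the sequences of r positive numbers contribute. *)
Fixpoint lsum r Phi : R :=
  if r is r'.+1 then
    \sum_(a < N.+1) wt a * lsum r' (fun l => Phi (val a :: l))
  else Phi [::].

Lemma ler_lsum r Phi Psi :
  (forall l, size l = r -> all (leq 1) l -> Phi l <= Psi l) ->
  lsum r Phi <= lsum r Psi.
Proof.
elim: r Phi Psi => [|r IH] Phi Psi le /=; first exact: le.
apply: ler_sum => -[ [|a] aN] _; first by rewrite wt0 !mul0r.
by rewrite ler_wpM2l ?wt_ge0 // IH // => l sl pl; rewrite le //= ?sl.
Qed.

Lemma eq_lsum r Phi Psi :
  (forall l, size l = r -> all (leq 1) l -> Phi l = Psi l) ->
  lsum r Phi = lsum r Psi.
Proof.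
by move=> e; apply/eqP; rewrite eq_le !ler_lsum // => l sl pl; rewrite e.
Qed.

Lemma lsumD r Phi Psi :
  lsum r (fun l => Phi l + Psi l) = lsum r Phi + lsum r Psi.
Proof.
elim: r Phi Psi => //= r IH Phi Psi.
by rewrite -big_split; apply: eq_bigr => a _ /=; rewrite IH mulrDr.
Qed.

Lemma lsumZ r c Phi : lsum r (fun l => c * Phi l) = c * lsum r Phi.
Proof.
elim: r Phi => //= r IH Phi.
by rewrite mulr_sumr; apply: eq_bigr => a _ /=; rewrite IH mulrCA.
Qed.

Lemma lsum_sum r (I : finType) (Phi : I -> seq nat -> R) :
  lsum r (fun l => \sum_i Phi i l) = \sum_i lsum r (Phi i).
Proof.
elim: r Phi => //= r IH Phi.
rewrite exchange_big; apply: eq_bigr => a _ /=.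
by rewrite IH mulr_sumr.
Qed.

Lemma lsum_swap r Phi :
  lsum r.+2 (fun l => if l is a :: b :: l' then Phi (b :: a :: l') else 0)
  = lsum r.+2 Phi.
Proof.
rewrite /=; under eq_bigr do rewrite mulr_sumr.
rewrite exchange_big; apply: eq_bigr => a _.
by rewrite mulr_sumr; apply: eq_bigr => b _; rewrite mulrCA.
Qed.

Definition bring i (l : seq nat) := nth 0%N l i :: (take i l ++ drop i.+1 l).

(** Swaps of the first two entries, applied under the outer summations, carry an entry forward one
    place at a time. *)
Lemma lsum_bring r Phi i :
  (i < r)%N -> lsum r (fun l => Phi (bring i l)) = lsum r Phi.
Proof.
elim: i r Phi => [|i IH] [|r] Phi ir //.
  by apply: eq_lsum => -[|a l] // _ _; rewrite /bring /= drop0.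
case: r => // r in ir *.
pose Psi l := if l is a :: b :: l' then Phi (b :: a :: l') else 0.
rewrite -[RHS]lsum_swap -/(Psi _).
transitivity (\sum_(a < N.+1) wt a *
   lsum r.+1 (fun l => Psi (val a :: bring i l))).
  by apply: eq_bigr => a _; congr (_ * _); apply: eq_lsum => -[].
by apply: eq_bigr => a _; rewrite (IH _ (fun l => Psi (val a :: l))).
Qed.

(** [rot 1] undoes [bring] of the last entry. *)
Lemma lsum_rot1 r Phi : lsum r (fun l => Phi (rot 1 l)) = lsum r Phi.
Proof.
case: r => // r.
rewrite -(lsum_bring _ (ltnSn r)); apply: eq_lsum => l sl _; congr Phi.
rewrite /bring drop_oversize ?sl // cats0 /rot /= drop0 take0.
by rewrite cats1 -take_nth ?sl // -sl take_size.
Qed.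

Lemma lsum_rot r Phi i : (i <= r)%N -> lsum r (fun l => Phi (rot i l)) = lsum r Phi.
Proof.
elim: i Phi => [|i IH] Phi ir; first by apply: eq_lsum => l _ _; rewrite rot0.
rewrite -[RHS]lsum_rot1 -(IH (fun l => Phi (rot 1 l)) (ltnW ir)).
by apply: eq_lsum => l sl _; rewrite rotS ?sl.
Qed.

(** Grouping the pairs by c = a + b produces the convolution of [wt] with itself, and the factor a +
    b is the one that [wt_rec] asks for. *)
Lemma lsum_merge r Phi :
  lsum r.+2 (fun l => if l is a :: b :: l' then
                       (a + b)%:R * ((sumn l == N)%:R * Phi ((a + b)%N :: l'))
                     else 0)
  = lsum r.+1 (fun l => 2 * ((head 0%N l)%:R - 1) * ((sumn l == N)%:R * Phi l)).
Proof.
pose G c := lsum r (fun l => (c + sumn l == N)%:R * Phi (c :: l)).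
transitivity (\sum_(a < N.+1) \sum_(b < N.+1) wt a * wt b * (a + b)%:R * G (a + b)%N).
  rewrite /=; apply: eq_bigr => a _; rewrite mulr_sumr; apply: eq_bigr => b _.
  rewrite /G -!mulrA; congr (_ * (_ * _)); rewrite -lsumZ; apply: eq_lsum => l _ _.
  by rewrite /= addnA.
transitivity (\sum_(c < N.+1) (\sum_(a < c.+1) wt a * wt (c - a)%N) * (c%:R * G c)).
  (* A sum a + b beyond the range of c is ruled out by the constraint on the total length. *)
  have GN c : (N < c)%N -> G c = 0.
    move=> Nc; rewrite /G -[RHS](mul0r (lsum r Phi)) -lsumZ; apply: eq_lsum => l _ _.
    by rewrite (_ : _ == N = false) ?mul0r //; lia.
  transitivity (\sum_(a < N.+1) \sum_(c < N.+1 | (a <= c)%N) wt a * wt (c - a)%N * (c%:R * G c)).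
    apply: eq_bigr => a _.
    rewrite -(big_mkord xpredT (fun b => wt a * wt b * (a + b)%:R * G (a + b)%N)).
    rewrite -(big_mkord (fun c => a <= c)%N (fun c => wt a * wt (c - a)%N * (c%:R * G c))).
    rewrite [RHS](big_cat_nat (n := a)) //=; last by rewrite ltnW.
    rewrite [X in X + _]big1_seq ?add0r; last first.
      by move=> c; rewrite mem_index_iota => /andP[ac] /andP[_ ca]; lia.
    rewrite (big_cat_nat (n := N.+1 - a)) //=; last by rewrite leq_subr.
    rewrite [X in _ + X]big1_seq ?addr0; last first.
      by move=> c; rewrite mem_index_iota => /andP[_] /andP[ca _]; rewrite GN ?mulr0 //; lia.
    have e := big_addn 0 N.+1 a (fun c => a <= c)%N (fun c => wt a * wt (c - a)%N * (c%:R * G c)).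
    rewrite add0n in e; rewrite {}e.
    rewrite big_seq_cond [RHS]big_seq_cond; apply: eq_big => [c|c _].
      by rewrite leq_addl.
    by rewrite addnK addnC !mulrA.
  rewrite (exchange_big_dep xpredT) //=; apply: eq_bigr => c _.
  rewrite mulr_suml -(big_mkord (fun a => a <= c)%N (fun a => wt a * wt (c - a)%N * (c%:R * G c))).
  rewrite (big_cat_nat (n := c.+1)) //= [X in _ + X]big1_seq ?addr0; last first.
    by move=> a; rewrite mem_index_iota => /andP[ac] /andP[ca _]; lia.
  rewrite -(big_mkord xpredT (fun a => wt a * wt (c - a)%N * (c%:R * G c))).
  rewrite big_seq_cond [RHS]big_seq_cond; apply: eq_bigl => a.
  by rewrite mem_index_iota; lia.
rewrite /=; apply: eq_bigr => c _.
rewrite mulrCA mulrA wt_rec mulrAC mulrC; congr (_ * _).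
rewrite /G -!lsumZ; apply: eq_lsum => l _ _ /=; ring.
Qed.
End list_sum.

(** * The law of the gaps *)

Section gap_law.
Variables (R : realFieldType) (N : nat).
Implicit Types (Phi Psi : seq nat -> R) (f g : nat -> R).
Local Notation wt := (wt R).
Local Notation lsum := (lsum N).

(** Both notions of invariance are needed: [merge_avg] depends on which gaps are adjacent and is
    invariant under rotations only, while the moments [mu] are symmetric in the gaps. *)
Definition rot_inv Phi := forall l, Phi (rot 1 l) = Phi l.
Definition perm_inv Phi := forall l l', perm_eq l l' -> Phi l = Phi l'.

Lemma rot_invE Phi i l : rot_inv Phi -> Phi (rot i l) = Phi l.
Proof.
move=> inv; elim: i => [|i IH]; first by rewrite rot0.
have [il|li] := ltnP i (size l); first by rewrite rotS // inv.
by rewrite rot_oversize // ltnW.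
Qed.

Lemma perm_rot_inv Phi : perm_inv Phi -> rot_inv Phi.
Proof. by move=> inv l; apply: inv; rewrite perm_rot. Qed.

Lemma big_nth0 (l : seq nat) f :
  \sum_(x <- l) f x = \sum_(i < size l) f (nth 0%N l i).
Proof. by rewrite (big_nth 0%N) big_mkord. Qed.

Lemma lsum_head r f Phi : rot_inv Phi ->
  r%:R * lsum r (fun l => f (head 0%N l) * Phi l) =
  lsum r (fun l => (\sum_(x <- l) f x) * Phi l).
Proof.
move=> inv.
transitivity (lsum r (fun l => \sum_(i < r) f (nth 0%N l i) * Phi l)).
  transitivity (\sum_(i < r) lsum r (fun l => f (head 0%N l) * Phi l)).
    by rewrite sumr_const card_ord mulr_natl.
  rewrite lsum_sum; apply: eq_bigr => i _.
  rewrite -(lsum_rot N (fun l => f (head 0%N l) * Phi l) (ltnW (ltn_ord i))).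
  apply: eq_lsum => l sl _; rewrite rot_invE // -nth0 /rot nth_cat size_drop.
  by rewrite sl subn_gt0 ltn_ord nth_drop addn0.
by apply: eq_lsum => l sl _; rewrite big_nth0 sl mulr_suml.
Qed.

Lemma sumn_inv : perm_inv (fun l => (sumn l == N)%:R).
Proof. by move=> l l' ll; rewrite (perm_sumn ll). Qed.

Lemma sumn_natr (l : seq nat) : \sum_(x <- l) x%:R = (sumn l)%:R :> R.
Proof. by rewrite sumnE natr_sum. Qed.

Lemma mul_perm_inv Phi Psi :
  perm_inv Phi -> perm_inv Psi -> perm_inv (fun l => Phi l * Psi l).
Proof. by move=> p q l l' ll; rewrite (p _ _ ll) (q _ _ ll). Qed.

Lemma mul_rot_inv Phi Psi :
  rot_inv Phi -> rot_inv Psi -> rot_inv (fun l => Phi l * Psi l).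
Proof. by move=> p q l; rewrite p q. Qed.

(** The normalising constant, through the ratio that [law_step] forces; [law1] shows that it
    normalises. *)
Fixpoint lawc k : R :=
  if k is k'.+1 then
    lawc k' * ((N - k')%:R * k%:R / (N%:R * (N - k)%:R))
  else 1.

(* The expectation of Phi over the gaps after k particles: their density is
   proportional to the product of the weights on the sequences of sum N. *)
Definition law k Phi :=
  lawc k * lsum (N - k) (fun l => (sumn l == N)%:R * Phi l).

Definition gaps k (l : seq nat) :=
  [/\ size l = (N - k)%N, all (leq 1) l & sumn l = N].

Lemma lawc_ge0 k : 0 <= lawc k.
Proof. by elim: k => //= k IH; rewrite mulr_ge0 // divr_ge0 // mulr_ge0. Qed.

Lemma ler_law k Phi Psi :
  (forall l, gaps k l -> Phi l <= Psi l) -> law k Phi <= law k Psi.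
Proof.
move=> le; rewrite /law ler_wpM2l ?lawc_ge0 //; apply: ler_lsum => l sl pl.
have [sN|_] := eqVneq; last by rewrite !mul0r.
by rewrite ler_wpM2l //; apply: le.
Qed.

Lemma eq_law k Phi Psi :
  (forall l, gaps k l -> Phi l = Psi l) -> law k Phi = law k Psi.
Proof. by move=> e; apply/eqP; rewrite eq_le !ler_law // => l gl; rewrite e. Qed.

Lemma lawD k Phi Psi : law k (fun l => Phi l + Psi l) = law k Phi + law k Psi.
Proof.
rewrite /law -mulrDr -lsumD; congr (_ * _).
by apply: eq_lsum => l _ _; rewrite mulrDr.
Qed.

Lemma lawZ k c Phi : law k (fun l => c * Phi l) = c * law k Phi.
Proof.
rewrite /law mulrCA -(lsumZ _ _ c); congr (_ * _).
by apply: eq_lsum => l _ _; rewrite mulrCA.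
Qed.

Lemma law_head k f Phi : rot_inv Phi ->
  (N - k)%:R * law k (fun l => f (head 0%N l) * Phi l) =
  law k (fun l => (\sum_(x <- l) f x) * Phi l).
Proof.
move=> inv; rewrite /law mulrCA; congr (_ * _).
have := @lsum_head (N - k) f _ (mul_rot_inv (perm_rot_inv sumn_inv) inv).
move=> /= e; under eq_lsum do rewrite mulrCA.
by rewrite e; apply: eq_lsum => l _ _; rewrite mulrCA.
Qed.

Lemma law_rot k i Phi : (i <= N - k)%N ->
  law k (fun l => Phi (rot i l)) = law k Phi.
Proof.
move=> ik; rewrite /law -[in RHS](lsum_rot N _ ik); congr (_ * _).
by apply: eq_lsum => l _ _; rewrite (rot_invE _ _ (perm_rot_inv sumn_inv)).
Qed.

(** The first two gaps are a sample without replacement from all the gaps; the subtracted sum is the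
    diagonal. *)
Lemma law_pair k f g Phi : (k.+1 < N)%N -> perm_inv Phi ->
  ((N - k)%:R * (N - k.+1)%:R) *
    law k (fun l => f (nth 0%N l 0) * g (nth 0%N l 1) * Phi l) =
  law k (fun l => ((\sum_(x <- l) f x) * (\sum_(x <- l) g x) -
                   \sum_(x <- l) f x * g x) * Phi l).
Proof.
move=> kN inv.
pose Psi l := (sumn l == N)%:R * Phi l.
have pinv : perm_inv Psi by apply: mul_perm_inv => //; apply: sumn_inv.
rewrite /law [LHS]mulrCA; congr (_ * _); rewrite -mulrA.
have -> : (N - k = (N - k.+1).+1)%N by lia.
set r := (N - k.+1)%N; rewrite -/lsum.
have step1 : r%:R * lsum r.+1 (fun l => f (nth 0%N l 0) * g (nth 0%N l 1) * Psi l) =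
   lsum r.+1 (fun l => f (head 0%N l) * ((\sum_(x <- l) g x) * Psi l)) -
   lsum r.+1 (fun l => f (head 0%N l) * g (head 0%N l) * Psi l).
  rewrite -[X in _ = _ + X]mulN1r -(lsumZ _ _ (-1)) -lsumD /= mulr_sumr.
  apply: eq_bigr => a _; rewrite mulrCA; congr (_ * _).
  transitivity (f a * (r%:R * lsum r (fun l => g (head 0%N l) * Psi (val a :: l)))).
    rewrite mulrCA; congr (_ * _); rewrite -lsumZ; apply: eq_lsum => l _ _.
    by rewrite nth0 mulrA.
  rewrite lsum_head; last first.
    by move=> l; apply: pinv; rewrite perm_cons perm_rot.
  rewrite -lsumZ; apply: eq_lsum => l _ _ /=; rewrite big_cons; ring.
have ->: lsum r.+1 (fun l => (sumn l == N)%:R *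
   (f (nth 0%N l 0) * g (nth 0%N l 1) * Phi l)) =
  lsum r.+1 (fun l => f (nth 0%N l 0) * g (nth 0%N l 1) * Psi l).
  by apply: eq_lsum => l _ _; rewrite /Psi; ring.
rewrite step1 mulrBr lsum_head; last first.
  apply/perm_rot_inv/mul_perm_inv => // l l' ll.
  by rewrite (perm_big _ ll).
rewrite (@lsum_head r.+1 (fun x => f x * g x)); last exact: perm_rot_inv.
rewrite -[X in _ + X = _]mulN1r -(lsumZ _ _ (-1)) -lsumD; apply: eq_lsum => l _ _.
rewrite /Psi; ring.
Qed.

(* By wt_rec, merging the first two gaps with a bias towards a large sum turns
   the law at k into the law at k.+1, biased by the head; rotation invariance
   then replaces the head by the mean gap. *)
Lemma law_step k Phi : (k.+1 < N)%N -> rot_inv Phi ->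
  law k.+1 Phi = (N - k)%:R / N%:R * law k (fun l =>
    if l is a :: b :: l' then (a + b)%:R / 2 * Phi ((a + b)%N :: l') else 0).
Proof.
move=> kN inv; rewrite /law /=.
pose Psi l := (sumn l == N)%:R * Phi l.
have rinv : rot_inv Psi.
  by apply: mul_rot_inv => //; apply/perm_rot_inv/sumn_inv.
have -> : (N - k = (N - k.+1).+1)%N by lia.
have [r rE] : exists r, (N - k.+1 = r.+1)%N by exists (N - k.+2)%N; lia.
rewrite rE.
have merge_head := lsum_merge N r Phi.
(* The N - k - 1 gaps x add up to N, so the numbers x - 1 add up to k + 1. *)
have head1 : r.+1%:R * lsum r.+1 (fun l => 2 * ((head 0%N l)%:R - 1) * Psi l) =
   2 * (k.+1)%:R * lsum r.+1 Psi.
  have e := @lsum_head r.+1 (fun x => 2 * (x%:R - 1)) Psi rinv.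
  rewrite e -lsumZ; apply: eq_lsum => l sl _.
  rewrite /Psi; have [sN|_] := eqVneq; last by rewrite !mul0r !mulr0.
  congr (_ * _); rewrite -mulr_sumr; congr (_ * _).
  rewrite sumrB sumn_natr sN big_const_seq count_predT iter_addr_0 sl.
  rewrite -[1 *+ _]/(_%:R) -natrB; last by lia.
  by congr _%:R; lia.
have -> : lsum r.+2 (fun l => (sumn l == N)%:R * (if l is a :: b :: l'
     then (a + b)%:R / 2 * Phi ((a + b)%N :: l') else 0)) =
  2^-1 * lsum r.+1 (fun l => 2 * ((head 0%N l)%:R - 1) * Psi l).
  rewrite -merge_head -lsumZ; apply: eq_lsum => -[|a [|b l]] _ _; rewrite ?mulr0 //=.
  rewrite addnA; ring.
have r0 : r.+1%:R != 0 :> R by rewrite pnatr_eq0.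
have N0 : N%:R != 0 :> R by rewrite pnatr_eq0; lia.
apply: (mulfI r0); rewrite -[in RHS]mulrA.
transitivity (lawc k * (r.+2%:R / N%:R * (k.+1%:R * lsum r.+1 Psi))).
  rewrite /Psi; move: (N%:R) N0 (r.+1%:R) r0 (k.+1%:R) (r.+2%:R) => x x0 y y0 z t.
  by field; rewrite x0 y0.
rewrite (_ : k.+1%:R * _ = 2^-1 * (2 * k.+1%:R * lsum r.+1 Psi)); last by field.
rewrite -head1; ring.
Qed.

Lemma law0 Phi : law 0 Phi = Phi (nseq N 1%N).
Proof.
rewrite /law mul1r subn0.
suff e r Psi : (r <= N)%N -> lsum r (fun l => (sumn l == r)%:R * Psi l) = Psi (nseq r 1%N).
  exact: e.
elim: r Psi => [|r IH] Psi rN; first by rewrite /= mul1r.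
rewrite /=.
have one : (1 < N.+1)%N by lia.
rewrite (bigD1 (Ordinal one)) //= wt1 mul1r (IH (fun l => Psi (1%N :: l)) (ltnW rN)).
rewrite big1 ?addr0 // => -[ [|[|a]] aN] // _; first by rewrite wt0 mul0r.
rewrite [X in _ * X](_ : _ = 0) ?mulr0 //.
rewrite -[RHS](mul0r (lsum r (fun=> 0))) -lsumZ; apply: eq_lsum => l sl pl.
rewrite (_ : _ == _ = false) ?mul0r //=; apply/negbTE/eqP => e.
suff : (size l <= sumn l)%N by lia.
by elim: l pl {sl e} => //= b l IHl /andP[b1 /IHl]; lia.
Qed.

(** By [law_step] the mass is multiplied by the mean of the bias, which is 1 because each gap has
    mean N / (N - k). *)
Lemma law1 k : (k < N)%N -> law k (fun=> 1) = 1.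
Proof.
elim: k => [|k IH] kN; first by rewrite law0.
have N0 : N%:R != 0 :> R by rewrite pnatr_eq0; lia.
have r0 : (N - k)%:R != 0 :> R by rewrite pnatr_eq0; lia.
have h i : (i < 2)%N -> law k (fun l => (nth 0%N l i)%:R) = N%:R / (N - k)%:R.
  move=> i2.
  transitivity (law k (fun l => (head 0%N l)%:R * 1)).
    rewrite -(@law_rot k i (fun l => (head 0%N l)%:R * 1)); last by lia.
    apply: eq_law => l [sl _ _]; rewrite mulr1 -nth0 /rot nth_cat size_drop.
    by rewrite sl nth_drop addn0 (_ : (0 < _)%N); last by lia.
  apply: (mulfI r0); rewrite (@law_head k (fun x => x%:R) (fun=> 1)) //.
  rewrite mulrCA mulfV // mulr1.
  transitivity (law k (fun=> N%:R * 1)).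
    by apply: eq_law => l [_ _ sl]; rewrite sumn_natr sl.
  by rewrite lawZ IH ?mulr1 // ltnW.
rewrite law_step //.
transitivity ((N - k)%:R / N%:R * (2^-1 * (law k (fun l => (nth 0%N l 0)%:R) +
   law k (fun l => (nth 0%N l 1)%:R)))).
  rewrite -lawD -(lawZ _ 2^-1); congr (_ * _); apply: eq_law => -[|a [|b l]] [/= sl _ _]; try lia.
  by rewrite mulr1 natrD mulrC.
rewrite !h //; move: (N%:R) N0 ((N - k)%:R) r0 => x x0 y y0.
by field; rewrite x0 y0.
Qed.

End gap_law.

(** * Moments of the gaps *)

(** Bounds the jump of a power sum, weighted by the bias, by cross terms that [law_pair] can
    average. *)
Lemma exprD_le_cross (R : realFieldType) (x y : R) p : 0 <= x -> 0 <= y ->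
  (x + y) * ((x + y) ^+ p.+1 - x ^+ p.+1 - y ^+ p.+1) <=
  2 ^+ p.+1 * (x ^+ p.+1 * y + x * y ^+ p.+1).
Proof.
move=> x0 y0.
(* The constant is attained at x = y. *)
have cross q : (x + y) ^+ q.+2 - x ^+ q.+2 - y ^+ q.+2 <=
    (2 ^+ q.+1 - 1) * (x ^+ q.+1 * y + x * y ^+ q.+1).
  elim: q => [|q IH]; first by rewrite !expr2 !expr1; lra.
  (* Rearrangement: the mixed terms of (x + y) times the induction hypothesis are at most the outer
     ones. *)
  have mix : 0 <= x * y * ((x - y) * (x ^+ q - y ^+ q)).
    apply: mulr_ge0; first exact: mulr_ge0.
    have [xy|/ltW yx] := lerP x y.
      by rewrite mulr_le0 // subr_le0 // lerXn2r.
    by rewrite mulr_ge0 // subr_ge0 // lerXn2r.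
  have c1 : 0 <= (2 ^+ q.+1 - 1 : R) by rewrite subr_ge0 exprn_ege1 // ler1n.
  have := mulr_ge0 c1 mix; have := ler_wpM2l (addr_ge0 x0 y0) IH.
  rewrite -subr_ge0 => IHl mixl; rewrite -subr_ge0.
  move: (addr_ge0 IHl mixl); congr (0 <= _).
  by rewrite !exprS; ring.
have pos : 0 <= x ^+ p.+1 * y + x * y ^+ p.+1.
  by rewrite addr_ge0 // mulr_ge0 // exprn_ge0.
have := cross p; rewrite mulrBl mul1r.
have : x * y ^+ p.+1 >= 0 by rewrite mulr_ge0 // exprn_ge0.
have : x ^+ p.+1 * y >= 0 by rewrite mulr_ge0 // exprn_ge0.
rewrite ![_ ^+ p.+2]exprS; move: (2 ^+ p.+1) pos => c.
move: ((x + y) ^+ p.+1) (x ^+ p.+1) (y ^+ p.+1) => z u v.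
by nra.
Qed.

Section moments.
Variables (R : realFieldType) (N : nat).
Implicit Types (F G H : seq nat -> R) (l : seq nat).
Local Notation law := (@law R N).
Local Notation n := (N%:R : R).

(** [mu p.+1] is the p-th moment of the gap that contains a uniformly chosen site. *)
Definition mu p l : R := (\sum_(x <- l) x%:R ^+ p) / n.
Definition gap1 l : R := (nth 0%N l 0)%:R.
Definition gap2 l : R := (nth 0%N l 1)%:R.
Definition merge_head l := if l is a :: b :: l' then (a + b)%N :: l' else l.
(** The probability (a + b) / 2N of filling the site between the first two gaps, times the number N
    - k of empty sites that a rotation may put there; hence of mean 1 ([law_bias1]). *)
Definition bias k l : R := (N - k)%:R / n * ((gap1 l + gap2 l) / 2).

Lemma mu_perm p : perm_inv (mu p).
Proof. by move=> l l' ll; rewrite /mu (perm_big _ ll). Qed.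

Lemma mu_ge0 p l : 0 <= mu p l.
Proof. by rewrite divr_ge0 // sumr_ge0 // => x _; rewrite exprn_ge0. Qed.

Lemma gap1_ge0 l : 0 <= gap1 l. Proof. by []. Qed.
Lemma gap2_ge0 l : 0 <= gap2 l. Proof. by []. Qed.
Lemma bias_ge0 k l : 0 <= bias k l.
Proof. by rewrite mulr_ge0 ?divr_ge0 ?addr_ge0. Qed.

Lemma mu_merge p k l : (k.+1 < N)%N -> gaps N k l ->
  mu p (merge_head l) = mu p l + ((gap1 l + gap2 l) ^+ p - gap1 l ^+ p - gap2 l ^+ p) / n.
Proof.
move=> kN [sl _ _]; case: l sl => [|a [|b l]] /= sl; try lia.
by rewrite /mu /gap1 /gap2 /= !big_cons natrD; ring.
Qed.

Lemma mu1 k l : (0 < N)%N -> gaps N k l -> mu 1 l = 1.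
Proof.
move=> N0 [_ _ sl]; rewrite /mu; under eq_bigr do rewrite expr1.
by rewrite sumn_natr sl divff // pnatr_eq0; lia.
Qed.

Lemma mu_le p q k l : gaps N k l -> (p <= q)%N -> mu p l <= mu q l.
Proof.
move=> [_ /allP pl _] pq; rewrite /mu ler_wpM2r ?invr_ge0 //.
rewrite big_seq [leRHS]big_seq; apply: ler_sum => x /pl x1.
by rewrite ler_weXn2l // ler1n.
Qed.

(* Chebyshev's sum inequality for the size-biased gap *)
Lemma mu_mul p q k l : (0 < N)%N -> gaps N k l ->
  mu p.+1 l * mu q.+1 l <= mu (p + q).+1 l.
Proof.
move=> N0 gl; have n0 : n != 0 by rewrite pnatr_eq0; lia.
have n_gt0 : 0 < n by rewrite ltr0n.
have -> : mu (p + q).+1 l = mu 1 l * mu (p + q).+1 l by rewrite (mu1 N0 gl) mul1r.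
rewrite -subr_ge0.
have -> : mu 1 l * mu (p + q).+1 l - mu p.+1 l * mu q.+1 l =
   (2 * n * n)^-1 * \sum_(x <- l) \sum_(y <- l)
   x%:R * y%:R * ((x%:R ^+ p - y%:R ^+ p) * (x%:R ^+ q - y%:R ^+ q)).
  pose M a b : R := \sum_(x <- l) \sum_(y <- l) x%:R ^+ a * y%:R ^+ b.
  have ME a b : M a b = n * n * (mu a l * mu b l).
    rewrite /mu /M -mulrACA mulrA
      [RHS](_ : _ = (\sum_(x <- l) x%:R ^+ a) * \sum_(x <- l) x%:R ^+ b).
      by rewrite big_distrlr.
    by field.
  transitivity ((2 * n * n)^-1 *
    (M 1%N (p + q).+1 + M (p + q).+1 1%N - M p.+1 q.+1 - M q.+1 p.+1)).
    by rewrite !ME; field.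
  congr (_ * _); rewrite /M -!sumrN -!big_split /=; apply: eq_bigr => x _.
  rewrite -!sumrN -!big_split /=; apply: eq_bigr => y _.
  by rewrite !exprS !exprD; ring.
rewrite mulr_ge0 ?invr_ge0 ?mulr_ge0 ?sumr_ge0 // => x _.
apply: sumr_ge0 => y _; apply: mulr_ge0; first exact: mulr_ge0.
have [xy|/ltW yx] := lerP (x%:R : R) y%:R.
  by rewrite mulr_le0 // subr_le0 // lerXn2r // nnegrE.
by rewrite mulr_ge0 // subr_ge0 // lerXn2r // nnegrE.
Qed.

Lemma law_ge0 k F : (forall l, gaps N k l -> 0 <= F l) -> 0 <= law k F.
Proof.
move=> F0; have <- : law k (fun=> 0) = 0.
  by rewrite -[RHS](mul0r (law k F)) -lawZ; apply: eq_law => l _; rewrite mul0r.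
exact: ler_law.
Qed.

Lemma law_merge k F : (k.+1 < N)%N -> rot_inv F ->
  law k.+1 F = law k (fun l => bias k l * F (merge_head l)).
Proof.
move=> kN inv; rewrite law_step // -lawZ; apply: eq_law => -[|a [|b l]] [/= sl _ _]; try lia.
by rewrite /bias /gap1 /gap2 /= natrD !mulrA.
Qed.

(** The bias raises the power of one of the two gaps by one; [law_pair] then turns the pair into
    moments, with the diagonal as the last term. *)
Lemma law_bias k a b F : (k.+1 < N)%N -> perm_inv F ->
  law k (fun l => bias k l * (gap1 l ^+ a * gap2 l ^+ b) * F l) =
  n / (2 * (N - k.+1)%:R) *
  law k (fun l => (mu a.+1 l * mu b l + mu a l * mu b.+1 l -
                   2 / n * mu (a + b).+1 l) * F l).
Proof.
move=> kN inv.
have n0 : n != 0 by rewrite pnatr_eq0; lia.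
have r0 : (N - k)%:R != 0 :> R by rewrite pnatr_eq0; lia.
have s0 : (N - k.+1)%:R != 0 :> R by rewrite pnatr_eq0; lia.
pose f p (x : nat) : R := x%:R ^+ p.
have key c d := law_pair (f c) (f d) kN inv.
have P c d : law k (fun l => f c (nth 0%N l 0) * f d (nth 0%N l 1) * F l) =
   ((N - k)%:R * (N - k.+1)%:R)^-1 * (n * n) *
     law k (fun l => (mu c l * mu d l - mu (c + d)%N l / n) * F l).
  apply: (mulfI (mulf_neq0 r0 s0)); rewrite key.
  rewrite -[_^-1 * _ * _]mulrA mulVKf ?mulf_neq0 // -lawZ; apply: eq_law => l _.
  rewrite /mu mulrA; congr (_ * _).
  have -> : \sum_(x <- l) f c x * f d x = \sum_(x <- l) x%:R ^+ (c + d).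
    by apply: eq_bigr => x _; rewrite /f exprD.
  rewrite /f; move: (\sum_(x <- l) x%:R ^+ c) (\sum_(x <- l) x%:R ^+ d).
  by move: (\sum_(x <- l) x%:R ^+ (c + d)) => u v w; field.
transitivity ((N - k)%:R / (2 * n) *
  (law k (fun l => f a.+1 (nth 0%N l 0) * f b (nth 0%N l 1) * F l) +
   law k (fun l => f a (nth 0%N l 0) * f b.+1 (nth 0%N l 1) * F l))).
  rewrite -lawD -lawZ; apply: eq_law => l _.
  rewrite /bias /gap1 /gap2 /f !exprS.
  by field.
rewrite !P addSnnS addnS -mulrDr -lawD mulrA; congr (_ * _).
  by move: (N - k)%:R r0 (N - k.+1)%:R s0 => r r0 s s0; field; rewrite n0 s0 r0.
by apply: eq_law => l _; ring.
Qed.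

Lemma mu0 k l : gaps N k l -> mu 0 l = (N - k)%:R / n.
Proof.
move=> [sl _ _]; rewrite /mu; under eq_bigr do rewrite expr0.
by rewrite big_const_seq count_predT iter_addr_0 sl.
Qed.

Lemma law_bias1 k F : (k.+1 < N)%N -> perm_inv F ->
  law k (fun l => bias k l * F l) = law k F.
Proof.
move=> kN inv; have := law_bias 0 0 kN inv.
under [in LHS]eq_law do rewrite !expr0 !mulr1.
move=> ->; rewrite -lawZ; apply: eq_law => l gl.
rewrite addn0 (mu1 _ gl) ?(mu0 gl); last by lia.
rewrite mulrA -[RHS]mul1r; congr (_ * _).
have -> : (N - k = (N - k.+1).+1)%N by lia.
have n0 : n != 0 by rewrite pnatr_eq0; lia.
have s0 : (N - k.+1)%:R != 0 :> R by rewrite pnatr_eq0; lia.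
have e : (N - k.+1).+1%:R = (N - k.+1)%:R + 1 :> R by rewrite natr1.
rewrite e; move: (N - k.+1)%:R s0 => s s0.
by field; rewrite n0 s0.
Qed.

(** As long as N - k is of order N, the factors of all the steps multiply to a constant, so high
    moments stay bounded. *)
Lemma law_mu_step p k : (0 < p)%N -> (k.+1 < N)%N ->
  law k.+1 (mu p) <= (1 + 2 ^+ p / (N - k.+1)%:R) * law k (mu p).
Proof.
case: p => // p _ kN.
have n0 : n != 0 by rewrite pnatr_eq0; lia.
have s0 : (N - k.+1)%:R != 0 :> R by rewrite pnatr_eq0; lia.
have r0 : (N - k)%:R != 0 :> R by rewrite pnatr_eq0; lia.
rewrite law_merge //; last exact/perm_rot_inv/mu_perm.
have one a b : (N - k)%:R * (N - k.+1)%:R *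
    law k (fun l => gap1 l ^+ a * gap2 l ^+ b * 1) <=
    n * n * law k (fun l => mu a l * mu b l).
  rewrite (@law_pair _ _ k (fun x => x%:R ^+ a) (fun x => x%:R ^+ b) (fun=> 1)) //.
  rewrite -lawZ; apply: ler_law => l _; rewrite mulr1 /mu.
  apply: (@le_trans _ _ ((\sum_(x <- l) x%:R ^+ a) * (\sum_(x <- l) x%:R ^+ b))).
    by rewrite gerBl sumr_ge0 // => x _; rewrite mulr_ge0 // exprn_ge0.
  rewrite le_eqVlt; apply/orP; left; apply/eqP.
  move: (\sum_(x <- l) x%:R ^+ a) (\sum_(x <- l) x%:R ^+ b) => u v.
  by field.
have cross : law k (fun l => (N - k)%:R / (2 * n * n) * (2 ^+ p.+1 *
    (gap1 l ^+ p.+1 * gap2 l ^+ 1 * 1 + gap1 l ^+ 1 * gap2 l ^+ p.+1 * 1))) <=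
    2 ^+ p.+1 / (N - k.+1)%:R * law k (mu p.+1).
  rewrite lawZ lawZ lawD.
  have e1 : law k (fun l => mu p.+1 l * mu 1 l) = law k (mu p.+1).
    by apply: eq_law => l gl; rewrite (mu1 _ gl) ?mulr1 //; lia.
  have e2 : law k (fun l => mu 1 l * mu p.+1 l) = law k (mu p.+1).
    by apply: eq_law => l gl; rewrite (mu1 _ gl) ?mul1r //; lia.
  have := one p.+1 1%N; have := one 1%N p.+1; rewrite e1 e2.
  move: (law k (mu p.+1)) (law k (fun l => gap1 l ^+ p.+1 * gap2 l ^+ 1 * 1))
    (law k (fun l => gap1 l ^+ 1 * gap2 l ^+ p.+1 * 1)) => A B C hC hB.
  rewrite -subr_ge0.
  have -> : 2 ^+ p.+1 / (N - k.+1)%:R * A -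
      (N - k)%:R / (2 * n * n) * (2 ^+ p.+1 * (B + C)) =
      2 ^+ p.+1 / (2 * n * n * (N - k.+1)%:R) *
      ((n * n * A - (N - k)%:R * (N - k.+1)%:R * B) +
       (n * n * A - (N - k)%:R * (N - k.+1)%:R * C)).
    move: (2 ^+ p.+1) (N - k)%:R (N - k.+1)%:R s0 => c r s s0.
    by field; rewrite n0 s0.
  apply: mulr_ge0; first by rewrite divr_ge0 ?exprn_ge0 // !mulr_ge0.
  by rewrite addr_ge0 // subr_ge0.
rewrite mulrDl mul1r -{1}(law_bias1 kN (mu_perm p.+1)).
apply: le_trans _ (lerD (lexx _) cross).
rewrite -lawD; apply: ler_law => l gl.
rewrite (mu_merge _ kN gl) mulrDr lerD2l.
have := exprD_le_cross p (gap1_ge0 l) (gap2_ge0 l).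
rewrite !expr1 !mulr1.
move: (2 ^+ p.+1 * _) => B hB.
rewrite /bias.
have -> : (N - k)%:R / n * ((gap1 l + gap2 l) / 2) *
   (((gap1 l + gap2 l) ^+ p.+1 - gap1 l ^+ p.+1 - gap2 l ^+ p.+1) / n) =
   (N - k)%:R / (2 * n * n) *
     ((gap1 l + gap2 l) * ((gap1 l + gap2 l) ^+ p.+1 - gap1 l ^+ p.+1 - gap2 l ^+ p.+1)).
  by field.
by rewrite ler_wpM2l // divr_ge0 // !mulr_ge0.
Qed.

End moments.

(** * Approximate martingales *)

Ltac pos := repeat match goal with
  | |- is_true (0 <= _ + _) => apply: addr_ge0
  | |- is_true (0 <= _ ^+ 2) => exact: sqr_ge0
  | |- is_true (0 <= _ * _) => apply: mulr_ge0
  | |- is_true (0 <= _ ^+ _) => apply: exprn_ge0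
  | |- is_true (0 <= _ ^-1) => rewrite invr_ge0
  | |- is_true (0 <= _%:R) => exact: ler0n
  | |- _ => first [ assumption | exact: mu_ge0 | exact: ltW | done ]
  end.

Lemma sqr3_le (R : realFieldType) (a b c : R) :
  (a + b + c) ^+ 2 <= 3 * (a ^+ 2 + b ^+ 2 + c ^+ 2).
Proof. by have := sqr_ge0 (a - b); have := sqr_ge0 (b - c); have := sqr_ge0 (a - c); nra. Qed.

Lemma sqr4_le (R : realFieldType) (a b c d : R) :
  (a + b + c + d) ^+ 2 <= 4 * (a ^+ 2 + b ^+ 2 + c ^+ 2 + d ^+ 2).
Proof.
have := sqr_ge0 (a - b); have := sqr_ge0 (b - c); have := sqr_ge0 (a - c).
by have := sqr_ge0 (a - d); have := sqr_ge0 (b - d); have := sqr_ge0 (c - d); nra.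
Qed.

Section concentration.
Variables (R : realFieldType) (N : nat).
Implicit Types (F G H S : seq nat -> R) (l : seq nat).
Local Notation law := (@law R N).
Local Notation n := (N%:R : R).
Local Notation mu := (@mu R N).
Local Notation bias := (@bias R N).
Local Notation gap1 := (gap1 R).
Local Notation gap2 := (gap2 R).

Lemma perm_invB F G : perm_inv F -> perm_inv G -> perm_inv (fun l => F l - G l).
Proof. by move=> f g l l' ll; rewrite (f _ _ ll) (g _ _ ll). Qed.

Lemma perm_invX F p : perm_inv F -> perm_inv (fun l => F l ^+ p).
Proof. by move=> f l l' ll; rewrite (f _ _ ll). Qed.

(** Expanding around S leaves a cross term with the drift, split by 2xy <= x^2 / N + N y^2. The
    first half costs a factor 1 + 1 / N per step; with a drift of order N^-2 the second is of order
    N^-3. *)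
Lemma law_sq_step k S S' Dr (s0 : R) : (k.+1 < N)%N -> perm_inv S -> perm_inv S' ->
  law k (fun l => bias k l * (S' (merge_head l) - S l) * (S l - s0)) =
    law k (fun l => Dr l * (S l - s0)) ->
  law k.+1 (fun l => (S' l - s0) ^+ 2) <=
  (1 + n^-1) * law k (fun l => (S l - s0) ^+ 2) + n * law k (fun l => Dr l ^+ 2)
  + law k (fun l => bias k l * (S' (merge_head l) - S l) ^+ 2).
Proof.
move=> kN Sp S'p drift.
have n0 : 0 < n by rewrite ltr0n; lia.
have sp : perm_inv (fun l => (S l - s0) ^+ 2).
  by move=> l l' ll; rewrite (Sp _ _ ll).
rewrite law_merge //; last first.
  by apply: perm_rot_inv => l l' ll; rewrite (S'p _ _ ll).
have -> : law k (fun l => bias k l * (S' (merge_head l) - s0) ^+ 2) =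
  law k (fun l => bias k l * (S l - s0) ^+ 2) +
  2 * law k (fun l => bias k l * (S' (merge_head l) - S l) * (S l - s0)) +
  law k (fun l => bias k l * (S' (merge_head l) - S l) ^+ 2).
  by rewrite -lawZ -!lawD; apply: eq_law => l _; ring.
rewrite law_bias1 // drift lerD2r.
rewrite [(1 + _) * _]mulrDl mul1r -addrA lerD2l.
rewrite -!lawZ -lawD; apply: ler_law => l _.
rewrite -subr_ge0.
have -> : n^-1 * (S l - s0) ^+ 2 + n * Dr l ^+ 2 - 2 * (Dr l * (S l - s0)) =
   n^-1 * (S l - s0 - n * Dr l) ^+ 2 by field; rewrite gt_eqF.
by rewrite mulr_ge0 ?sqr_ge0 // invr_ge0 ltW.
Qed.

(* mu 2 ^+ 2 and mu 3 - 3 * mu 2 ^+ 2 are, up to O(1 / N), eigenvectors of the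
   drift operator times N - k, for the eigenvalues 4 and 3. *)
Definition mart4 k l := ((N - k)%:R / n) ^+ 4 * mu 2 l ^+ 2.
Definition mart3 k l := ((N - k)%:R / n) ^+ 3 * (mu 3 l - 3 * mu 2 l ^+ 2).

Lemma mart4_perm k : perm_inv (mart4 k).
Proof. by move=> l l' ll; rewrite /mart4 (@mu_perm R N _ _ _ ll). Qed.

Lemma mart3_perm k : perm_inv (mart3 k).
Proof. by move=> l l' ll; rewrite /mart3 !(@mu_perm R N _ _ _ ll). Qed.

Section step.
Variables (k : nat) (kN : (k.+1 < N)%N).
Let s : R := (N - k.+1)%:R.

Let rE : (N - k)%:R = s + 1 :> R.
Proof. by rewrite /s natr1; congr _%:R; lia. Qed.

Let n_gt0 : 0 < n. Proof. by rewrite ltr0n; lia. Qed.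
Let s_ge1 : 1 <= s. Proof. by rewrite ler1n; lia. Qed.
Let sn : s + 1 <= n. Proof. by rewrite -rE ler_nat leq_subr. Qed.

Let t := n^-1.
Let q := s / n.

(** What is left of the drift of [mart4] once its leading term has cancelled against the change of
    the prefactor; [mu 5] is a diagonal term of [law_bias], as is [mu 4] in [drift3]. *)
Definition drift4 l :=
  - (t ^+ 2 * ((6 * q ^+ 2 + 4 * q * t + t ^+ 2) * mu 2 l ^+ 2 + 4 * q ^+ 3 * t * mu 5 l)).

Definition drift3 l :=
  t ^+ 2 * (- ((3 * q + t) * (mu 3 l - 3 * mu 2 l ^+ 2)) + 12 * q ^+ 2 * t * mu 5 l
            - 6 * q ^+ 2 * mu 4 l).

Lemma mart4_merge l : gaps N k l -> mart4 k.+1 (merge_head l) - mart4 k l =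
  ((s / n) ^+ 4 - ((s + 1) / n) ^+ 4) * mu 2 l ^+ 2 +
  (s / n) ^+ 4 * (4 / n * mu 2 l * (gap1 l * gap2 l) +
                  4 / n ^+ 2 * (gap1 l ^+ 2 * gap2 l ^+ 2)).
Proof.
move=> gl; rewrite /mart4 (mu_merge _ _ kN gl) rE -/s.
by field; rewrite gt_eqF.
Qed.

Lemma mart3_merge l : gaps N k l -> mart3 k.+1 (merge_head l) - mart3 k l =
  ((s / n) ^+ 3 - ((s + 1) / n) ^+ 3) * (mu 3 l - 3 * mu 2 l ^+ 2) +
  (s / n) ^+ 3 * (3 / n * (gap1 l ^+ 2 * gap2 l + gap1 l * gap2 l ^+ 2)
                  - 12 / n * mu 2 l * (gap1 l * gap2 l)
                  - 12 / n ^+ 2 * (gap1 l ^+ 2 * gap2 l ^+ 2)).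
Proof.
move=> gl; rewrite /mart3 !(mu_merge _ _ kN gl) rE -/s.
by field; rewrite gt_eqF.
Qed.

(** An identity in mean only: testing against a symmetric H takes the place of conditioning on the
    unordered gaps. *)
Lemma mart4_drift H : perm_inv H ->
  law k (fun l => bias k l * (mart4 k.+1 (merge_head l) - mart4 k l) * H l) =
  law k (fun l => drift4 l * H l).
Proof.
move=> Hp; pose c := (s / n) ^+ 4; pose c' := ((s + 1) / n) ^+ 4.
have p2 : perm_inv (fun l => mu 2 l * H l) by apply: mul_perm_inv => //; apply: mu_perm.
have p22 : perm_inv (fun l => mu 2 l ^+ 2 * H l).
  by apply: mul_perm_inv => //; apply/perm_invX/mu_perm.
transitivity (law k (fun l =>
   (c - c') * (bias k l * (mu 2 l ^+ 2 * H l)) +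
   (c * (4 / n)) * (bias k l * (gap1 l ^+ 1 * gap2 l ^+ 1) * (mu 2 l * H l)) +
   (c * (4 / n ^+ 2)) * (bias k l * (gap1 l ^+ 2 * gap2 l ^+ 2) * H l))).
  by apply: eq_law => l gl; rewrite (mart4_merge gl) -/c -/c' !expr1; ring.
rewrite !lawD !lawZ law_bias1 // !law_bias // -!lawZ -!lawD.
apply: eq_law => l gl; rewrite (mu1 _ _ gl) ?(ltn_trans _ kN) // -/s /c /c' /drift4 /q /t.
by field; rewrite !gt_eqF // (lt_le_trans ltr01).
Qed.

Lemma mart3_drift H : perm_inv H ->
  law k (fun l => bias k l * (mart3 k.+1 (merge_head l) - mart3 k l) * H l) =
  law k (fun l => drift3 l * H l).
Proof.
move=> Hp; pose c := (s / n) ^+ 3; pose c' := ((s + 1) / n) ^+ 3.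
have p2 : perm_inv (fun l => mu 2 l * H l) by apply: mul_perm_inv => //; apply: mu_perm.
have p3 : perm_inv (fun l => (mu 3 l - 3 * mu 2 l ^+ 2) * H l).
  by move=> l l' ll; rewrite !(@mu_perm R N _ _ _ ll) (Hp _ _ ll).
transitivity (law k (fun l =>
   (c - c') * (bias k l * ((mu 3 l - 3 * mu 2 l ^+ 2) * H l)) +
   (c * (3 / n)) * (bias k l * (gap1 l ^+ 2 * gap2 l ^+ 1) * H l) +
   (c * (3 / n)) * (bias k l * (gap1 l ^+ 1 * gap2 l ^+ 2) * H l) +
   (c * - (12 / n)) * (bias k l * (gap1 l ^+ 1 * gap2 l ^+ 1) * (mu 2 l * H l)) +
   (c * - (12 / n ^+ 2)) * (bias k l * (gap1 l ^+ 2 * gap2 l ^+ 2) * H l))).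
  by apply: eq_law => l gl; rewrite (mart3_merge gl) -/c -/c' !expr1; ring.
rewrite !lawD !lawZ law_bias1 // !law_bias // -!lawZ -!lawD.
apply: eq_law => l gl; rewrite (mu1 _ _ gl) ?(ltn_trans _ kN) // -/s /c /c' /drift3 /q /t.
by field; rewrite !gt_eqF // (lt_le_trans ltr01).
Qed.


Variables (L : R) (nL : n <= L * s).

Let t01 : 0 <= t <= 1.
Proof.
by rewrite invr_ge0 ltW //= invf_le1 // (le_trans _ sn) // lerDr (le_trans ler01).
Qed.

Let q_ge0 : 0 <= q. Proof. by rewrite divr_ge0 // ltW. Qed.

Let qt1 : q + t <= 1.
Proof. by rewrite /q /t -[X in _ + X]mul1r -mulrDl ler_pdivrMr // mul1r. Qed.

Let mu_prod p r m l : gaps N k l -> (p + r < m)%N ->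
  mu p.+1 l * mu r.+1 l <= mu m l.
Proof.
move=> gl prm; apply: le_trans (mu_mul _ _ _ _ gl) (mu_le _ gl prm).
by lia.
Qed.

Let mu22 l : gaps N k l -> mu 2 l ^+ 2 <= mu 3 l.
Proof. by move=> gl; rewrite expr2; apply: mu_prod gl _. Qed.

Let mu22_le5 l : gaps N k l -> mu 2 l ^+ 2 <= mu 5 l.
Proof. by move=> gl; apply: le_trans (mu22 gl) (mu_le _ gl _). Qed.

(** Order 5 is the highest in the drifts, so their squares call for order 9; the jumps are bounded
    by the same moment. *)
Let mu55 l : gaps N k l -> mu 5 l ^+ 2 <= mu 9 l.
Proof. by move=> gl; rewrite expr2; apply: mu_prod gl _. Qed.

Let sqr_le (a c y z : R) : 0 <= c -> 0 <= y -> `|a| <= c * y -> y ^+ 2 <= z ->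
  a ^+ 2 <= c ^+ 2 * z.
Proof.
move=> c0 y0 ay yz; rewrite -(real_normK (num_real a)).
apply: le_trans (_ : (c * y) ^+ 2 <= _).
  by rewrite lerXn2r // nnegrE ?normr_ge0 ?mulr_ge0.
by rewrite exprMn ler_wpM2l // sqr_ge0.
Qed.

Let q_le1 : q <= 1.
Proof. by apply: le_trans qt1; rewrite lerDl; case/andP: t01. Qed.

Let qp p : 0 <= q ^+ p <= 1.
Proof. by rewrite exprn_ge0 //= exprn_ile1. Qed.

Lemma drift4_le l : gaps N k l -> drift4 l ^+ 2 <= (15 * t ^+ 2) ^+ 2 * mu 9 l.
Proof.
move=> gl; have m5 := mu_ge0 R N 5 l; have m22 := mu22_le5 gl.
have /andP[t0 t1] := t01; have /andP[q20 q21] := qp 2; have /andP[q30 q31] := qp 3.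
apply: sqr_le (mu55 gl) => //; first by rewrite mulr_ge0 ?sqr_ge0.
rewrite normrN ger0_norm; last first.
  by pos.
rewrite [leRHS]mulrAC [leRHS]mulrC ler_wpM2l ?sqr_ge0 //.
(* 11 = 6 + 4 + 1 bounds the coefficient of [mu 2 l ^+ 2], and 4 that of [mu 5 l]. *)
have -> : 15 * mu 5 l = 11 * mu 5 l + 4 * mu 5 l by rewrite -mulrDl; congr (_ * _); ring.
apply: lerD.
  apply: ler_pM => //; rewrite ?sqr_ge0 //.
    by pos.
  have : q * t <= 1 by rewrite mulr_ile1.
  have : t ^+ 2 <= 1 by rewrite exprn_ile1.
  by move: q21; lra.
rewrite ler_wpM2r // -mulrA -[leRHS]mulr1 ler_wpM2l //.
by rewrite mulr_ile1.
Qed.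


Let t_ge0 : 0 <= t. Proof. by case/andP: t01. Qed.
Let t_le1 : t <= 1. Proof. by case/andP: t01. Qed.

Lemma drift3_le l : gaps N k l -> drift3 l ^+ 2 <= (34 * t ^+ 2) ^+ 2 * mu 9 l.
Proof.
move=> gl; have m5 := mu_ge0 R N 5 l; have m22 := mu22_le5 gl.
have m3 := mu_ge0 R N 3 l; have m4 := mu_ge0 R N 4 l.
have m35 : mu 3 l <= mu 5 l by apply: mu_le gl _.
have m45 : mu 4 l <= mu 5 l by apply: mu_le gl _.
have sq := sqr_ge0 (mu 2 l).
apply: sqr_le (mu55 gl) => //; first by pos.
rewrite normrM ger0_norm ?sqr_ge0 // [leRHS]mulrAC [leRHS]mulrC ler_wpM2l ?sqr_ge0 //.
(* The three bounds add up to 16 + 12 + 6 = 34. *)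
have b1 : `|(3 * q + t) * (mu 3 l - 3 * mu 2 l ^+ 2)| <= 4 * (4 * mu 5 l).
  rewrite normrM; apply: ler_pM => //.
    rewrite ger0_norm; last by pos.
    by move: q_le1 t_le1; lra.
  by rewrite ler_norml; apply/andP; split; lra.
have b2 : 12 * q ^+ 2 * t * mu 5 l <= 12 * mu 5 l.
  rewrite ler_wpM2r // -mulrA -[leRHS]mulr1 ler_wpM2l //.
  by have /andP[] := qp 2; move=> ? ?; rewrite mulr_ile1.
have b3 : 6 * q ^+ 2 * mu 4 l <= 6 * mu 5 l.
  apply: ler_pM => //; first by pos.
  by rewrite -[leRHS]mulr1 ler_wpM2l //; have /andP[] := qp 2.
have b2' : 0 <= 12 * q ^+ 2 * t * mu 5 l by pos.
have b3' : 0 <= 6 * q ^+ 2 * mu 4 l by pos.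
move: b1; rewrite !ler_norml => /andP[b1 b1']; apply/andP; split; lra.
Qed.

Lemma law_bias_le a b F : perm_inv F ->
  (forall l, gaps N k l -> 0 <= F l) ->
  (forall l, gaps N k l -> mu a.+1 l * mu b l * F l <= mu 9 l) ->
  (forall l, gaps N k l -> mu a l * mu b.+1 l * F l <= mu 9 l) ->
  law k (fun l => bias k l * (gap1 l ^+ a * gap2 l ^+ b) * F l) <= L * law k (mu 9).
Proof.
move=> Fp F0 Fa Fb; rewrite law_bias //.
have s0 : 0 < s by exact: lt_le_trans ltr01 s_ge1.
have m90 : 0 <= law k (mu 9) by apply: law_ge0 => l _; apply: mu_ge0.
apply: (@le_trans _ _ (n / (2 * s) * (2 * law k (mu 9)))).
  apply: ler_wpM2l; first by pos.
  rewrite -lawZ; apply: ler_law => l gl.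
  have := Fa l gl; have := Fb l gl.
  have : 0 <= 2 / n * mu (a + b).+1 l * F l by pos; exact: F0.
  by rewrite -/(n) !mulrDl mulNr; lra.
rewrite mulrA ler_wpM2r // invfM mulrA -mulrA mulrC.
rewrite [X in X <= _](_ : _ = n / s); first by rewrite ler_pdivrMr.
by field; rewrite gt_eqF.
Qed.

Lemma jump4_le : law k (fun l => bias k l * (mart4 k.+1 (merge_head l) - mart4 k l) ^+ 2)
  <= 48 * (1 + 2 * L) * t ^+ 2 * law k (mu 9).
Proof.
have B22 : law k (fun l => bias k l * (gap1 l ^+ 2 * gap2 l ^+ 2) * mu 2 l ^+ 2) <=
    L * law k (mu 9).
  have h l : gaps N k l -> mu 3 l * mu 2 l * mu 2 l ^+ 2 <= mu 9 l.
    move=> gl; have h4 : mu 3 l * mu 2 l <= mu 4 l by apply: mu_prod gl _.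
    apply: le_trans (_ : mu 4 l * mu 3 l <= _); last by apply: mu_prod gl _.
    by apply: ler_pM (mu22 gl) => //; pos.
  apply: law_bias_le => // [|l gl|l gl]; first exact/perm_invX/mu_perm.
    exact: sqr_ge0.
  by rewrite [mu 2 l * _]mulrC h.
have B44 : law k (fun l => bias k l * (gap1 l ^+ 4 * gap2 l ^+ 4) * 1) <= L * law k (mu 9).
  by apply: law_bias_le => // l gl; rewrite mulr1; apply: mu_prod gl _.
have B00 : law k (fun l => bias k l * mu 2 l ^+ 4) <= law k (mu 9).
  rewrite law_bias1 //; last exact/perm_invX/mu_perm.
  apply: ler_law => l gl; rewrite -[4%N]/(2 * 2)%N exprM.
  apply: le_trans (_ : mu 3 l ^+ 2 <= _).
    by rewrite lerXn2r ?nnegrE ?sqr_ge0 ?mu_ge0 // mu22.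
  by rewrite expr2; apply: mu_prod gl _.
(* 48 = 3 * 4^2: three summands, each with a coefficient of at most 4. *)
apply: le_trans (_ : 48 * t ^+ 2 * (law k (fun l => bias k l * mu 2 l ^+ 4)
  + law k (fun l => bias k l * (gap1 l ^+ 2 * gap2 l ^+ 2) * mu 2 l ^+ 2)
  + law k (fun l => bias k l * (gap1 l ^+ 4 * gap2 l ^+ 4) * 1)) <= _); last first.
  rewrite [leRHS](_ : _ = 48 * t ^+ 2 * (law k (mu 9) + L * law k (mu 9) + L * law k (mu 9))).
    by rewrite ler_wpM2l ?lerD //; pos.
  by ring.
rewrite -!lawD -lawZ; apply: ler_law => l gl.
rewrite (mart4_merge gl) -/q.
set m := mu 2 l; set x := gap1 l; set y := gap2 l.
have -> : (s + 1) / n = q + t by rewrite mulrDl mul1r.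
(* The quotient of (q + t)^4 - q^4 by t. *)
pose e := q ^+ 3 + q ^+ 2 * (q + t) + q * (q + t) ^+ 2 + (q + t) ^+ 3.
pose z := x * y.
have -> : (q ^+ 4 - (q + t) ^+ 4) * m ^+ 2 + q ^+ 4 * (4 / n * m * (x * y) +
     4 / n ^+ 2 * (x ^+ 2 * y ^+ 2)) = t * (- (e * m ^+ 2) + 4 * q ^+ 4 * (m * z) +
     4 * q ^+ 4 * t * z ^+ 2).
  rewrite /e /z -exprVn -/t; ring.
have -> : 48 * t ^+ 2 * (bias k l * m ^+ 4 + bias k l * (x ^+ 2 * y ^+ 2) * m ^+ 2 +
     bias k l * (x ^+ 4 * y ^+ 4) * 1) = bias k l * (t ^+ 2 * (3 * ((4 * m ^+ 2) ^+ 2 +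
     (4 * (m * z)) ^+ 2 + (4 * z ^+ 2) ^+ 2))) by rewrite /z; ring.
rewrite exprMn; apply: ler_wpM2l; first exact: bias_ge0.
apply: ler_wpM2l; first exact: sqr_ge0.
have qt0 : 0 <= q + t by pos.
have z0 : 0 <= z by rewrite mulr_ge0 ?gap1_ge0 ?gap2_ge0.
have m0 : 0 <= m by exact: mu_ge0.
have mz0 : 0 <= m * z by exact: mulr_ge0.
have e4 : 0 <= e <= 4.
  rewrite /e; apply/andP; split; first by pos.
  have [/andP[? ?] /andP[? ?]] := (qp 3, qp 2).
  have r2 : (q + t) ^+ 2 <= 1 by rewrite exprn_ile1.
  have r3 : (q + t) ^+ 3 <= 1 by rewrite exprn_ile1.
  have : q ^+ 2 * (q + t) <= 1 by rewrite mulr_ile1.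
  have : q * (q + t) ^+ 2 <= 1 by rewrite mulr_ile1 // exprn_ge0.
  by lra.
have [/andP[q40 q41] /andP[e0 e4']] := (qp 4, e4).
have a1 : (- (e * m ^+ 2)) ^+ 2 <= (4 * m ^+ 2) ^+ 2.
  rewrite sqrrN; apply: lerXn2r; rewrite ?nnegrE; [by pos|by pos|].
  by rewrite ler_wpM2r ?sqr_ge0.
have a2 : (4 * q ^+ 4 * (m * z)) ^+ 2 <= (4 * (m * z)) ^+ 2.
  apply: lerXn2r; rewrite ?nnegrE; [by pos|by pos|].
  by rewrite ler_wpM2r // -[leRHS]mulr1 ler_wpM2l.
have a3 : (4 * q ^+ 4 * t * z ^+ 2) ^+ 2 <= (4 * z ^+ 2) ^+ 2.
  apply: lerXn2r; rewrite ?nnegrE; [by pos|by pos|].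
  by rewrite ler_wpM2r ?sqr_ge0 // -mulrA -[leRHS]mulr1 ler_wpM2l // mulr_ile1.
apply: le_trans (sqr3_le _ _ _) _; rewrite ler_wpM2l //.
by rewrite !lerD.
Qed.

Lemma jump3_le : law k (fun l => bias k l * (mart3 k.+1 (merge_head l) - mart3 k l) ^+ 2)
  <= (576 + 1296 * L) * t ^+ 2 * law k (mu 9).
Proof.
have B22 : law k (fun l => bias k l * (gap1 l ^+ 2 * gap2 l ^+ 2) * mu 2 l ^+ 2) <=
    L * law k (mu 9).
  have h l : gaps N k l -> mu 3 l * mu 2 l * mu 2 l ^+ 2 <= mu 9 l.
    move=> gl; have h4 : mu 3 l * mu 2 l <= mu 4 l by apply: mu_prod gl _.
    apply: le_trans (_ : mu 4 l * mu 3 l <= _); last by apply: mu_prod gl _.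
    by apply: ler_pM (mu22 gl) => //; pos.
  apply: law_bias_le => // [|l gl|l gl]; first exact/perm_invX/mu_perm.
    exact: sqr_ge0.
  by rewrite [mu 2 l * _]mulrC h.
have B44 : law k (fun l => bias k l * (gap1 l ^+ 4 * gap2 l ^+ 4) * 1) <= L * law k (mu 9).
  by apply: law_bias_le => // l gl; rewrite mulr1; apply: mu_prod gl _.
have B42 : law k (fun l => bias k l * (gap1 l ^+ 4 * gap2 l ^+ 2) * 1) <= L * law k (mu 9).
  by apply: law_bias_le => // l gl; rewrite mulr1; apply: mu_prod gl _.
have B24 : law k (fun l => bias k l * (gap1 l ^+ 2 * gap2 l ^+ 4) * 1) <= L * law k (mu 9).
  by apply: law_bias_le => // l gl; rewrite mulr1; apply: mu_prod gl _.
have B00 : law k (fun l => bias k l * (4 * mu 3 l) ^+ 2) <= 16 * law k (mu 9).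
  rewrite law_bias1 //; last by move=> l l' ll; rewrite !(@mu_perm R N _ _ _ ll).
  rewrite -lawZ; apply: ler_law => l gl.
  have -> : (4 * mu 3 l) ^+ 2 = 16 * mu 3 l ^+ 2 by ring.
  by apply: ler_wpM2l; rewrite // expr2; apply: mu_prod gl _.
(* Four summands with coefficients 3, 3, 12 and 12 give 36, 36, 576 and 576; then (x + y)^2 <= 2
   (x^2 + y^2) makes 72 of the second 36. Altogether 36 * 16 = 576 and 2 * 72 + 2 * 576 = 1296. *)
apply: le_trans (_ : t ^+ 2 * (36 * law k (fun l => bias k l * (4 * mu 3 l) ^+ 2)
  + 72 * (law k (fun l => bias k l * (gap1 l ^+ 4 * gap2 l ^+ 2) * 1)
         + law k (fun l => bias k l * (gap1 l ^+ 2 * gap2 l ^+ 4) * 1))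
  + 576 * law k (fun l => bias k l * (gap1 l ^+ 2 * gap2 l ^+ 2) * mu 2 l ^+ 2)
  + 576 * law k (fun l => bias k l * (gap1 l ^+ 4 * gap2 l ^+ 4) * 1)) <= _); last first.
  rewrite [leRHS](_ : _ = t ^+ 2 * (576 * law k (mu 9) + 1296 * (L * law k (mu 9)))).
    by apply: ler_wpM2l; [exact: sqr_ge0 | lra].
  by ring.
rewrite -!lawZ -!lawD -!lawZ -!lawD -lawZ; apply: ler_law => l gl.
rewrite (mart3_merge gl) -/q.
have M22 := mu22 gl; have M3 := mu_ge0 R N 3 l; have M2 := mu_ge0 R N 2 l.
move: M22 M3 M2.
set m := mu 2 l; set m3 := mu 3 l; set x := gap1 l; set y := gap2 l => M22 M3 M2.
have -> : (s + 1) / n = q + t by rewrite mulrDl mul1r.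
pose e := q ^+ 2 + q * (q + t) + (q + t) ^+ 2.
pose z := x * y.
have -> : (q ^+ 3 - (q + t) ^+ 3) * (m3 - 3 * m ^+ 2) + q ^+ 3 *
     (3 / n * (x ^+ 2 * y + x * y ^+ 2) - 12 / n * m * (x * y) -
     12 / n ^+ 2 * (x ^+ 2 * y ^+ 2)) =
     t * (- (e * (m3 - 3 * m ^+ 2)) + 3 * q ^+ 3 * (z * (x + y)) +
          - (12 * q ^+ 3 * (m * z)) + - (12 * q ^+ 3 * t * z ^+ 2)).
  rewrite /e /z -exprVn -/t; ring.
rewrite exprMn.
have x0 : 0 <= x by exact: gap1_ge0.
have y0 : 0 <= y by exact: gap2_ge0.
apply: le_trans (_ : bias k l * (t ^+ 2 * (4 * ((3 * (4 * m3)) ^+ 2 + (3 * (z * (x + y))) ^+ 2 +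
   (12 * (m * z)) ^+ 2 + (12 * z ^+ 2) ^+ 2))) <= _); last first.
  rewrite -subr_ge0.
  have -> : t ^+ 2 * (36 * (bias k l * (4 * m3) ^+ 2) + 72 * (bias k l * (x ^+ 4 * y ^+ 2) * 1 +
     bias k l * (x ^+ 2 * y ^+ 4) * 1) + 576 * (bias k l * (x ^+ 2 * y ^+ 2) * m ^+ 2) +
     576 * (bias k l * (x ^+ 4 * y ^+ 4) * 1)) - bias k l * (t ^+ 2 * (4 * ((3 * (4 * m3)) ^+ 2 +
     (3 * (z * (x + y))) ^+ 2 + (12 * (m * z)) ^+ 2 + (12 * z ^+ 2) ^+ 2))) =
     36 * (bias k l * t ^+ 2 * (z * (x - y)) ^+ 2) by rewrite /z; ring.
  by pos; exact: bias_ge0.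
apply: ler_wpM2l; first exact: bias_ge0.
apply: ler_wpM2l; first exact: sqr_ge0.
have qt0 : 0 <= q + t by pos.
have z0 : 0 <= z by rewrite mulr_ge0.
have mz0 : 0 <= m * z by exact: mulr_ge0.
have e3 : 0 <= e <= 3.
  rewrite /e; apply/andP; split; first by pos.
  have /andP[? ?] := qp 2.
  have r2 : (q + t) ^+ 2 <= 1 by rewrite exprn_ile1.
  have : q * (q + t) <= 1 by rewrite mulr_ile1.
  by lra.
have [/andP[q30 q31] /andP[e0 e3']] := (qp 3, e3).
have a1 : (- (e * (m3 - 3 * m ^+ 2))) ^+ 2 <= (3 * (4 * m3)) ^+ 2.
  rewrite sqrrN -(real_normK (num_real (e * _)));
  apply: lerXn2r; rewrite ?nnegrE; [exact: normr_ge0|by pos|].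
  rewrite normrM (ger0_norm e0); apply: ler_pM => //.
  by have sq := sqr_ge0 m; rewrite ler_norml; apply/andP; split; lra.
have zxy : 0 <= z * (x + y) by pos.
have a2 : (3 * q ^+ 3 * (z * (x + y))) ^+ 2 <= (3 * (z * (x + y))) ^+ 2.
  apply: lerXn2r; rewrite ?nnegrE; [by pos|by pos|].
  by rewrite ler_wpM2r // -[leRHS]mulr1 ler_wpM2l.
have a3 : (- (12 * q ^+ 3 * (m * z))) ^+ 2 <= (12 * (m * z)) ^+ 2.
  rewrite sqrrN; apply: lerXn2r; rewrite ?nnegrE; [by pos|by pos|].
  by rewrite ler_wpM2r // -[leRHS]mulr1 ler_wpM2l.
have a4 : (- (12 * q ^+ 3 * t * z ^+ 2)) ^+ 2 <= (12 * z ^+ 2) ^+ 2.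
  rewrite sqrrN; apply: lerXn2r; rewrite ?nnegrE; [by pos|by pos|].
  by rewrite ler_wpM2r ?sqr_ge0 // -mulrA -[leRHS]mulr1 ler_wpM2l // mulr_ile1.
apply: le_trans (sqr4_le _ _ _ _) _; rewrite ler_wpM2l //.
by rewrite !lerD.
Qed.

Lemma mart4_step (s0 : R) :
  law k.+1 (fun l => (mart4 k.+1 l - s0) ^+ 2) <=
  (1 + n^-1) * law k (fun l => (mart4 k l - s0) ^+ 2)
  + (225 + 48 * (1 + 2 * L)) * t ^+ 2 * law k (mu 9).
Proof.
have := law_sq_step (Dr := drift4) kN (@mart4_perm k) (@mart4_perm k.+1) (s0 := s0).
move=> /(_ (mart4_drift _)) h; apply: le_trans (h _) _.
  by apply: perm_invB => //; exact: mart4_perm.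
rewrite -addrA lerD2l
  [leRHS](_ : _ = 225 * t ^+ 2 * law k (mu 9) +
    48 * (1 + 2 * L) * t ^+ 2 * law k (mu 9)); last by ring.
apply: lerD jump4_le.
apply: le_trans (_ : n * ((15 * t ^+ 2) ^+ 2 * law k (mu 9)) <= _).
  by rewrite ler_wpM2l // -lawZ; apply: ler_law => l gl; exact: drift4_le.
rewrite mulrA; apply: ler_wpM2r; first by apply: law_ge0 => l _; exact: mu_ge0.
have -> : n * (15 * t ^+ 2) ^+ 2 = 225 * t ^+ 2 * t by rewrite /t; field; rewrite gt_eqF.
by rewrite -[leRHS]mulr1; apply: ler_wpM2l; [pos | exact: t_le1].
Qed.

Lemma mart3_step (s0 : R) :
  law k.+1 (fun l => (mart3 k.+1 l - s0) ^+ 2) <=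
  (1 + n^-1) * law k (fun l => (mart3 k l - s0) ^+ 2)
  + (1156 + 576 + 1296 * L) * t ^+ 2 * law k (mu 9).
Proof.
have := law_sq_step (Dr := drift3) kN (@mart3_perm k) (@mart3_perm k.+1) (s0 := s0).
move=> /(_ (mart3_drift _)) h; apply: le_trans (h _) _.
  by apply: perm_invB => //; exact: mart3_perm.
rewrite -addrA lerD2l
  [leRHS](_ : _ = 1156 * t ^+ 2 * law k (mu 9) +
    (576 + 1296 * L) * t ^+ 2 * law k (mu 9)); last by ring.
apply: lerD jump3_le.
apply: le_trans (_ : n * ((34 * t ^+ 2) ^+ 2 * law k (mu 9)) <= _).
  by rewrite ler_wpM2l // -lawZ; apply: ler_law => l gl; exact: drift3_le.
rewrite mulrA; apply: ler_wpM2r; first by apply: law_ge0 => l _; exact: mu_ge0.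
have -> : n * (34 * t ^+ 2) ^+ 2 = 1156 * t ^+ 2 * t by rewrite /t; field; rewrite gt_eqF.
by rewrite -[leRHS]mulr1; apply: ler_wpM2l; [pos | exact: t_le1].
Qed.

End step.
End concentration.

(** * Concentration of the third moment *)

Lemma gronwall (R : realType) (N K : nat) (c d : R) (a : nat -> R) :
  (0 < N)%N -> (K <= N)%N -> 0 <= c -> 0 <= d -> 0 <= a 0%N ->
  (forall k, (k < K)%N -> a k.+1 <= (1 + c / N%:R) * a k + d) ->
  forall k, (k <= K)%N -> a k <= expR c * (a 0%N + N%:R * d).
Proof.
move=> N0 KN c0 d0 a0 step.
have n0 : 0 < N%:R :> R by rewrite ltr0n.
have g1 : 1 <= 1 + c / N%:R by rewrite lerDl divr_ge0.
have grow k : (k <= K)%N -> a k <= (1 + c / N%:R) ^+ k * (a 0%N + k%:R * d).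
  elim: k => [|k IH] kK; first by rewrite expr0 mul1r mul0r addr0.
  apply: le_trans (step _ kK) _.
  have := ler_wpM2l (le_trans ler01 g1) (IH (ltnW kK)).
  rewrite mulrA -exprS => h.
  have e1 : 1 <= (1 + c / N%:R) ^+ k.+1 by rewrite exprn_ege1.
  rewrite -(natr1 k) [(_ + 1) * d]mulrDl mul1r addrA [leRHS]mulrDr; apply: lerD => //.
  by rewrite -[leLHS]mul1r ler_wpM2r.
move=> k kK; apply: le_trans (grow _ kK) _; apply: ler_pM.
- by rewrite exprn_ge0 // (le_trans ler01).
- by rewrite addr_ge0 // mulr_ge0.
- apply: le_trans (_ : expR (c / N%:R) ^+ k <= _).
    by rewrite lerXn2r ?nnegrE ?expR_ge0 ?expR_ge1Dx // (le_trans ler01).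
  rewrite -expRM_natl ler_expR mulrA ler_pdivrMr // mulrC ler_wpM2l //.
  by rewrite ler_nat (leq_trans kK).
- by rewrite lerD2l ler_wpM2r // ler_nat (leq_trans kK).
Qed.

Definition mu9_const (R : realType) (L : R) := expR (512 * L).

(** 1732 + 1296 L is the constant of [mart3_step] and exceeds that of [mart4_step]; the first factor
    comes from (x + y)^2 <= 2 x^2 + 2 y^2 in [law_mu3]. *)
Definition mu3_const (R : realType) (L : R) :=
  (2 * L ^+ 6 + 18 * L ^+ 8) * (expR 1 * ((1732 + 1296 * L) * mu9_const L)).

Section concentration.
Variables (R : realType) (N K : nat) (L : R).
Hypotheses (KN : (K < N)%N) (NL : N%:R <= L * (N - K)%:R).
Local Notation law := (@law R N).
Local Notation n := (N%:R : R).
Local Notation mu := (@mu R N).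

Let n_gt0 : 0 < n. Proof. by rewrite ltr0n; lia. Qed.

Let L_gt0 : 0 < L.
Proof.
have s0 : 0 < (N - K)%:R :> R by rewrite ltr0n; lia.
by rewrite -(pmulr_lgt0 _ s0); apply: lt_le_trans NL.
Qed.

Let NLk k : (k <= K)%N -> n <= L * (N - k)%:R.
Proof.
by move=> kK; apply: le_trans NL _; rewrite (ler_wpM2l (ltW L_gt0)) // ler_nat; lia.
Qed.

Lemma law_mu9 k : (k <= K)%N -> law k (mu 9) <= mu9_const L.
Proof.
move=> kK.
have := @gronwall R N K (512 * L) 0 (fun k => law k (mu 9)).
rewrite /= law0 mulr0 addr0 => h.
have m0 : mu 9 (nseq N 1%N) = 1.
  rewrite /mu big_nseq expr1n iter_addr_0.
  by rewrite divff // gt_eqF.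
rewrite m0 mulr1 in h; apply: h kK => [||||| {}k kK].
- exact: leq_ltn_trans KN.
- exact: ltnW.
- by apply: mulr_ge0; [exact: ler0n | exact: ltW].
- exact: lexx.
- exact: ler01.
rewrite addr0.
apply: le_trans (@law_mu_step R N 9 k isT (leq_ltn_trans kK KN)) _.
apply: ler_wpM2r; first by apply: law_ge0 => l _; exact: mu_ge0.
rewrite lerD2l; have s0 : 0 < (N - k.+1)%:R :> R by rewrite ltr0n; lia.
have -> : 2 ^+ 9 = 512 :> R by ring.
rewrite ler_pdivrMr // -mulrA mulrAC mulrA ler_pdivlMr // -mulrA.
by apply: ler_wpM2l; [exact: ler0n | rewrite mulrC NLk].
Qed.

Lemma law_mart4 k : (k <= K)%N ->
  law k (fun l => (mart4 R N k l - 1) ^+ 2) <=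
  expR 1 * ((1732 + 1296 * L) * mu9_const L) / n.
Proof.
move=> kK.
have c0 : 0 <= mu9_const L by rewrite expR_ge0.
have := @gronwall R N K 1 ((1732 + 1296 * L) * mu9_const L / n ^+ 2)
   (fun k => law k (fun l => (mart4 R N k l - 1) ^+ 2)).
rewrite law0.
have -> : mart4 R N 0 (nseq N 1%N) = 1 :> R.
  rewrite /mart4 /mu big_nseq expr1n iter_addr_0 subn0.
  by rewrite divff ?gt_eqF // !expr1n mulr1.
rewrite subrr expr0n /= add0r => h.
have -> : expR 1 * ((1732 + 1296 * L) * mu9_const L) / n =
   expR 1 * (n * ((1732 + 1296 * L) * mu9_const L / n ^+ 2)).
  by field; rewrite gt_eqF.
apply: h kK => [||||| {}k kK].
- exact: leq_ltn_trans KN.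
- exact: ltnW.
- exact: ler01.
- by pos.
- exact: lexx.
have kN := leq_ltn_trans kK KN.
have := mart4_step kN (NLk kK) 1; rewrite mul1r => h'; apply: le_trans h' _.
rewrite lerD2l -exprVn [leRHS]mulrAC; apply: ler_pM.
- by pos.
- by apply: law_ge0 => l _; exact: mu_ge0.
- by apply: ler_wpM2r; [pos | move: L_gt0; lra].
- exact/law_mu9/ltnW.
Qed.

Lemma law_mart3 k : (k <= K)%N ->
  law k (fun l => (mart3 R N k l - (-2)) ^+ 2) <=
  expR 1 * ((1732 + 1296 * L) * mu9_const L) / n.
Proof.
move=> kK.
have c0 : 0 <= mu9_const L by rewrite expR_ge0.
have := @gronwall R N K 1 ((1732 + 1296 * L) * mu9_const L / n ^+ 2)
   (fun k => law k (fun l => (mart3 R N k l - (-2)) ^+ 2)).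
rewrite law0.
have -> : mart3 R N 0 (nseq N 1%N) = -2 :> R.
  rewrite /mart3 /mu !big_nseq !expr1n !iter_addr_0 subn0.
  by rewrite divff ?gt_eqF // !expr1n mul1r mulr1; ring.
rewrite subrr expr0n /= add0r => h.
have -> : expR 1 * ((1732 + 1296 * L) * mu9_const L) / n =
   expR 1 * (n * ((1732 + 1296 * L) * mu9_const L / n ^+ 2)).
  by field; rewrite gt_eqF.
apply: h kK => [||||| {}k kK].
- exact: leq_ltn_trans KN.
- exact: ltnW.
- exact: ler01.
- by pos.
- exact: lexx.
have kN := leq_ltn_trans kK KN.
have := mart3_step kN (NLk kK) (-2); rewrite mul1r => h'; apply: le_trans h' _.
rewrite lerD2l -exprVn [leRHS]mulrAC; apply: ler_pM.
- by pos.
- by apply: law_ge0 => l _; exact: mu_ge0.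
- by apply: ler_wpM2r; [pos | move: L_gt0; lra].
- exact/law_mu9/ltnW.
Qed.

(** Solving [mart4] = 1 and [mart3] = -2, their values at time 0, for [mu 3] gives 3 u^4 - 2 u^3. *)
Lemma law_mu3 k : (k <= K)%N ->
  law k (fun l => (mu 3 l - (3 * (n / (N - k)%:R) ^+ 4 - 2 * (n / (N - k)%:R) ^+ 3)) ^+ 2)
  <= mu3_const L / n.
Proof.
move=> kK; have r0 : 0 < (N - k)%:R :> R by rewrite ltr0n; lia.
set u := n / (N - k)%:R.
have u0 : 0 <= u by rewrite divr_ge0.
have uL : u <= L by rewrite ler_pdivrMr // NLk.
have L0 : 0 <= L by exact: ltW.
apply: le_trans (_ : 2 * L ^+ 6 * law k (fun l => (mart3 R N k l - (-2)) ^+ 2) +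
   18 * L ^+ 8 * law k (fun l => (mart4 R N k l - 1) ^+ 2) <= _); last first.
  rewrite /mu3_const -[leRHS]mulrA [leRHS]mulrDl; apply: lerD;
    rewrite ler_wpM2l ?law_mart3 ?law_mart4 //.
    by rewrite mulr_ge0 // exprn_ge0.
  by rewrite mulr_ge0 // exprn_ge0.
rewrite -!lawZ -lawD; apply: ler_law => l _.
have -> : mu 3 l - (3 * u ^+ 4 - 2 * u ^+ 3) =
    u ^+ 3 * (mart3 R N k l - (-2)) + 3 * u ^+ 4 * (mart4 R N k l - 1).
  by rewrite /mart3 /mart4 /u; field; rewrite !gt_eqF.
set a := mart3 R N k l - _; set b := mart4 R N k l - _.
apply: le_trans (_ : 2 * (u ^+ 6 * a ^+ 2) + 18 * (u ^+ 8 * b ^+ 2) <= _).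
  rewrite -subr_ge0 (_ : _ - _ = (u ^+ 3 * a - 3 * u ^+ 4 * b) ^+ 2) ?sqr_ge0 //.
  by ring.
apply: lerD; rewrite -[leRHS]mulrA ler_wpM2l // ler_wpM2r ?sqr_ge0 //.
  by rewrite lerXn2r ?nnegrE.
by rewrite lerXn2r ?nnegrE.
Qed.

End concentration.

(** * Potentials for one walk *)

(** The empty sites are the partial sums of the gaps, counted from a root that is itself empty and
    appears both as 0 and as [sumn l]. The walk thus lives on an interval with absorbing ends and
    never wraps around. *)
Fixpoint bdry (l : seq nat) (j : nat) : bool :=
  (j == 0%N) || (if l is a :: l' then (a <= j)%N && bdry l' (j - a) else false).

Fixpoint bdry_idx (l : seq nat) (j : nat) : nat :=
  if l is a :: l' then if (a <= j)%N then (bdry_idx l' (j - a)).+1 else 0 else 0.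

(** The counter c is not reset between particles: it is the total displacement so far. The result is
    [None] when the bits run out. *)
Fixpoint settle (l : seq nat) (j c : nat) (bs : seq bool) : option (nat * nat) :=
  if bdry l j then Some (j, c)
  else if bs is b :: bs' then settle l (if b then j.+1 else j.-1) c.+1 bs'
  else None.

Lemma bdry0 l : bdry l 0. Proof. by case: l. Qed.

Lemma bdry_sumn l : bdry l (sumn l).
Proof. by elim: l => //= a l IH; rewrite leq_addr addKn IH orbT. Qed.

(** * Averages over finitely many fair bits *)

Section bit_average.
Variable R : realFieldType.
Implicit Types F G : seq bool -> R.

Fixpoint bit_avg J F : R :=
  if J is J'.+1 then
    (bit_avg J' (fun bs => F (true :: bs)) + bit_avg J' (fun bs => F (false :: bs))) / 2
  else F [::].

Lemma ler_bit_avg J F G :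
  (forall bs, size bs = J -> F bs <= G bs) -> bit_avg J F <= bit_avg J G.
Proof.
elim: J F G => [|J IH] F G le /=; first exact: le.
by rewrite ler_pM2r ?invr_gt0 // lerD // IH // => bs sb; rewrite le //= sb.
Qed.

Lemma bit_avgD J F G : bit_avg J (fun bs => F bs + G bs) = bit_avg J F + bit_avg J G.
Proof. by elim: J F G => //= J IH F G; rewrite !IH; field. Qed.

Lemma bit_avgZ J c F : bit_avg J (fun bs => c * F bs) = c * bit_avg J F.
Proof. by elim: J F => //= J IH F; rewrite !IH; field. Qed.

(* Optional stopping for the walk killed after J steps *)
Lemma settle_avg_le l (F : option (nat * nat) -> R) (h : nat -> nat -> R) e :
  (forall j c, (j <= sumn l)%N -> bdry l j -> F (Some (j, c)) <= h j c) ->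
  (forall j c, (j <= sumn l)%N -> ~~ bdry l j ->
     (h j.+1 c.+1 + h j.-1 c.+1) / 2 <= h j c) ->
  (forall j, (j <= sumn l)%N -> ~~ bdry l j -> F None <= h j e) ->
  forall J c j, (c + J = e)%N -> (j <= sumn l)%N ->
  bit_avg J (fun bs => F (settle l j c bs)) <= h j c.
Proof.
move=> hb hs he J; elim: J => [|J IH] c j ce jl /=.
  by case: ifPn => bj; [exact: hb | rewrite -ce addn0 in he; exact: he].
have [bj|bj] := boolP (bdry l j).
  apply: le_trans (hb _ _ jl bj).
  have const : bit_avg J (fun=> F (Some (j, c))) = F (Some (j, c)).
    rewrite -[LHS]/(bit_avg J (fun bs => F (Some (j, c)))).
    by elim: J {IH ce} => //= J ->; field.
  by rewrite !const; lra.
apply: le_trans (hs _ _ jl bj).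
have j0 : j != 0%N by apply: contraNneq bj => ->; exact: bdry0.
have jN : j != sumn l by apply: contraNneq bj => ->; exact: bdry_sumn.
by rewrite ler_pM2r ?invr_gt0 // lerD // IH //; lia.
Qed.

End bit_average.

(** * Potentials glued together from the gaps *)

Section piecewise.
Variable R : realFieldType.
Implicit Types (psi : nat -> nat -> nat -> R).

(** [psi i a t] is the potential at position t of gap number i, of length a. A boundary point is
    given to the gap on its left; [matching] says that the gap on its right agrees. *)
Fixpoint piecewise psi (i : nat) (l : seq nat) (j : nat) : R :=
  if l is a :: l' then
    if (j <= a)%N then psi i a j else piecewise psi i.+1 l' (j - a)%N
  else 0.

Definition matching psi := forall i a b, (0 < a)%N -> (0 < b)%N ->
  psi i a a = psi i.+1 b 0%N.

Lemma piecewise_ind (P : R -> Prop) psi i l j : (0 < sumn l)%N -> (j <= sumn l)%N ->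
  (forall i a t, a \in l -> (t <= a)%N -> P (psi i a t)) -> P (piecewise psi i l j).
Proof.
elim: l i j => //= a l IH i j l0 jl Ppsi; case: ifPn => ja.
  by apply: Ppsi; rewrite ?mem_head.
by apply: IH => [||k b t bl]; [lia|lia|apply: Ppsi; rewrite inE bl orbT].
Qed.

Lemma piecewise_next psi i a l j : matching psi -> all (leq 1) (a :: l) ->
  (a <= j)%N -> (j < a + sumn l)%N ->
  piecewise psi i (a :: l) j = piecewise psi i.+1 l (j - a)%N.
Proof.
move=> m /= /andP[a0 pl] aj jl; case: ifP => // ja.
have -> : j = a by lia.
case: l pl jl => [|b l] /=; first by lia.
by move=> /andP[b0 _] _; rewrite subnn /= (m i a b).
Qed.

(** There are two potentials because the counter advances with the walk: psi' is meant to be psi at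
    the next count. *)
Lemma piecewise_superharmonic psi psi' i l j : matching psi' -> all (leq 1) l ->
  (forall i a t, (0 < t < a)%N -> (psi' i a t.+1 + psi' i a t.-1) / 2 <= psi i a t) ->
  (j < sumn l)%N -> ~~ bdry l j ->
  (piecewise psi' i l j.+1 + piecewise psi' i l j.-1) / 2 <= piecewise psi i l j.
Proof.
move=> m pl sh; elim: l i j pl => //= a l IH i j /andP[a0 pl] jl.
rewrite negb_or negb_and => /andP[j0 jb].
have [ja|aj] := leqP j a.
  have ja' : (j < a)%N.
    rewrite ltn_neqAle ja andbT; apply: contraTneq jb => ->.
    by rewrite leqnn subnn bdry0.
  by rewrite ja' (leq_trans (leq_pred _) ja) sh //; lia.
rewrite (leq_gtF (ltnW aj)).
have -> : (if (j.-1 <= a)%N then psi' i a j.-1 else piecewise psi' i.+1 l (j.-1 - a)) =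
    piecewise psi' i.+1 l (j - a).-1.
  rewrite -[LHS]/(piecewise psi' i (a :: l) j.-1) piecewise_next //=; try lia.
    by congr piecewise; lia.
rewrite subSn ?(ltnW aj) //; apply: IH => //; first by lia.
by move: jb; rewrite (ltnW aj).
Qed.

Lemma piecewise_bdry psi (v : nat -> R) i l j : all (leq 1) l ->
  l != [::] ->
  (forall i a, (0 < a)%N -> psi i a 0%N = v i /\ psi i a a = v i.+1) ->
  (j <= sumn l)%N -> bdry l j -> piecewise psi i l j = v (i + bdry_idx l j)%N.
Proof.
move=> pl l0 hv; elim: l l0 i j pl => //= a l IH _ i j /andP[a0 pl] jl bj.
have [<-|j0] := eqVneq 0%N j.
  by rewrite /= leqNgt a0 addn0; case: (hv i a).
have {}bj : (a <= j)%N && bdry l (j - a) by move: bj; rewrite eq_sym (negbTE j0).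
have /andP[aj bj'] := bj; rewrite aj.
have [ja|ja] := leqP j a.
  have -> : j = a by lia.
  rewrite subnn (_ : bdry_idx l 0 = 0%N) ?addn1; first by case: (hv i a).
  by case: l pl {IH jl bj bj'} => //= b l /andP[b0 _]; rewrite leqNgt b0.
have l0 : l != [::] by apply: contraTneq jl => -> /=; lia.
by rewrite (IH l0) ?addSnnS //; lia.
Qed.

Lemma sum_piecewise psi i l : matching psi -> all (leq 1) l ->
  \sum_(j < sumn l) piecewise psi i l j =
  \sum_(k < size l) \sum_(t < nth 0%N l k) psi (i + k)%N (nth 0%N l k) t.
Proof.
move=> m; elim: l i => [|a l IH] i pl; first by rewrite !big_ord0.
have /andP[a0 pl'] := pl.
rewrite /sumn -/sumn big_split_ord /= big_ord_recl /= addn0; congr (_ + _).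
  by apply: eq_bigr => t _; rewrite ltnW.
transitivity (\sum_(j < sumn l) piecewise psi i.+1 l j).
  apply: eq_bigr => j _; rewrite -[LHS]/(piecewise psi i (a :: l) (a + j)).
  by rewrite piecewise_next ?leq_addr ?ltn_add2l // addKn.
by rewrite IH //; apply: eq_bigr => k _; rewrite /bump add1n addSnnS.
Qed.

Lemma sum_ord_natr a : \sum_(t < a) t%:R = a%:R * (a%:R - 1) / 2 :> R.
Proof.
elim: a => [|a IH]; first by rewrite big_ord0 mul0r mul0r.
by rewrite big_ord_recr /= IH -natr1; field.
Qed.

Lemma sum_ord_sqr a :
  \sum_(t < a) t%:R ^+ 2 = a%:R * (a%:R - 1) * (2 * a%:R - 1) / 6 :> R.
Proof.
elim: a => [|a IH]; first by rewrite big_ord0 !mul0r.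
by rewrite big_ord_recr /= IH -natr1; field.
Qed.

Lemma sum_ord_const a (c : R) : \sum_(t < a) c = a%:R * c.
Proof. by rewrite sumr_const card_ord mulr_natl. Qed.

End piecewise.

(* The position in l of the gap that ends at the boundary point j; the
   boundary point 0 ends the last gap. *)
Definition left_gap (l : seq nat) j :=
  if bdry_idx l j is i.+1 then i else (size l).-1.

Definition fill (l : seq nat) j := merge_head (rot (left_gap l j) l).

(** * The drop of one particle *)

Section kernel.
Variables (R : realFieldType) (N J : nat).
Local Notation n := (N%:R : R).
Implicit Types (F : option (nat * nat) -> R) (G : seq nat -> R).

Definition drop_avg l c F : R :=
  (\sum_(j < N) bit_avg J (fun bs => F (settle l j c bs))) / n.

(** The transition of the gaps without the cut-off, which bounds the true one by [drop_avg_fill]. *)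
Definition merge_avg G l : R :=
  (\sum_(i < size l) (gap1 R (rot i l) + gap2 R (rot i l)) / 2 * G (merge_head (rot i l))) / n.

Lemma merge_avg_rot_inv G : rot_inv (merge_avg G).
Proof.
move=> l; rewrite /merge_avg size_rot; congr (_ / n).
case: l => [|a l]; first by rewrite !big_ord0.
set l1 := a :: l; pose Phi l := (gap1 R l + gap2 R l) / 2 * G (merge_head l).
rewrite -[LHS]/(\sum_(i < size l1) Phi (rot i (rot 1 l1))).
rewrite -[RHS]/(\sum_(i < size l1) Phi (rot i l1)).
transitivity (\sum_(i < size l1) Phi (rot i.+1 l1)).
  apply: eq_bigr => i _; congr Phi.
  by rewrite -rotD ?addn1 // addn1; exact: ltn_ord.
rewrite [LHS]big_ord_recr [RHS]big_ord_recl /= addrC; congr (_ + _).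
by rewrite rot0 rot_oversize.
Qed.

Lemma merge_avg_ge0 G l : (forall l', 0 <= G l') -> 0 <= merge_avg G l.
Proof.
move=> G0; rewrite divr_ge0 // sumr_ge0 // => i _.
by rewrite mulr_ge0 // divr_ge0 // addr_ge0 // ?gap1_ge0 ?gap2_ge0.
Qed.

Lemma nth0_rot (l : seq nat) i : (i < size l)%N -> nth 0%N (rot i l) 0 = nth 0%N l i.
Proof. by move=> il; rewrite /rot nth_cat size_drop subn_gt0 il nth_drop addn0. Qed.

Lemma nth1_rot (l : seq nat) i : (1 < size l)%N -> (i < size l)%N ->
  nth 0%N (rot i l) 1 = nth 0%N l (if (i.+1 < size l)%N then i.+1 else 0).
Proof.
move=> l1 il; rewrite /rot nth_cat size_drop ltn_subRL addn1 nth_drop addn1.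
case: ifP => // h; rewrite (_ : 1 - _ = 0)%N; last by lia.
by rewrite nth_take //; lia.
Qed.

Lemma drop_avg_fill k l c G : (k.+1 < N)%N -> gaps N k l -> (forall l', 0 <= G l') ->
  drop_avg l c (fun o => if o is Some (j, _) then G (fill l j) else 0) <= merge_avg G l.
Proof.
move=> kN [sl pl sN] G0.
rewrite /drop_avg /merge_avg ler_wpM2r ?invr_ge0 //.
(* The value of G once the left end of gap i is filled; for i = 0 this end is the root, where the
   last gap ends. *)
pose v i := G (merge_head (rot (if i is i'.+1 then i' else (size l).-1) l)).
(* The harmonic interpolation of v on each gap *)
pose psi i a t : R := ((a%:R - t%:R) * v i + t%:R * v i.+1) / a%:R.
have v0 i : 0 <= v i by exact: G0.
have match_psi : matching psi.
  move=> i a b a0 b0; rewrite /psi.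
  by field; rewrite !pnatr_eq0 -!lt0n b0 a0.
have l0 : l != [::] by apply: contraTneq kN => l0; rewrite l0 /= in sl; lia.
have bnd j : (j <= sumn l)%N -> bdry l j -> piecewise psi 0 l j = v (bdry_idx l j).
  move=> jl bj; rewrite (@piecewise_bdry _ psi v) // => i a a0.
  rewrite /psi; split; field; by rewrite pnatr_eq0 -lt0n.
apply: (@le_trans _ _ (\sum_(j < N) piecewise psi 0 l j)).
  apply: ler_sum => j _.
  pose F (o : option (nat * nat)) := if o is Some (j, _) then G (fill l j) else 0.
  apply: (@settle_avg_le _ l F (fun j _ => piecewise psi 0 l j) (c + J)) => //.
  - by move=> i c' il bi; rewrite bnd.
  - move=> i c' il bi.
    apply: piecewise_superharmonic => //.
      move=> m a t /andP[t0 ta]; rewrite /psi.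
      rewrite -mulrDl mulrAC ler_wpM2r ?invr_ge0 // -(natr1 t).
      have -> : t%:R = t.-1%:R + 1 :> R by rewrite natr1 prednK.
      lra.
    rewrite ltn_neqAle il andbT; apply: contraNneq bi => ->; exact: bdry_sumn.
  - move=> i il _; apply: (@piecewise_ind _ (fun y => F None <= y)) => // [|m a t al ta];
    first by rewrite sN; lia.
    by rewrite /psi divr_ge0 // addr_ge0 // mulr_ge0 // subr_ge0 ler_nat.
  - by rewrite sN ltnW.
rewrite -[N in leLHS]sN sum_piecewise //.
(* A gap owns its left end but not its right one, whence a + 1 on the left and a - 1 on the right;
   at each empty site the two shares add up to half the sum of the adjacent gaps. *)
have -> : \sum_(i < size l) \sum_(t < nth 0%N l i) psi (0 + i)%N (nth 0%N l i) t =
   \sum_(i < size l) ((nth 0%N l i)%:R + 1) / 2 * v i +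
   \sum_(i < size l) ((nth 0%N l i)%:R - 1) / 2 * v i.+1.
  rewrite -big_split /=; apply: eq_bigr => i _; rewrite add0n.
  have a0 : (0 < nth 0%N l i)%N by apply: (allP pl); rewrite mem_nth.
  move: (nth 0%N l i) a0 => a a0.
  rewrite /psi -mulr_suml big_split /= -!mulr_suml sumrB sum_ord_const sum_ord_natr.
  by field; rewrite pnatr_eq0 -lt0n.
have -> : \sum_(i < size l) ((nth 0%N l i)%:R + 1) / 2 * v i =
   \sum_(i < size l) ((nth 0%N (rot i l) 1)%:R + 1) / 2 * v i.+1.
  have [r rE] : exists r, size l = r.+2 by exists (size l).-2; lia.
  rewrite rE [LHS]big_ord_recl [RHS]big_ord_recr addrC /=; congr (_ + _).
    apply: eq_bigr => i _; have ir := ltn_ord i.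
    rewrite nth1_rot ?rE //=; last by lia.
    by rewrite /bump /= add1n ifT.
  by rewrite nth1_rot ?rE // ltnn /v rE.
rewrite -big_split /= le_eqVlt; apply/orP; left; apply/eqP; apply: eq_bigr => i _.
by rewrite /gap1 /gap2 nth0_rot // /v; field.
Qed.

Lemma sum_gap_pow k l p : gaps N k l ->
  \sum_(i < size l) (nth 0%N l i)%:R ^+ p = n * mu R N p l.
Proof.
move=> [sl pl sN]; rewrite /mu big_nth0 mulrCA.
have [N0|N0] := posnP N.
  have -> : l = [::] by apply/nilP; rewrite /nilp sl N0.
  by rewrite big_ord0 mul0r.
by rewrite divff ?mulr1 // pnatr_eq0 -lt0n.
Qed.

(** The square is treated as a whole because c' - x may be negative. A bound on the displacement
    from below would suffer from the cut-off; the nonnegative square does not. *)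
Lemma drop_avg_sqr k l c (x : R) : (k.+1 < N)%N -> gaps N k l ->
  drop_avg l c (fun o => if o is Some (_, c') then (c'%:R - x) ^+ 2 else 0) <=
  (c%:R - x) ^+ 2 + 2 * (c%:R - x) * ((mu R N 3 l - 1) / 6) + mu R N 5 l / 12.
Proof.
move=> kN gl; have [sl pl sN] := gl.
have n0 : 0 < n by rewrite ltr0n; lia.
pose phi a t : R := t%:R * (a%:R - t%:R).
(* phi is the mean exit time from the gap. The last summand dominates both the
   second moment of the exit time and phi ^+ 2, so psi is nonnegative. *)
pose psi c (i a t : nat) : R := (c%:R - x) ^+ 2 + 2 * (c%:R - x) * phi a t +
   a%:R ^+ 2 / 2 * phi a t.
have match_psi c' : matching (psi c').
  by move=> i a b _ _; rewrite /psi /phi subrr mulr0 mul0r !mulr0.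
have l0 : l != [::] by apply: contraTneq kN => l0; rewrite l0 /= in sl; lia.
have bnd j c' : (j <= sumn l)%N -> bdry l j -> piecewise (psi c') 0 l j = (c'%:R - x) ^+ 2.
  move=> jl bj; rewrite (@piecewise_bdry _ _ (fun=> (c'%:R - x) ^+ 2)) // => i a a0.
  by rewrite /psi /phi subrr mulr0 mul0r !mulr0 !addr0.
rewrite /drop_avg ler_pdivrMr //.
apply: (@le_trans _ _ (\sum_(j < N) piecewise (psi c) 0 l j)).
  apply: ler_sum => j _.
  pose F (o : option (nat * nat)) := if o is Some (_, c') then (c'%:R - x) ^+ 2 else 0.
  apply: (@settle_avg_le _ l F (fun j c => piecewise (psi c) 0 l j) (c + J)) => //.
  - by move=> i c' il bi; rewrite bnd.
  - move=> i c' il bi.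
    apply: piecewise_superharmonic => //.
      move=> m a t /andP[t0 ta]; rewrite /psi /phi -(natr1 t) -(natr1 c').
      have -> : t%:R = t.-1%:R + 1 :> R by rewrite natr1 prednK.
      have h : 0 <= (a%:R - 2 * (t.-1%:R + 1)) ^+ 2 :> R by exact: sqr_ge0.
      rewrite -subr_ge0; have := addr_ge0 ler01 (divr_ge0 h (ler0n R 2)).
      by congr (0 <= _); field.
    rewrite ltn_neqAle il andbT; apply: contraNneq bi => ->; exact: bdry_sumn.
  - move=> i il _; apply: (@piecewise_ind _ (fun y => F None <= y)) => // [|m a t al ta];
    first by rewrite sN; lia.
    rewrite /psi; set d := _ - x.
    have phi0 : 0 <= phi a t by rewrite mulr_ge0 // subr_ge0 ler_nat.
    have phia : phi a t <= a%:R ^+ 2 / 2.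
      rewrite /phi; have := sqr_ge0 (a%:R - 2 * t%:R : R).
      have := sqr_ge0 (a%:R : R); move: (a%:R) (t%:R) => a' t'; nra.
    have := ler_wpM2r phi0 phia; have := sqr_ge0 (d + phi a t).
    by rewrite /F; move: (phi a t) => p; nra.
  - by rewrite sN ltnW.
rewrite -[N in leLHS]sN sum_piecewise //.
(* The mean exit times t (a - t) of one gap add up to (a^3 - a) / 6. *)
have -> : \sum_(i < size l) \sum_(t < nth 0%N l i) psi c (0 + i)%N (nth 0%N l i) t =
   \sum_(i < size l) ((c%:R - x) ^+ 2 * (nth 0%N l i)%:R ^+ 1 +
      (c%:R - x) / 3 * ((nth 0%N l i)%:R ^+ 3 - (nth 0%N l i)%:R ^+ 1) +
      ((nth 0%N l i)%:R ^+ 5 - (nth 0%N l i)%:R ^+ 3) / 12).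
  apply: eq_bigr => i _; move: (nth 0%N l i) => a.
  rewrite /psi /phi.
  transitivity (\sum_(t < a) ((c%:R - x) ^+ 2 +
      (2 * (c%:R - x) + a%:R ^+ 2 / 2) * (a%:R * t%:R - t%:R ^+ 2))).
    by apply: eq_bigr => t _; field.
  rewrite big_split /= sum_ord_const -mulr_sumr sumrB -mulr_sumr sum_ord_natr sum_ord_sqr.
  by field.
rewrite big_split /= big_split /= -!mulr_sumr -mulr_suml !sumrB !(sum_gap_pow _ gl).
rewrite (mu1 _ _ gl); last by lia.
have := mu_ge0 R N 3 l; move: (mu R N 3 l) (mu R N 5 l) => m3 m5 m30.
rewrite -subr_ge0 (_ : _ - _ = n * m3 / 12); first by rewrite divr_ge0 // mulr_ge0 // ltW.
by field.
Qed.

(** Markov's inequality: the potential is the elapsed time plus the mean remaining time, over J. It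
    is at least 1 when the walk is cut off and at most N^2 / J at the start. *)
Lemma drop_avg_dead k l c : (k.+1 < N)%N -> (0 < J)%N -> gaps N k l ->
  drop_avg l c (fun o => (o == None)%:R) <= n ^+ 2 / J%:R.
Proof.
move=> kN J0 gl; have [sl pl sN] := gl.
have n0 : 0 < n by rewrite ltr0n; lia.
pose phi a t : R := t%:R * (a%:R - t%:R).
pose psi d (i a t : nat) : R := ((d - c)%N%:R + phi a t) / J%:R.
have jr : 0 < J%:R :> R by rewrite ltr0n.
have match_psi c' : matching (psi c').
  by move=> i a b _ _; rewrite /psi /phi subrr mulr0 mul0r.
have l0 : l != [::] by apply: contraTneq kN => l0; rewrite l0 /= in sl; lia.
have psi_ge0 d i a t : (t <= a)%N -> 0 <= psi d i a t.
  by move=> ta; rewrite divr_ge0 // addr_ge0 // mulr_ge0 // subr_ge0 ler_nat.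
rewrite /drop_avg ler_pdivrMr //.
apply: (@le_trans _ _ (\sum_(j < N) n ^+ 2 / J%:R)); last first.
  by rewrite sumr_const card_ord mulr_natr.
apply: ler_sum => j _.
apply: (@le_trans _ _ (piecewise (psi c) 0 l j)); last first.
  apply: (@piecewise_ind _ (fun y => y <= _)); [by rewrite sN; lia|by rewrite sN ltnW|].
  move=> m a t al ta; rewrite /psi subnn add0r ler_wpM2r ?invr_ge0 //.
  have aN : (a <= N)%N by
    rewrite -sN; elim: (l) al => //= b l' IH; rewrite inE => /orP[/eqP->|/IH]; lia.
  rewrite expr2; apply: ler_pM => //.
  - by rewrite subr_ge0 ler_nat.
  - by rewrite ler_nat (leq_trans ta).
  - by apply: le_trans (_ : a%:R <= _); rewrite ?ler_nat // gerBl.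
pose F (o : option (nat * nat)) : R := (o == None)%:R.
apply: (@settle_avg_le _ l F (fun j d => piecewise (psi d) 0 l j) (c + J)) => //.
- by move=> i c' il bi; apply: (@piecewise_ind _ (fun y => 0 <= y)) => // [|m a t al ta];
    [rewrite sN; lia|exact: psi_ge0].
- move=> i c' il bi.
  apply: piecewise_superharmonic => //.
    move=> m a t /andP[t0 ta]; rewrite /psi /phi -mulrDl mulrAC ler_wpM2r ?invr_ge0 //.
    have : (c'.+1 - c)%N%:R <= (c' - c)%N%:R + 1 :> R by rewrite natr1 ler_nat; lia.
    rewrite -(natr1 t); have -> : t%:R = t.-1%:R + 1 :> R by rewrite natr1 prednK.
    by move: (a%:R) (t.-1%:R) => a' t'; nra.
  rewrite ltn_neqAle il andbT; apply: contraNneq bi => ->; exact: bdry_sumn.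
- move=> i il _; apply: (@piecewise_ind _ (fun y => F None <= y)) => // [|m a t al ta];
    first by rewrite sN; lia.
  rewrite /psi addKn ler_pdivlMr // mul1r lerDl mulr_ge0 // subr_ge0 ler_nat //.
- by rewrite sN ltnW.
Qed.

End kernel.

(** * The truncated process *)

Section circle.
Variable n : nat.
Local Notation N := n.+1.
Implicit Types (o x : 'I_N).

Definition site o j : 'I_N := iter j (@ordS N) o.
Definition coord o x : nat := ((x + (N - o)) %% N)%N.

Lemma val_site o j : val (site o j) = ((o + j) %% N)%N.
Proof.
elim: j => [|j IH]; first by rewrite addn0 modn_small.
have succ m p : ((m %% p).+1 = m.+1 %[mod p])%N by rewrite -addn1 modnDml addn1.
by rewrite -[LHS]/((val (site o j)).+1 %% N)%N IH succ addnS.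
Qed.

Lemma coord_lt o x : (coord o x < N)%N.
Proof. exact: ltn_pmod. Qed.

Lemma site_coord o x : site o (coord o x) = x.
Proof.
apply: val_inj; rewrite val_site /coord modnDmr addnCA subnKC; last exact/ltnW/ltn_ord.
by rewrite modnDr modn_small.
Qed.

Lemma coord_inj o : injective (coord o).
Proof. by move=> x y e; rewrite -(site_coord o x) e site_coord. Qed.

Lemma sum_coord (V : nmodType) o (F : nat -> V) :
  \sum_(x < N) F (coord o x) = \sum_(j < N) F j.
Proof.
have inj : injective (fun x : 'I_N => Ordinal (coord_lt o x)).
  by move=> x y [] /coord_inj.
by rewrite [RHS](reindex_inj inj).
Qed.

Lemma site_add o i j : site (site o i) j = site o (i + j).
Proof. by rewrite /site addnC iterD. Qed.

Lemma siteN o : site o N = o.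
Proof. by apply: val_inj; rewrite val_site modnDr modn_small. Qed.

(* Root, gaps read clockwise from the root, and total displacement; None once
   some walk has not ended within its allotted steps. *)
Definition state := option ('I_N * seq nat * nat).

(** The root moves to the left end of the merged gap, in step with the rotation inside [fill]. *)
Definition update (st : state) (x : 'I_N) (bs : seq bool) : state :=
  if st is Some (o, l, c) then
    if settle l (coord o x) c bs is Some (j, c') then
      Some (site o (sumn (take (left_gap l j) l)), fill l j, c')
    else None
  else None.

Definition init_state : state := Some (ord0, nseq N 1%N, 0%N).

Lemma gaps_init : gaps N 0 (nseq N 1%N).
Proof. by split; [rewrite size_nseq subn0 | rewrite all_nseq | rewrite sumn_nseq mul1n]. Qed.

Definition proper k (st : state) : Prop :=
  if st is Some (_, l, _) then gaps N k l else True.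

Lemma gaps_fill k l j : (k.+1 < N)%N -> gaps N k l -> gaps N k.+1 (fill l j).
Proof.
move=> kN [sl pl sN]; rewrite /fill; set l' := rot _ l.
have sl' : size l' = (N - k)%N by rewrite size_rot.
have pl' : all (leq 1) l' by rewrite (@perm_all _ l' l) ?perm_rot.
have sN' : sumn l' = N by rewrite -[RHS]sN; apply: perm_sumn; rewrite perm_rot.
case: l' sl' pl' sN' => [|a [|b l']] /=; try lia.
by move=> h1 /and3P[a1 b1 p] s; split => /=; [lia | rewrite p addn_gt0 a1 | lia].
Qed.

Lemma proper_update k st x bs : (k.+1 < N)%N -> proper k st -> proper k.+1 (update st x bs).
Proof.
case: st => [ [ [ o l] c]|] //= kN gl; case: settle => [ [j c']|] //=.
exact: gaps_fill.
Qed.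

(** * Expectations as iterated finite averages *)

Section expectation.
Variables (R : realType) (J : nat).
Implicit Types (F G : state -> R).

Definition particle_avg F st : R :=
  (\sum_(x < N) bit_avg J (fun bs => F (update st x bs))) / N%:R.

Fixpoint expect k F : R :=
  if k is k'.+1 then expect k' (particle_avg F) else F init_state.

Lemma ler_particle_avg k F G st : (k.+1 < N)%N -> proper k st ->
  (forall st', proper k.+1 st' -> F st' <= G st') ->
  particle_avg F st <= particle_avg G st.
Proof.
move=> kN pst le; rewrite ler_wpM2r ?invr_ge0 // ler_sum // => x _.
by apply: ler_bit_avg => bs _; apply: le; exact: proper_update.
Qed.

Lemma ler_expect k F G : (k < N)%N ->
  (forall st, proper k st -> F st <= G st) -> expect k F <= expect k G.
Proof.
elim: k F G => [|k IH] F G kN le /=.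
  exact/le/gaps_init.
by apply: IH => [|st pst]; [exact: ltnW | exact: ler_particle_avg le].
Qed.

Lemma particle_avgD F G st :
  particle_avg (fun st => F st + G st) st = particle_avg F st + particle_avg G st.
Proof.
rewrite /particle_avg -mulrDl -big_split /=; congr (_ / _).
by apply: eq_bigr => x _; rewrite bit_avgD.
Qed.

Lemma particle_avgZ a F st :
  particle_avg (fun st => a * F st) st = a * particle_avg F st.
Proof.
rewrite /particle_avg mulrA mulr_sumr; congr (_ / _).
by apply: eq_bigr => x _; rewrite bit_avgZ.
Qed.

Lemma eq_particle_avg F G st : F =1 G -> particle_avg F st = particle_avg G st.
Proof.
move=> e; rewrite /particle_avg; congr (_ / _); apply: eq_bigr => x _.
by apply/eqP; rewrite eq_le !ler_bit_avg // => bs _; rewrite e.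
Qed.

Lemma eq_expect k F G : F =1 G -> expect k F = expect k G.
Proof. by elim: k F G => //= k IH F G e; apply: IH => st; apply: eq_particle_avg. Qed.

Lemma expectD k F G : expect k (fun st => F st + G st) = expect k F + expect k G.
Proof.
elim: k F G => //= k IH F G; rewrite -IH; apply: eq_expect => st.
exact: particle_avgD.
Qed.

Lemma expectZ k a F : expect k (fun st => a * F st) = a * expect k F.
Proof.
elim: k F => //= k IH F; rewrite -IH; apply: eq_expect => st.
exact: particle_avgZ.
Qed.

Definition alive (f : seq nat -> nat -> R) (st : state) : R :=
  if st is Some (_, l, c) then f l c else 0.

Lemma particle_avg_None f : particle_avg (alive f) None = 0.
Proof.
rewrite /particle_avg big1 ?mul0r // => x _ /=.
have -> : (fun=> 0) = (fun bs : seq bool => 0 * 0 : R) by rewrite mul0r.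
by rewrite bit_avgZ mul0r.
Qed.

Lemma particle_avg_alive f o l c : particle_avg (alive f) (Some (o, l, c)) =
  drop_avg N J l c (fun p => if p is Some (j, c') then f (fill l j) c' else 0).
Proof.
rewrite /particle_avg /drop_avg; congr (_ / _).
pose h (p : option (nat * nat)) := if p is Some (j, c') then f (fill l j) c' else 0.
rewrite -[RHS](sum_coord o (fun j => bit_avg J (fun bs => h (settle l j c bs)))).
apply: eq_bigr => x _; apply/eqP; rewrite eq_le !ler_bit_avg // => bs _ /=;
  by case: settle => [ [j c']|].
Qed.

(** By induction: a step is bounded by [merge_avg], a sum over rotations. Under the rotation
    invariant [law k] each of its N - k terms has the same mean, and [law_merge] leads to
    [law k.+1]. *)
Lemma expect_gaps_le k (G : seq nat -> R) : (k < N)%N -> (forall l, 0 <= G l) -> rot_inv G ->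
  expect k (alive (fun l _ => G l)) <= law N k G.
Proof.
elim: k G => [|k IH] G kN G0 Ginv; first by rewrite law0.
rewrite /=; apply: le_trans (_ : expect k (alive (fun l _ => merge_avg N G l)) <= _).
  apply: ler_expect => [|[ [ [ o l] c]|] pst]; first exact: ltnW.
    by rewrite particle_avg_alive; apply: drop_avg_fill pst G0.
  by rewrite particle_avg_None.
have {}IH := IH (merge_avg N G) (ltnW kN) (fun l => merge_avg_ge0 _ _ G0)
   (@merge_avg_rot_inv R N G).
apply: le_trans IH _.
pose Phi l := (gap1 R l + gap2 R l) / 2 * G (merge_head l).
have rE : law N k (fun l => \sum_(i < N - k) Phi (rot i l)) = (N - k)%:R * law N k Phi.
  have e (r : nat) : (r <= N - k)%N ->
      law N k (fun l => \sum_(i < r) Phi (rot i l)) = r%:R * law N k Phi.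
    elim: r => [|r IHr] rN.
      rewrite mul0r -[RHS](mul0r (law N k Phi)) -lawZ; apply: eq_law => l _.
      by rewrite big_ord0 mul0r.
    transitivity (law N k (fun l => \sum_(i < r) Phi (rot i l) + Phi (rot r l))).
      by apply: eq_law => l _; rewrite big_ord_recr.
    by rewrite lawD IHr ?(ltnW rN) // law_rot ?(ltnW rN) // -natr1 mulrDl mul1r.
  exact: e.
have -> : law N k (merge_avg N G) = N%:R^-1 * ((N - k)%:R * law N k Phi).
  rewrite -rE -lawZ; apply: eq_law => l [sl _ _].
  by rewrite /merge_avg sl mulrC.
rewrite law_merge // mulrA [N%:R^-1 * _]mulrC -lawZ; apply: ler_law => l _.
by rewrite /bias /Phi mulrA.
Qed.

Lemma expect_dead_le k : (k < N)%N -> (0 < J)%N ->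
  expect k (fun st => (st == None)%:R) <= k%:R * (N%:R ^+ 2 / J%:R).
Proof.
move=> + J0; elim: k => [|k IH] kN; first by rewrite mul0r.
have b0 : 0 <= N%:R ^+ 2 / J%:R :> R by rewrite divr_ge0 ?exprn_ge0.
rewrite -(natr1 k) mulrDl mul1r /=.
have one (c : R) : expect k (fun=> c) = c.
  elim: (k) => //= m IHm; rewrite -[RHS]IHm; apply: eq_expect => st.
  have cst : bit_avg J (fun=> c) = c by elim: (J) => //= j ->; field.
  by rewrite /particle_avg cst sum_ord_const mulrC mulKf // pnatr_eq0.
apply: le_trans (_ : expect k (fun st => (st == None)%:R + N%:R ^+ 2 / J%:R) <= _).
  apply: ler_expect => [|[ [ [ o l] c]|] pst]; first exact: ltnW.
    rewrite [X in X <= _](_ : _ = drop_avg N J l c (fun p => (p == None)%:R)).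
      by rewrite add0r; apply: drop_avg_dead kN J0 pst.
    rewrite /particle_avg /drop_avg; congr (_ / _).
    rewrite -[RHS](sum_coord o (fun j => bit_avg J (fun bs => (settle l j c bs == None)%:R))).
    apply: eq_bigr => x _; apply/eqP; rewrite eq_le !ler_bit_avg // => bs _ /=;
      by case: settle => [ [j c']|].
  rewrite eqxx -[leLHS](_ : 1 = _) ?lerDl //.
  have cst : bit_avg J (fun=> 1) = 1 :> R by elim: (J) => //= j ->; field.
  by rewrite /particle_avg /= cst sum_ord_const mulr1 divff // pnatr_eq0.
by rewrite expectD one lerD2r IH // ltnW.
Qed.

End expectation.
End circle.

(** * Concentration of the total displacement *)

Lemma limit_profileE (R : realType) (a : R) : a != 1 ->
  limit_profile a = ((1 - a)^-1 ^+ 3 - (1 - a)^-1 ^+ 2 - a) / 6.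
Proof.
move=> a1; have : 1 - a != 0 by rewrite subr_eq0 eq_sym.
by move=> h; rewrite /limit_profile; field.
Qed.

(** With u = 1 / (1 - a), v = 1 / (1 - b) and h = b - a, delta is the difference quotient of the
    limit profile and (3 u^4 - 2 u^3 - 1) / 6 its derivative at a. *)
Lemma profile_increment (R : realFieldType) (L u v h : R) :
  1 <= u -> u <= v -> v <= L -> 0 < h -> v - u = h * (u * v) ->
  let delta := h^-1 * ((v ^+ 3 - v ^+ 2) - (u ^+ 3 - u ^+ 2) - h) / 6 in
  0 <= delta <= L ^+ 4 /\
  `|delta - (3 * u ^+ 4 - 2 * u ^+ 3 - 1) / 6| <= 2 * L ^+ 5 * h.
Proof.
move=> u1 uv vL h0 vu delta.
have h_neq0 : h != 0 by rewrite gt_eqF.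
have deltaE : delta = (u * v * (v ^+ 2 + u * v + u ^+ 2) - u * v * (u + v) - 1) / 6.
  rewrite /delta.
  have -> : v ^+ 3 - v ^+ 2 - (u ^+ 3 - u ^+ 2) =
    (v - u) * (v ^+ 2 + u * v + u ^+ 2) - (v - u) * (u + v) by ring.
  by rewrite vu; field.
have v1 : 1 <= v by exact: le_trans uv.
have L1 : 1 <= L by exact: le_trans vL.
have [u0 v0 L0] : [/\ 0 <= u, 0 <= v & 0 <= L] by split; exact: le_trans ler01 _.
have uL : u <= L by exact: le_trans vL.
have uv1 : 1 <= u * v by rewrite mulr_ege1.
have b22 : u * v <= L ^+ 2 by rewrite expr2 ler_pM.
have uu : u <= u ^+ 2 by rewrite expr2 ler_peMr.
have vv : v <= v ^+ 2 by rewrite expr2 ler_peMr.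
split.
  rewrite deltaE; apply/andP; split.
    rewrite divr_ge0 //.
    have -> : u * v * (v ^+ 2 + u * v + u ^+ 2) - u * v * (u + v) - 1 =
      u * v * ((v ^+ 2 - v) + (u ^+ 2 - u)) + ((u * v) ^+ 2 - 1) by ring.
    apply: addr_ge0; last by rewrite subr_ge0 exprn_ege1.
    by apply: mulr_ge0; [exact: mulr_ge0|apply: addr_ge0; rewrite subr_ge0].
  rewrite ler_pdivrMr //.
  have : u * v * (v ^+ 2 + u * v + u ^+ 2) <= L ^+ 2 * (3 * L ^+ 2).
    apply: ler_pM => //; [by pos|by pos|].
    have : v ^+ 2 <= L ^+ 2 by rewrite lerXn2r ?nnegrE.
    have : u ^+ 2 <= L ^+ 2 by rewrite lerXn2r ?nnegrE.
    by move: b22; lra.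
  have : 0 <= u * v * (u + v) by pos.
  have -> : L ^+ 2 * (3 * L ^+ 2) = 3 * L ^+ 4 by ring.
  have : 0 <= L ^+ 4 by exact: exprn_ge0.
  by lra.
have -> : delta - (3 * u ^+ 4 - 2 * u ^+ 3 - 1) / 6 =
   (v - u) * ((u * (v ^+ 2 + u * v + u ^+ 2) + u ^+ 2 * (v + u) + u ^+ 3) / 6 -
      (u ^+ 2 + u * (v + u)) / 6).
  by rewrite deltaE; field.
rewrite vu.
have -> : 2 * L ^+ 5 * h = h * (L ^+ 2 * (2 * L ^+ 3)) by ring.
rewrite -mulrA normrM (gtr0_norm h0) ler_pM2l // normrM.
apply: ler_pM => //.
  by rewrite ger0_norm // mulr_ge0.
have L23 : L ^+ 2 <= L ^+ 3 by rewrite ler_weXn2l.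
have p a b : 0 <= a <= L -> 0 <= b <= L -> 0 <= a * b <= L ^+ 2.
  move=> /andP[a0 aL] /andP[b0 bL].
  by rewrite mulr_ge0 //= expr2 ler_pM.
have p3 a b c : 0 <= a <= L -> 0 <= b <= L -> 0 <= c <= L -> 0 <= a * b * c <= L ^+ 3.
  move=> /andP[a0 aL] /andP[b0 bL] /andP[c0 cL].
  rewrite !mulr_ge0 //= exprSr expr2; apply: ler_pM; rewrite ?mulr_ge0 //.
  exact: ler_pM.
have Hu : 0 <= u <= L by rewrite u0.
have Hv : 0 <= v <= L by rewrite v0.
have /andP[? ?] := p3 _ _ _ Hu Hv Hv; have /andP[? ?] := p3 _ _ _ Hu Hu Hv.
have /andP[? ?] := p3 _ _ _ Hu Hu Hu.
have /andP[? ?] := p _ _ Hu Hv; have /andP[? ?] := p _ _ Hu Hu.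
rewrite ler_norml !exprS !expr0 !mulr1 in L23 *.
apply/andP; split; nra.
Qed.

(** In this order: the error of [mu 3], the discretisation error of the profile, the square (L^4)^2
    of its increment, and the spread of a single displacement. *)
Definition displacement_const (R : realType) (L : R) : R :=
  expR 1 * (mu3_const L / 18 + 8 * L ^+ 10 + L ^+ 8 + mu9_const L / 12).

Section second_moment.
Variables (R : realType) (n K J : nat) (L : R).
Local Notation N := n.+1.
Hypotheses (KN : (K < N)%N) (NL : N%:R <= L * (N - K)%:R).

Local Notation expect := (@expect n R).

Definition centre k : R := N%:R * limit_profile (k%:R / N%:R).

Let N_gt0 : 0 < N%:R :> R. Proof. by []. Qed.

Let L_gt0 : 0 < L.
Proof.
have s0 : 0 < (N - K)%:R :> R by rewrite ltr0n; lia.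
by rewrite -(pmulr_lgt0 _ s0); apply: lt_le_trans NL.
Qed.

Let NLk k : (k <= K)%N -> N%:R / (N - k)%:R <= L.
Proof.
move=> kK; rewrite ler_pdivrMr ?ltr0n; last by lia.
by apply: le_trans NL _; rewrite (ler_wpM2l (ltW L_gt0)) // ler_nat; lia.
Qed.

Lemma centreE k : (k < N)%N -> centre k =
  N%:R * ((N%:R / (N - k)%:R) ^+ 3 - (N%:R / (N - k)%:R) ^+ 2 - k%:R / N%:R) / 6.
Proof.
move=> kN; have k1 : k%:R / N%:R != 1 :> R.
  by rewrite lt_eqF // ltr_pdivrMr // mul1r ltr_nat.
rewrite /centre limit_profileE // -mulrA; congr (_ * (_ / _)).
have -> : 1 - k%:R / N%:R = (N - k)%:R / N%:R :> R.
  by rewrite natrB ?(ltnW kN) // mulrBl divff // gt_eqF.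
by rewrite invf_div.
Qed.

Lemma centre_step k : (k.+1 <= K)%N ->
  0 <= centre k.+1 - centre k <= L ^+ 4 /\
  `|centre k.+1 - centre k -
    (3 * (N%:R / (N - k)%:R) ^+ 4 - 2 * (N%:R / (N - k)%:R) ^+ 3 - 1) / 6|
  <= 2 * L ^+ 5 / N%:R.
Proof.
move=> kK.
have s0 : 0 < (N - k.+1)%:R :> R by rewrite ltr0n; lia.
have rE : (N - k)%:R = (N - k.+1)%:R + 1 :> R by rewrite natr1; congr _%:R; lia.
have r0 : 0 < (N - k)%:R :> R by rewrite ltr0n; lia.
have hN : 0 < N%:R^-1 :> R by rewrite invr_gt0.
have := @profile_increment R L (N%:R / (N - k)%:R) (N%:R / (N - k.+1)%:R) N%:R^-1.
have u1 : 1 <= N%:R / (N - k)%:R :> R by rewrite ler_pdivlMr // mul1r ler_nat; lia.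
have uv : N%:R / (N - k)%:R <= N%:R / (N - k.+1)%:R :> R.
  by rewrite ler_pM2l // lef_pV2 ?posrE // ler_nat; lia.
move=> /(_ u1 uv (NLk kK) hN).
have e : N%:R / (N - k.+1)%:R - N%:R / (N - k)%:R =
  N%:R^-1 * (N%:R / (N - k)%:R * (N%:R / (N - k.+1)%:R)) :> R.
  rewrite rE; move: (N - k.+1)%:R s0 (N%:R) N_gt0 => s s0' m m0.
  have s1 : s + 1 != 0 by rewrite gt_eqF // addr_gt0.
  by field; rewrite s1 !gt_eqF.
move=> /(_ e) /=.
have -> // : N%:R^-1^-1 * ((N%:R / (N - k.+1)%:R) ^+ 3 - (N%:R / (N - k.+1)%:R) ^+ 2 -
   ((N%:R / (N - k)%:R) ^+ 3 - (N%:R / (N - k)%:R) ^+ 2) - N%:R^-1) / 6 =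
   centre k.+1 - centre k.
rewrite !centreE; [|lia|lia].
rewrite -(natr1 k) invrK.
set u := N%:R / (N - k)%:R; set v := N%:R / (N - k.+1)%:R.
by move: u v (N%:R) N_gt0 => u v m m0; field; rewrite gt_eqF.
Qed.

(** With U the deviation and Y the mean displacement given the gaps, the cross term 2 U (Y - delta)
    is at most U^2 / N + N (Y - delta)^2. By [law_mu3] the last term has bounded mean, so each step
    adds O(1). *)
Lemma displacement_second_moment k : (k <= K)%N ->
  expect J k (alive (fun _ c => (c%:R - centre k) ^+ 2)) <= displacement_const L * N%:R.
Proof.
move=> kK; set d := mu3_const L / 18 + 8 * L ^+ 10 + L ^+ 8 + mu9_const L / 12.
have m9 : 0 <= mu9_const L by rewrite expR_ge0.
have L0 := ltW L_gt0.
have pc0 : 0 <= mu3_const L.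
  rewrite /mu3_const.
  by move: (expR 1) (expR_ge0 (1 : R)) (mu9_const L) m9 => x x0 y y0; pos.
have d0 : 0 <= d.
  rewrite /d.
  by move: (mu3_const L) pc0 (mu9_const L) m9 => x x0 y y0; pos.
have := @gronwall R N K 1 d
  (fun k => expect J k (alive (fun _ c => (c%:R - centre k) ^+ 2))).
have -> : expect J 0 (alive (fun (_ : seq nat) c => (c%:R - centre 0) ^+ 2)) = 0 :> R.
  by rewrite /= /centre /limit_profile !mul0r expr0n !mul0r mulr0 subrr expr0n.
rewrite add0r /displacement_const -/d mulrAC -mulrA => h.
apply: h kK => //; first exact: ltnW.
move=> {}k kK.
have [/andP[del0 delL] del_y] := centre_step kK.
move: del0 delL del_y; set delta := centre k.+1 - centre k.
set y := (_ - 1) / 6 => del0 delL del_y.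
have kN : (k.+1 < N)%N by lia.
rewrite -[leLHS]/(expect J k (particle_avg J
  (alive (fun (_ : seq nat) c => (c%:R - centre k.+1) ^+ 2)))).
apply: le_trans (_ : expect J k (alive (fun l c => (1 + 1 / N%:R) * (c%:R - centre k) ^+ 2
   + (N%:R * ((mu R N 3 l - 1) / 6 - delta) ^+ 2 + L ^+ 8 + mu R N 9 l / 12))) <= _).
  apply: ler_expect => [|[ [ [ o l] c]|] pst]; first exact: ltnW.
    rewrite particle_avg_alive; apply: le_trans (drop_avg_sqr _ _ _ kN pst) _ => /=.
    have Y0 : 0 <= (mu R N 3 l - 1) / 6.
      rewrite divr_ge0 // subr_ge0 -(mu1 R _ pst) //; exact: mu_le pst _.
    have m59 : mu R N 5 l <= mu R N 9 l by exact: mu_le pst _.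
    have -> : centre k.+1 = centre k + delta by rewrite /delta addrC subrK.
    move: Y0; set Y := (mu R N 3 l - 1) / 6 => Y0.
    set U := c%:R - centre k; have -> : c%:R - (centre k + delta) = U - delta.
      by rewrite opprD addrA.
    have dY := mulr_ge0 del0 Y0.
    have dd : delta ^+ 2 <= L ^+ 8.
      have -> : L ^+ 8 = (L ^+ 4) ^+ 2 by rewrite -exprM.
      by rewrite lerXn2r ?nnegrE ?exprn_ge0.
    have sq : 0 <= N%:R^-1 * (U - N%:R * (Y - delta)) ^+ 2.
      by rewrite mulr_ge0 ?sqr_ge0 // invr_ge0.
    have eqn : N%:R^-1 * (U - N%:R * (Y - delta)) ^+ 2 =
       1 / N%:R * U ^+ 2 - 2 * U * (Y - delta) + N%:R * (Y - delta) ^+ 2.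
      by move: (N%:R) N_gt0 => m m0; field; rewrite gt_eqF.
    rewrite eqn in sq.
    move: (1 / N%:R) sq dY dd m59 => i; move: (mu R N 5 l) (mu R N 9 l) => m5 m9'.
    by move: (N%:R * _ ^+ 2) (L ^+ 8) => p q; nra.
  by rewrite particle_avg_None.
apply: le_trans (_ : expect J k (fun st => (1 + 1 / N%:R) *
    alive (fun _ c => (c%:R - centre k) ^+ 2) st +
    alive (fun l _ => N%:R * ((mu R N 3 l - 1) / 6 - delta) ^+ 2 + L ^+ 8 + mu R N 9 l / 12) st) <= _).
  by apply: ler_expect => [|[ [ [ o l] c]|] pst] /=; rewrite ?mulr0 ?addr0 // ltnW.
rewrite expectD expectZ lerD2l.
have mp : rot_inv (fun l => N%:R * ((mu R N 3 l - 1) / 6 - delta) ^+ 2 + L ^+ 8 + mu R N 9 l / 12).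
  by apply: perm_rot_inv => l l' ll; rewrite !(@mu_perm R N _ _ _ ll).
apply: le_trans (expect_gaps_le _ (ltnW kN) _ mp) _.
  by move=> l; pos.
apply: le_trans (_ : law N k (fun l => N%:R / 18 *
  (mu R N 3 l - (3 * (N%:R / (N - k)%:R) ^+ 4 - 2 * (N%:R / (N - k)%:R) ^+ 3)) ^+ 2 +
  ((8 * L ^+ 10 + L ^+ 8) * 1 + 12^-1 * mu R N 9 l)) <= _).
  apply: ler_law => l gl; rewrite addrA mulr1.
  apply: lerD; last by rewrite mulrC.
  rewrite addrA lerD2r.
  set v := 3 * _ - 2 * _; set w := mu R N 3 l - v.
  have -> : (mu R N 3 l - 1) / 6 - delta = w / 6 + (y - delta) by rewrite /w /y -/v; field.
  have yd : (y - delta) ^+ 2 <= (2 * L ^+ 5 / N%:R) ^+ 2.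
    rewrite -[X in X <= _](real_normK (num_real _)) distrC lerXn2r ?nnegrE //.
    by rewrite divr_ge0 // mulr_ge0 // exprn_ge0.
  apply: le_trans (_ : N%:R * (2 * (w / 6) ^+ 2 + 2 * (2 * L ^+ 5 / N%:R) ^+ 2) <= _).
    rewrite ler_wpM2l //; have := sqr_ge0 (w / 6 - (y - delta)).
    by move: yd; move: (w / 6) (y - delta) (2 * L ^+ 5 / N%:R) => p q e; nra.
  have -> : N%:R * (2 * (w / 6) ^+ 2 + 2 * (2 * L ^+ 5 / N%:R) ^+ 2) =
    N%:R / 18 * w ^+ 2 + 8 * L ^+ 10 / N%:R.
    by move: (N%:R) N_gt0 => m m0; field; rewrite gt_eqF.
  rewrite lerD2l ler_pdivrMr // ler_peMr ?ler1n //.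
  by rewrite mulr_ge0 // exprn_ge0.
rewrite !lawD !lawZ law1 ?(ltnW kN) // mulr1 /d -!addrA.
apply: lerD.
  have := law_mu3 KN NL (ltnW kK); rewrite ler_pdivlMr //.
  set x := law N k _; move: x (N%:R : R) (mu3_const L) => x m p.
  by nra.
rewrite !lerD2l mulrC ler_pM2r ?invr_gt0 //.
exact: (law_mu9 KN NL (ltnW kK)).
Qed.

End second_moment.

(** * The law of the truncated process *)

Lemma sum_tuple_cons (V : nmodType) (A : finType) m (F : m.+1.-tuple A -> V) :
  \sum_t F t = \sum_a \sum_(t : m.-tuple A) F (cons_tuple a t).
Proof.
rewrite pair_bigA /=.
rewrite (reindex (fun p : A * m.-tuple A => cons_tuple p.1 p.2)) //=.
exists (fun t => (thead t, behead_tuple t)) => [ [a t] _|t _] /=.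
  by rewrite theadE; congr pair; apply: val_inj.
by rewrite [RHS]tuple_eta; apply: val_inj.
Qed.

Lemma bit_avg_sum (R : realFieldType) J (F : seq bool -> R) :
  bit_avg J F = 2^-1 ^+ J * \sum_(t : J.-tuple bool) F t.
Proof.
elim: J F => [|J IH] F /=.
  rewrite expr0 mul1r (bigD1 [tuple]) //= big1 ?addr0 // => t /negP[].
  exact/eqP/tuple0.
rewrite sum_tuple_cons big_bool /= !IH exprS.
by field.
Qed.

Section cover.
Context {d : measure_display} {T : measurableType d} {R : realType}.
Variable P : probability T R.

Lemma measure_le_sum (I : finType) (A : set T) (A_ : I -> set T) :
  measurable A -> (forall i, measurable (A_ i)) -> A `<=` \bigcup_i A_ i ->
  (P A <= \sum_i P (A_ i))%E.
Proof.
move=> mA mA_ sub.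
have sub_add (s : seq I) : (P (\big[setU/set0]_(i <- s) A_ i) <= \sum_(i <- s) P (A_ i))%E.
  elim: s => [|i s IH]; first by rewrite !big_nil measure0.
  rewrite !big_cons; apply: (le_trans (measureU2 P _ _)) => //.
    exact: bigsetU_measurable.
  by rewrite leeD2l.
apply: le_trans (sub_add (index_enum I)).
apply: le_measure; rewrite ?inE //; first exact: bigsetU_measurable.
rewrite -bigcup_seq; apply: subset_trans sub _ => w [i _ wi].
by exists i => //=; rewrite mem_index_enum.
Qed.

End cover.

Section runs.
Variables (n J : nat).
Local Notation N := n.+1.
Implicit Types (u : nat -> 'I_N) (s : nat -> nat -> bool).

(** The latest particle comes first, so that earlier traces are suffixes ([trace_drop]): the
    deviation event depends on the runs at all times. *)
Fixpoint trace u s k : seq ('I_N * seq bool) :=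
  if k is k'.+1 then (u k, mkseq (s k) J) :: trace u s k' else [::].

Definition state_of (tr : seq ('I_N * seq bool)) : state n :=
  foldr (fun p st => update st p.1 p.2) (init_state n) tr.

Definition run u s k := state_of (trace u s k).

Lemma runS u s k : run u s k.+1 = update (run u s k) (u k.+1) (mkseq (s k.+1) J).
Proof. by []. Qed.

Lemma trace_drop u s k m : (k <= m)%N -> trace u s k = seq.drop (m - k) (trace u s m).
Proof.
elim: m => [|m IH]; first by rewrite leqn0 => /eqP ->.
rewrite leq_eqVlt => /predU1P[->|km]; first by rewrite subnn drop0.
by rewrite subSn //= -IH.
Qed.

End runs.

Section law_of_run.
Context {d : measure_display} {T : measurableType d} {R : realType}.
Variables (P : probability T R) (n J : nat).
Local Notation N := n.+1.
Variables (drop : nat -> T -> 'I_N) (step : nat -> nat -> T -> bool).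
Hypothesis source : drop_push_source P drop step.

Local Notation drops w := (fun k => drop k w).
Local Notation steps w := (fun k j => step k j w).

Lemma measurable_trace k (S : seq ('I_N * seq bool) -> Prop) : (k < N)%N ->
  measurable [set w | S (trace J (drops w) (steps w) k)].
Proof.
elim: k S => [|k IH] S kN /=.
  have [h|h] := pselect (S [::]).
    by rewrite (_ : [set w | _] = setT) //; apply/seteqP; split.
  by rewrite (_ : [set w | _] = set0) //; apply/seteqP; split.
have -> : [set w | S (trace J (drops w) (steps w) k.+1)] =
  \bigcup_(p in [set: 'I_N * J.-tuple bool])
    (drop k.+1 @^-1` [set p.1] `&`
     (\bigcap_(j in `I_J) step k.+1 j @^-1` [set nth false p.2 j]) `&`
     [set w | S ((p.1, val p.2) :: trace J (drops w) (steps w) k)]).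
  apply/seteqP; split => w /=.
    move=> Sw; exists (drop k.+1 w, [tuple of mkseq (fun j => step k.+1 j w) J]) => //=.
    split; first split => //.
      by move=> j /= jJ; rewrite nth_mkseq.
    exact: Sw.
  move=> [ [x t] _ /= [ [dx bits]]].
  have -> : val t = mkseq (fun j => step k.+1 j w) J.
    apply: (@eq_from_nth _ false); first by rewrite size_mkseq size_tuple.
    by move=> j; rewrite size_tuple => jJ; rewrite nth_mkseq // (bits j jJ).
  by rewrite dx.
apply: fin_bigcup_measurable => [|[x t] _ /=]; first exact: finite_finset.
apply: measurableI; last by apply: (IH (fun l => S ((x, val t) :: l))); exact: ltnW.
apply: measurableI; first exact: (drop_measurable source).
apply: fin_bigcap_measurable => [|j _]; first exact: finite_II.
exact: (step_measurable source).
Qed.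

Lemma measurable_run k (S : state n -> Prop) : (k < N)%N ->
  measurable [set w | S (run J (drops w) (steps w) k)].
Proof. exact: (measurable_trace (fun l => S (state_of l))). Qed.

Definition particle_cylinder k x (t : J.-tuple bool) (A : nat + nat * nat -> set T)
    (i : nat + nat * nat) : set T :=
  if particle i == k then
    match i with
    | inl _ => drop k @^-1` [set x]
    | inr (_, j) => step k j @^-1` [set nth false t j]
    end
  else A i.

Definition particle_sources k : seq (nat + nat * nat) :=
  inl k :: [seq inr (k, j) | j <- iota 0 J].

Lemma prob_particle k x t A : (0 < k < N)%N ->
  (\prod_(i <- particle_sources k) P (particle_cylinder k x t A i) =
   (N%:R^-1 * 2^-1 ^+ J)%:E)%E.
Proof.
move=> kN; rewrite big_cons /particle_cylinder /= eqxx (drop_uniform source) //.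
rewrite EFinM; congr (_ * _)%E; rewrite big_map.
have -> (s : seq nat) : (\prod_(j <- s) P (if k == k then step k j @^-1` [set nth false t j]
   else A (inr (k, j))))%E = (2^-1 ^+ size s)%:E.
  elim: s => [|j s IH]; first by rewrite big_nil.
  by rewrite big_cons IH eqxx (step_symmetric source) // exprS EFinM.
by rewrite size_iota.
Qed.

(** The cylinder on the particles after k makes the induction possible: fixing the values of
    particle k + 1 enlarges the cylinder. As only an upper bound is claimed, the union bound takes
    the place of additivity. *)
Lemma prob_run_cylinder k (S : pred (state n)) (r : seq (nat + nat * nat)) A p :
  (k < N)%N -> uniq r ->
  (forall i, i \in r -> (k < particle i < N)%N /\ source_events drop step i (A i)) ->
  (\prod_(i <- r) P (A i) = p%:E)%E ->
  (P ((\bigcap_(i in [set` r]) A i) `&` [set w | S (run J (drops w) (steps w) k)])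
   <= (p * expect J k (fun st => (S st)%:R))%:E)%E.
Proof.
elim: k S r A p => [|k IH] S r A p kN ur rA pE.
  rewrite /= /run /=; case: (S (init_state n)); last first.
    have -> : [set w : T | false] = set0 by apply/seteqP; split.
    by rewrite setI0 measure0 mulr0.
  have -> : [set w : T | true] = setT by apply/seteqP; split.
  rewrite setIT mulr1 -pE.
  by rewrite (source_independent source) // => i /rA [? ?]; split.
pose cyl (q : 'I_N * J.-tuple bool) := particle_cylinder k.+1 q.1 q.2 A.
pose r' := particle_sources k.+1 ++ r.
have kN' : (0 < k.+1 < N)%N by [].
have cylr q i : i \in r -> cyl q i = A i.
  move=> /rA [/andP[ki _] _]; rewrite /cyl /particle_cylinder gtn_eqF //.
have src_particle i : i \in particle_sources k.+1 -> particle i = k.+1.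
  by rewrite inE => /orP[/eqP ->//|/mapP[j _ ->]].
have ur' : uniq r'.
  rewrite cat_uniq ur andbT; apply/andP; split.
    rewrite /= map_inj_uniq ?iota_uniq ?andbT; last by move=> i j [].
    by apply/mapP => -[].
  apply/hasPn => i /rA [/andP[ki _] _]; apply/negP => /src_particle e.
  by rewrite e ltnn in ki.
have cyl_ev q i : i \in r' -> (k < particle i < N)%N /\ source_events drop step i (cyl q i).
  rewrite mem_cat => /orP[ir|ir]; last first.
    rewrite cylr //; have [/andP[ki ->] ?] := rA _ ir; split=> //.
    by rewrite ltnW.
  split; first by rewrite (src_particle _ ir) ltnSn.
  rewrite /cyl /particle_cylinder (src_particle _ ir) eqxx.
  move: ir; rewrite inE => /orP[/eqP ->|/mapP[j _ ->]] /=.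
    by exists [set q.1].
  by exists [set nth false q.2 j].
have cylE q : (\prod_(i <- r') P (cyl q i) = (N%:R^-1 * 2^-1 ^+ J * p)%:E)%E.
  rewrite big_cat prob_particle // [in RHS]EFinM -pE; congr (_ * _)%E.
  by rewrite big_seq [RHS]big_seq; apply: eq_bigr => i ir; rewrite cylr.
pose part q := (\bigcap_(i in [set` r']) cyl q i) `&`
  [set w | S (update (run J (drops w) (steps w) k) q.1 q.2)].
have mcap B (s : seq (nat + nat * nat)) :
    (forall i, i \in s -> (0 < particle i < N)%N /\ source_events drop step i (B i)) ->
    measurable (\bigcap_(i in [set` s]) B i).
  move=> sB; apply: fin_bigcap_measurable; first exact: finite_seq.
  move=> i /= /sB [iN]; case: i iN => [m|[m j]] /= mN [V _ <-].
    rewrite (_ : _ @^-1` _ = \bigcup_(x in V) drop m @^-1` [set x]).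
      apply: fin_bigcup_measurable => [|x _]; first exact: finite_finset.
      exact: (drop_measurable source).
    by apply/seteqP; split => w /=; [exists (drop m w)|move=> [x Vx ->]].
  rewrite (_ : _ @^-1` _ = \bigcup_(x in V) step m j @^-1` [set x]).
    apply: fin_bigcup_measurable => [|x _]; first exact: finite_finset.
    exact: (step_measurable source).
  by apply/seteqP; split => w /=; [exists (step m j w)|move=> [x Vx ->]].
apply: (le_trans (measure_le_sum (A_ := part) P _ _ _)).
- apply: measurableI; last exact: (measurable_run (fun st => S st) kN).
  by apply: mcap => i /rA [/andP[ki ->] ?]; rewrite (leq_ltn_trans _ ki).
- move=> q; apply: measurableI.
    by apply: mcap => i /(cyl_ev q) [/andP[ki ->] ?]; rewrite (leq_ltn_trans _ ki).
  exact: (measurable_run (fun st => S (update st q.1 q.2)) (ltnW kN)).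
- move=> w [Aw Sw].
  exists (drop k.+1 w, [tuple of mkseq (fun j => step k.+1 j w) J]) => //; split.
    move=> i /=; rewrite mem_cat => /orP[ir|ir]; last by rewrite cylr //; exact: Aw.
    rewrite /cyl /particle_cylinder (src_particle _ ir) eqxx.
    move: ir; rewrite inE => /orP[/eqP -> //|/mapP[j jJ ->]] /=.
    rewrite mem_iota add0n in jJ.
    by rewrite nth_mkseq.
  exact: Sw.
apply: (@le_trans _ _ (\sum_(q : 'I_N * J.-tuple bool) (N%:R^-1 * 2^-1 ^+ J * p *
    expect J k (fun st => (S (update st q.1 q.2))%:R))%:E)%E).
  apply: lee_sum => q _.
  exact: (IH (fun st => S (update st q.1 q.2)) r' (cyl q) _ (ltnW kN) ur' (cyl_ev q) (cylE q)).
rewrite sumEFin lee_fin /=.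
have expect_sum (I : finType) (F : I -> state n -> R) :
    expect J k (fun st => \sum_i F i st) = \sum_i expect J k (F i).
  have aux (s : seq I) :
      expect J k (fun st => \sum_(i <- s) F i st) = \sum_(i <- s) expect J k (F i).
    elim: s => [|i s IHs].
      rewrite big_nil -[RHS](mul0r (@expect n R J k (fun=> 0))) -expectZ.
      by apply: eq_expect => st; rewrite big_nil mul0r.
    rewrite big_cons -IHs -expectD.
    by apply: eq_expect => st; rewrite big_cons.
  exact: aux.
rewrite -mulr_sumr -expect_sum.
have -> : expect J k (particle_avg J (fun st => (S st)%:R)) = N%:R^-1 * 2^-1 ^+ J *
    expect J k (fun st => \sum_(q : 'I_N * J.-tuple bool) (S (update st q.1 q.2))%:R) :> R.
  rewrite -expectZ; apply: eq_expect => st.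
  rewrite /particle_avg mulrC -mulrA; congr (_ * _).
  rewrite mulr_sumr -(pair_bigA _ (fun x (t : J.-tuple bool) =>
    2^-1 ^+ J * (S (update st x t))%:R : R)) /=.
  by apply: eq_bigr => x _; rewrite bit_avg_sum mulr_sumr.
by rewrite mulrAC mulrC.
Qed.

Lemma prob_run k (S : pred (state n)) : (k < N)%N ->
  (P [set w | S (run J (drops w) (steps w) k)] <= (expect J k (fun st => (S st)%:R))%:E)%E.
Proof.
move=> kN.
have := @prob_run_cylinder k S [::] (fun=> setT) 1 kN isT.
rewrite big_nil mul1r => h.
rewrite -[X in P X](@setTI _ _) -[X in X `&` _](_ :
  \bigcap_(i in [set` ([::] : seq (nat + nat * nat))]) setT = setT).
  exact: h.
by apply/seteqP; split.
Qed.

End law_of_run.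

(** * The dynamics in terms of gaps *)

Section dynamics.
Variable n : nat.
Local Notation N := n.+1.
Implicit Types (A : {set 'I_N}) (o x : 'I_N) (s : nat -> bool).

Definition describes A o (l : seq nat) :=
  forall j, (j <= N)%N -> (site o j \notin A) = bdry l j.

(** [walk] appends steps at the end, whereas [settle] consumes them from the front. *)
Lemma walk_shift x s i :
  walk x s i.+1 = walk (if s 0%N then ordS x else ord_pred x) (s \o succn) i.
Proof. by elim: i => //= i ->. Qed.

Lemma ord_pred_site o j : (0 < j)%N -> ord_pred (site o j) = site o j.-1.
Proof. by case: j => // j _; rewrite /= ordSK. Qed.

Lemma mkseqS (T : Type) (f : nat -> T) k : mkseq f k.+1 = f 0%N :: mkseq (f \o succn) k.
Proof. by rewrite /mkseq /= -[1%N]/(1 + 0)%N iotaDl -map_comp. Qed.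

Lemma settle_walk A o l J s j c : sumn l = N -> describes A o l -> (j <= N)%N ->
  match settle l j c (mkseq s J) with
  | Some (j', c') => [/\ (j' <= N)%N, bdry l j' & exists t,
      [/\ c' = (c + t)%N, walk (site o j) s t = site o j' & first_empty A (site o j) s t]]
  | None => forall i, (i <= J)%N -> walk (site o j) s i \in A
  end.
Proof.
move=> lN Al; elim: J s j c => [|J IH] s j c jN.
  rewrite /=; case: ifPn => bj.
    split=> //; exists 0%N; split; rewrite ?addn0 //; split => //=.
    by rewrite Al.
  by move=> i; rewrite leqn0 => /eqP -> /=; rewrite -[_ \in _]negbK Al.
rewrite mkseqS /=; case: ifPn => bj.
  split=> //; exists 0%N; split; rewrite ?addn0 //; split => //=.
  by rewrite Al.
have jA : site o j \in A by rewrite -[_ \in _]negbK Al.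
have j0 : (0 < j)%N by rewrite lt0n; apply: contraNneq bj => ->; exact: bdry0.
have jlt : (j < N)%N.
  by rewrite ltn_neqAle jN andbT; apply: contraNneq bj => ->; rewrite -lN bdry_sumn.
pose j1 := if s 0%N then j.+1 else j.-1.
have j1N : (j1 <= N)%N by rewrite /j1; case: ifP => // _; lia.
have sj1 : (if s 0%N then ordS (site o j) else ord_pred (site o j)) = site o j1.
  by rewrite /j1; case: ifP => // _; rewrite ord_pred_site.
have := IH (s \o succn) j1 c.+1 j1N.
rewrite -/j1; case: settle => [ [j' c']|].
  move=> [j'N bj' [t [c'E wE [tA before]]]]; split=> //; exists t.+1; split.
  - by rewrite c'E addSnnS.
  - by rewrite walk_shift sj1.
  - split; first by rewrite walk_shift sj1.
    by move=> [|i] // it; rewrite walk_shift sj1; exact: before.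
by move=> h [|i] // iJ; rewrite walk_shift sj1; exact: h.
Qed.

Lemma settle_extend l J J' s j c r : (J <= J')%N ->
  settle l j c (mkseq s J) = Some r -> settle l j c (mkseq s J') = Some r.
Proof.
elim: J J' s j c => [|J IH] J' s j c JJ'.
  rewrite /=; case: ifP => // bj [<-]; case: J' JJ' => [|J'] _; rewrite ?mkseqS /= bj //.
case: J' JJ' => // J' JJ'; rewrite !mkseqS /=; case: ifP => // _; exact: IH.
Qed.

Lemma settle_ge l j c bs j' c' : settle l j c bs = Some (j', c') -> (c <= c')%N.
Proof.
elim: bs j c => [|b bs IH] j c /=; case: ifP => // _; try by move=> [_ <-].
by move=> /IH; lia.
Qed.

Lemma first_empty_inj A x s i j : first_empty A x s i -> first_empty A x s j -> i = j.
Proof.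
move=> [iA bi] [jA bj]; case: (ltngtP i j) => // h.
  by rewrite (bj _ h) in iA.
by rewrite (bi _ h) in jA.
Qed.

Lemma stick_site1 A x s t : first_empty A x s t -> stick_site A x s = [set walk x s t]%SET.
Proof.
move=> ft; apply/setP => y; rewrite finset.in_set finset.in_set1; apply/asboolP/eqP.
  by move=> [j fj <-]; rewrite (first_empty_inj fj ft).
by move=> ->; exists t.
Qed.

Lemma describes_rot1 A o a l : all (leq 1) (a :: l) -> sumn (a :: l) = N ->
  describes A o (a :: l) -> describes A (site o a) (rcons l a).
Proof.
move=> /= /andP[a0 pl] lN Al j jN; rewrite site_add.
have rc m : (m <= sumn l + a)%N ->
    bdry (rcons l a) m = (if (m <= sumn l)%N then bdry l m else m == (sumn l + a)%N).
  elim: l {Al lN} pl m => [|b l IH] /=.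
    by move=> _ m ma; case: m ma => [|m] ma //=; rewrite orbF; lia.
  move=> /andP[b0 pl] m mb.
  have [bm|mb'] := leqP b m.
    by rewrite IH //;
      [rewrite leq_subLR; case: ifP => // _; case: (m) bm mb => [|m'] //=; lia | lia].
  by rewrite !orbF (leq_trans (ltnW mb') (leq_addr _ _)).
rewrite rc; last by lia.
case: ifP => jl.
  rewrite Al /=; last by lia.
  by rewrite leq_addr addKn addn_eq0 (gtn_eqF a0).
(* Past the old root the coordinate wraps around, into the gap a now placed last. *)
have e : (a + j = N + (j - sumn l))%N by lia.
have -> : site o (a + j) = site o (j - sumn l) by rewrite e -site_add siteN.
rewrite Al; last by lia.
case: l {rc Al} pl lN jl e => [|b l] /=.
  by move=> _ aN; rewrite !addn0 in aN *; case: j jN => //= j jN; rewrite orbF subn0 ; lia.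
move=> /andP[b0 pl] lN jl e.
rewrite (_ : j - (b + sumn l) == 0 = false)%N; last by lia.
have [h|h] := eqVneq j (b + sumn l + a)%N.
  by rewrite h addKn leqnn subnn.
by apply/negbTE; apply/negP => /andP[]; lia.
Qed.

Lemma describes_rot A o l m : all (leq 1) l -> sumn l = N -> (m <= size l)%N ->
  describes A o l -> describes A (site o (sumn (take m l))) (rot m l).
Proof.
move=> pl lN ml Al; elim: m ml => [|m IH] ml; first by rewrite take0 rot0.
rewrite rotS // (take_nth 0%N) // -cats1 sumn_cat /= addn0 -site_add.
have := IH (ltnW ml).
have := size_rot m l.
have : all (leq 1) (rot m l) by apply/allP => y; rewrite mem_rot; exact: (allP pl).
have : sumn (rot m l) = N by rewrite -lN; apply: perm_sumn; rewrite perm_rot.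
have := nth0_rot ml; case: (rot m l) => [|a l'] /= <-; first by lia.
move=> lN' pl' sl' Al'; rewrite /rot /= drop0 take0 cats1.
exact: describes_rot1.
Qed.

Lemma describes_merge A o a b l : all (leq 1) (a :: b :: l) -> sumn (a :: b :: l) = N ->
  describes A o (a :: b :: l) -> describes (A :|: [set site o a])%SET o ((a + b)%N :: l).
Proof.
move=> /= /and3P[a0 b0 pl] lN Al j jN.
rewrite finset.in_setU finset.in_set1 negb_or Al //.
(* As a lies strictly between 0 and N, it is the only coordinate of its site, although 0 and N share
   theirs. *)
have site_inj : (site o j == site o a) = (j == a).
  apply/eqP/eqP => [|-> //] /(congr1 val); rewrite !val_site.
  move: (ltn_ord o); set k := nat_of_ord o => kN.
  have [->|jN'] := eqVneq j N.
    rewrite modnDr modn_small //.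
    have [h|h] := ltnP (k + a) N; first by rewrite modn_small //; lia.
    rewrite -(subnK h) modnDr modn_small //; lia.
  have [h|h] := ltnP (k + a) N; have [h'|h'] := ltnP (k + j) N.
  - by rewrite !modn_small //; lia.
  - rewrite [RHS]modn_small // -(subnK h') modnDr modn_small //; lia.
  - rewrite [LHS]modn_small // -(subnK h) modnDr modn_small //; lia.
  - rewrite -(subnK h) -(subnK h') !modnDr !modn_small //; lia.
rewrite site_inj /=.
have [->|j0] := eqVneq j 0%N; first by rewrite /= (ltn_eqF a0).
have [->|ja] := eqVneq j a.
  by rewrite andbF /=; apply/esym/negbTE; apply/negP => /andP[]; lia.
rewrite andbT /=; case: (leqP a j) => aj /=.
  rewrite (_ : j - a == 0 = false)%N /=; last by lia.
  by rewrite leq_subRL // subnDA.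
by apply/esym/negbTE; apply/negP => /andP[]; lia.
Qed.

Lemma sumn_take_bdry l j : all (leq 1) l -> (j <= sumn l)%N -> bdry l j ->
  sumn (take (bdry_idx l j) l) = j.
Proof.
elim: l j => [|a l IH] j /=; first by move=> _; lia.
move=> /andP[a0 pl] jl; case: ifP => aj.
  rewrite (_ : j == 0 = false)%N /=; last by lia.
  by move=> bj; rewrite IH //; lia.
by rewrite orbF => /eqP ->.
Qed.

Lemma bdry_idx_le l j : (bdry_idx l j <= size l)%N.
Proof. by elim: l j => //= a l IH j; case: ifP => // _; rewrite ltnS. Qed.

Lemma describes_fill A o l j : all (leq 1) l -> sumn l = N -> (1 < size l)%N ->
  (j <= N)%N -> bdry l j -> describes A o l ->
  describes (A :|: [set site o j])%SET (site o (sumn (take (left_gap l j) l))) (fill l j).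
Proof.
move=> pl lN sl jN bj Al; set m := left_gap l j.
have ml : (m < size l)%N.
  by rewrite /m /left_gap; have := bdry_idx_le l j; case: bdry_idx => [|i]; lia.
(* For j = 0 the left gap is the last one, and its right end [site o N] is the root again. *)
have sm : site o j = site o (sumn (take m.+1 l)).
  rewrite /m /left_gap; have := sumn_take_bdry pl _ bj; rewrite lN => /(_ jN).
  case: bdry_idx => [|i] => [|->] //.
  by rewrite take0 /= => <-; rewrite prednK ?take_size ?lN ?siteN //; lia.
have := describes_rot pl lN (ltnW ml) Al.
have : all (leq 1) (rot m l) by apply/allP => y; rewrite mem_rot; exact: (allP pl).
have : sumn (rot m l) = N by rewrite -lN; apply: perm_sumn; rewrite perm_rot.
have := size_rot m l; have := nth0_rot ml.
rewrite /fill -/m; case: (rot m l) => [|a [|b l']] /= aE; try by lia.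
move=> _ lN' pl' Al'.
have -> : site o j = site (site o (sumn (take m l))) a.
  by rewrite sm site_add (take_nth 0%N) // -cats1 sumn_cat /= addn0 aE.
exact: describes_merge.
Qed.

End dynamics.

(** * From truncated runs to the actual displacement *)

Section link.
Variables (R : realType) (n : nat).
Local Notation N := n.+1.
Variables (u : nat -> 'I_N) (s : nat -> nat -> bool).

Lemma displacement_first_empty k t : first_empty (occupied u s k) (u k.+1) (s k.+1) t ->
  displacement u s R k.+1 = (t%:R)%:E.
Proof.
move=> ft; rewrite /displacement /= -[RHS]ereal_inf1; congr ereal_inf.
apply/seteqP; split => y /=; last by move=> ->; exists t.
by move=> [j fj <-]; rewrite (first_empty_inj fj ft).
Qed.

Lemma displacement_ge0 k : (0 <= displacement u s R k)%E.
Proof. by apply/ereal_infP => _ [j _ <-]; rewrite lee_fin. Qed.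

Lemma total_displacementS k : total_displacement u s R k.+1 =
  (total_displacement u s R k + displacement u s R k.+1)%E.
Proof. by rewrite /total_displacement big_nat_recr. Qed.

Lemma run_describes J k o l c : (k < N)%N -> run J u s k = Some (o, l, c) ->
  [/\ gaps N k l, describes (occupied u s k) o l & total_displacement u s R k = (c%:R)%:E].
Proof.
elim: k o l c => [|k IH] o l c kN.
  move=> e; have {e} [<- <- <-] : init_state n = Some (o, l, c) := e; split.
  - exact: gaps_init.
  - move=> j jN; rewrite finset.in_set0 /=.
    have b m i : (i <= m)%N -> bdry (nseq m 1%N) i.
      elim: m i => [|m IHm] i im /=; first by move: im; rewrite leqn0 => ->.
      by case: i im => [|i] im //=; rewrite subn1 IHm.
    by rewrite -[RHS]/(bdry (nseq N 1%N) j) b.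
  - by rewrite /total_displacement big_geq.
rewrite runS; case E: (run J u s k) => [ [ [ o' l'] c']|] //=.
have [gl dl tl] := IH _ _ _ (ltnW kN) E.
have [sl pl lN] := gl.
have := settle_walk J (s k.+1) c' lN dl (ltnW (coord_lt o' (u k.+1))).
case: settle => [ [j c1]|] //; rewrite site_coord.
move=> [jN bj [t [c1E wt ft]]] [<- <- <-]; split.
- exact: gaps_fill.
- rewrite /= (stick_site1 ft) wt; apply: describes_fill => //.
  by rewrite sl; lia.
- by rewrite total_displacementS tl (displacement_first_empty ft) c1E natrD EFinD.
Qed.

Lemma run_extend J J' k st : (J <= J')%N -> run J u s k = Some st -> run J' u s k = Some st.
Proof.
move=> JJ'; elim: k st => [|k IH] st //; rewrite !runS.
case E: (run J u s k) => [ [ [ o l] c]|] //=; rewrite (IH _ E) /=.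
by case F: settle => [ [j c']|] //; rewrite (settle_extend JJ' F).
Qed.

(** Conversely, where a run dies at every cut-off the displacement is infinite; this settles the
    deviation event on the walks that never end. *)
Lemma total_displacement_finite k : (k < N)%N -> total_displacement u s R k != +oo%E ->
  exists J st, run J u s k = Some st.
Proof.
elim: k => [|k IH] kN; first by exists 0%N, (ord0, nseq N 1%N, 0%N).
rewrite total_displacementS => fin.
have d0 := displacement_ge0 k.+1.
have t0 : (0 <= total_displacement u s R k)%E.
  by apply: sume_ge0 => i _; exact: displacement_ge0.
have [J [ [ [ o l] c] E]] : exists J st, run J u s k = Some st.
  apply: IH; first exact: ltnW.
  apply: contraNneq fin => ->; rewrite addye //.
  by apply: contraTneq d0 => ->.
have [t ft] : exists t, first_empty (occupied u s k) (u k.+1) (s k.+1) t.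
  apply: contrapT => no; move/negP: fin; apply.
  rewrite (_ : displacement _ _ _ _ = +oo%E); last first.
    rewrite /displacement (_ : [set _ | _ in _] = set0) ?ereal_inf0 //.
    by apply/seteqP; split => // y [j fj _]; case: no; exists j.
  by rewrite addey //; apply: contraTneq t0 => ->.
exists (maxn J t); rewrite runS (run_extend (leq_maxl J t) E) /=.
have [gl dl tl] := run_describes (ltnW kN) E.
have [sl pl lN] := gl.
have := settle_walk (maxn J t) (s k.+1) c lN dl (ltnW (coord_lt o (u k.+1))).
case: settle => [ [j c1]|]; first by move=> _; eexists.
rewrite site_coord => /(_ t (leq_maxr _ _)).
by case: ft => /negbTE ->.
Qed.

Definition walked (st : state n) : nat := if st is Some (_, _, c) then c else 0.

Lemma run_alive J k m : (k <= m)%N -> run J u s m != None ->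
  run J u s k != None /\ (walked (run J u s k) <= walked (run J u s m))%N.
Proof.
elim: m => [|m IH]; first by rewrite leqn0 => /eqP ->.
rewrite leq_eqVlt => /predU1P[->|km] //; rewrite runS => alive.
have [h1 h2] : run J u s m != None /\
    (walked (run J u s m) <= walked (update (run J u s m) (u m.+1) (mkseq (s m.+1) J)))%N.
  move: alive; case: (run J u s m) => [ [ [ o l] c]|] //=.
  by case E: settle => [ [j c']|] //= _; split=> //; exact: settle_ge E.
by have [-> h3] := IH km h1; split=> //; exact: leq_trans h2.
Qed.

Lemma total_displacement_run J k : (k < N)%N -> run J u s k != None ->
  total_displacement u s R k = ((walked (run J u s k))%:R)%:E.
Proof.
move=> kN; case E: (run J u s k) => [ [ [ o l] c]|] // _.
by have [] := run_describes kN E.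
Qed.

End link.

(** * The deviation event *)

Lemma limit_profile_lipschitz (R : realType) (L a b : R) :
  0 <= a -> a <= b -> b < 1 -> (1 - b)^-1 <= L ->
  0 <= limit_profile b - limit_profile a <= L ^+ 4 * (b - a).
Proof.
move=> a0 ab b1 bL.
have [->|ab'] := eqVneq a b; first by rewrite !subrr mulr0 lexx.
have {ab'} ab' : a < b by rewrite lt_neqAle ab'.
have a1 : a < 1 by exact: lt_trans b1.
have [ua ub] : 0 < 1 - a /\ 0 < 1 - b by rewrite !subr_gt0.
have h0 : 0 < b - a by rewrite subr_gt0.
have u1 : 1 <= (1 - a)^-1 by rewrite invf_ge1 // gerBl.
have uv : (1 - a)^-1 <= (1 - b)^-1 by rewrite lef_pV2 ?posrE // lerD2l lerN2.
have e : (1 - b)^-1 - (1 - a)^-1 = (b - a) * ((1 - a)^-1 * (1 - b)^-1).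
  by field; rewrite !gt_eqF.
have [/andP[d0 dL] _] := profile_increment u1 uv bL h0 e.
rewrite !limit_profileE ?lt_eqF //.
set x := (1 - b)^-1 ^+ 3 - _ in d0 dL *; set y := (1 - a)^-1 ^+ 3 - _ in d0 dL *.
have -> : (x - b) / 6 - (y - a) / 6 = (b - a)^-1 * (x - y - (b - a)) / 6 * (b - a).
  by field; rewrite gt_eqF.
by rewrite mulr_ge0 ?(ltW h0) //= ler_pM2r.
Qed.

Lemma absz_ceilP (R : realType) (x : R) : 0 <= x ->
  x <= `|Num.ceil x|%N%:R < x + 1.
Proof.
move=> x0; have c0 : 0 <= Num.ceil x by rewrite ceil_ge0 (lt_le_trans _ x0).
rewrite natr_absz ger0_norm //.
have /andP[] := ceil_itv x; rewrite intrD intrN /= => h ->.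
by rewrite -ltrBlDr.
Qed.

Section one_circle.
Context {d : measure_display} {T : measurableType d} {R : realType}.
Variables (P : probability T R) (n : nat).
Local Notation N := n.+1.
Variables (drop : nat -> T -> 'I_N) (step : nat -> nat -> T -> bool).
Hypothesis source : drop_push_source P drop step.
Variables (eta eps L : R) (g : nat).
Hypotheses (eta01 : 0 < eta < 1) (eps0 : 0 < eps).

Let K := `|Num.ceil ((1 - eta) * N%:R)|%N.
Hypotheses (KN : (K < N)%N) (NL : N%:R <= L * (N - K)%:R).

Local Notation drops w := (fun k => drop k w).
Local Notation steps w := (fun k j => step k j w).
Local Notation runs J w k := (run J (drops w) (steps w) k).
Local Notation deviates := [set w : T | (eps%:E <= sup_deviation (drops w) (steps w) eta)%E].

Let N_gt0 : 0 < N%:R :> R. Proof. by []. Qed.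

Let ceil_leK a : 0 <= a -> a <= 1 - eta -> (`|Num.ceil (a * N%:R)| <= K)%N.
Proof.
move=> a0 ae.
have aN : 0 <= a * N%:R by exact: mulr_ge0.
have c0 : 0 <= Num.ceil (a * N%:R) by rewrite ceil_ge0 (lt_le_trans _ aN).
rewrite /K -lez_nat !gez0_abs // ?le_ceil // ?ler_wpM2r //.
by rewrite ceil_ge0 (lt_le_trans _ (mulr_ge0 _ _)) // subr_ge0; case/andP: eta01 => _ /ltW.
Qed.

Lemma dead_deviates w : (forall J, runs J w K = None) -> deviates w.
Proof.
move=> dead /=.
have tK : total_displacement (drops w) (steps w) R K = +oo%E.
  apply/eqP/negPn/negP => /(total_displacement_finite KN) [J [st E]].
  by rewrite dead in E.
rewrite /sup_deviation; apply: (@le_trans _ _ +oo%E); first exact: leey.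
apply: ereal_sup_ubound => /=; exists (1 - eta).
  by rewrite in_itv /= lexx subr_ge0; case/andP: eta01 => _ /ltW ->.
by rewrite -/K tK gt0_muley ?lte_fin ?invr_gt0.
Qed.

(** A run that survives some cut-off J has its deviation determined by a trace with finitely many
    values, which also disposes of the supremum over uncountably many a. A run that survives none
    deviates by [dead_deviates]. *)
Lemma measurable_deviates : measurable deviates.
Proof.
pose dev (tr : seq ('I_N * seq bool)) := (eps%:E <= ereal_sup [set
   `| (N%:R^-1)%:E * ((walked (state_of (seq.drop (K - `|Num.ceil (a * N%:R)|) tr)))%:R)%:E
      - (limit_profile a)%:E |%E | a in `[0%R, (1 - eta)%R] ])%E.
have devE J w : runs J w K != None ->
    dev (trace J (drops w) (steps w) K) = deviates w :> Prop.
  move=> alive; rewrite /dev /= /sup_deviation; congr (is_true (_ <= ereal_sup _)%E).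
  apply/seteqP; split => y /= [a aI <-]; exists a => //; move: (aI);
    rewrite /= in_itv /= => /andP[a0 a1]; have cK := ceil_leK a0 a1;
    have [alive' _] := run_alive cK alive;
    by rewrite -(trace_drop J (drops w) (steps w) cK)
      (total_displacement_run R _ alive') // (leq_ltn_trans cK).
have -> : deviates =
   (\bigcup_J [set w | runs J w K != None /\ dev (trace J (drops w) (steps w) K)]) `|`
   (\bigcap_J [set w | runs J w K = None]).
  apply/seteqP; split => w.
    move=> Dw; have [dead|/existsNP[J alive]] := pselect (forall J, runs J w K = None).
      by right => J _; exact: dead.
    by left; exists J => //=; split; [exact/eqP | rewrite devE //; exact/eqP].
  move=> [[J _ [/= alive Dw]]|dead]; first by move: Dw; rewrite devE.
  by apply: dead_deviates => J; exact: dead.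
apply: measurableU.
  apply: bigcup_measurable => J _.
  exact: (measurable_trace J source (fun tr => state_of tr != None /\ dev tr) KN).
apply: bigcap_measurable => [|J _]; first by exists 0%N.
exact: (measurable_run J source (fun st => st = None) KN).
Qed.

(** The mesh of a grid of g + 1 times; as g h > K, the last of them is K. *)
Let h := (K %/ g).+1.
Let point i := minn (i * h) K.
(** At most N particles, each cut off with probability at most N^2 / J, leave a total of 1 / N. *)
Let J := (N ^ 4)%N.

Let strays m (st : state n) : bool :=
  if st is Some (_, _, c) then (eps / 8 * N%:R) ^+ 2 <= (c%:R - centre R n m) ^+ 2 else false.

Hypotheses (g_gt0 : (0 < g)%N) (gL : 8 * L ^+ 4 <= eps * g%:R)
  (NL4 : 8 * L ^+ 4 <= eps * N%:R).

(** The budget is eps / 8 at the grid times, eps / 4 for the growth of the centre over one mesh,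
    since displacement and centre are both monotone, and eps / 8 for rounding a up to m / N. The
    total eps / 2 is below eps. *)
Lemma grid_deviates w : runs J w K != None ->
  (forall i, (i < g.+1)%N -> ~~ strays (point i) (runs J w (point i))) ->
  ~ deviates w.
Proof.
move=> alive ok; apply/negP; rewrite -ltNge.
apply: (@le_lt_trans _ _ (eps / 2)%:E); last first.
  by rewrite lte_fin ltr_pdivrMr // ltr_pMr // ltr1n.
apply: ge_ereal_sup => _ /= [a aI <-]; move: aI; rewrite in_itv /= => /andP[a0 a1].
set m := `|Num.ceil (a * N%:R)|%N.
have mK : (m <= K)%N by exact: ceil_leK.
have [alive_m _] := run_alive mK alive.
rewrite (total_displacement_run R _ alive_m) ?(leq_ltn_trans mK) //.
set c := walked _.
rewrite -EFinM -EFinB abse_EFin lee_fin.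
have K1 : 0 <= L.
  by rewrite ltW // -(pmulr_lgt0 _ (_ : 0 < (N - K)%:R)) ?ltr0n ?subn_gt0 // (lt_le_trans _ NL).
have inv_le k : (k <= K)%N -> k%:R / N%:R < 1 :> R /\ (1 - k%:R / N%:R)^-1 <= L.
  move=> kK; have kN : (k < N)%N by exact: leq_ltn_trans KN.
  have -> : 1 - k%:R / N%:R = (N - k)%:R / N%:R :> R.
    by rewrite natrB ?(ltnW kN) // mulrBl divff.
  split; first by rewrite ltr_pdivrMr // mul1r ltr_nat.
  rewrite invf_div ler_pdivrMr ?ltr0n ?subn_gt0 //; apply: le_trans NL _.
  by rewrite ler_wpM2l // ler_nat leq_sub2l.
have centre_mono k k' : (k <= k')%N -> (k' <= K)%N ->
    0 <= centre R n k' - centre R n k <= L ^+ 4 * (k' - k)%:R.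
  move=> kk' k'K; have [l1 lL] := inv_le _ k'K.
  have := limit_profile_lipschitz (divr_ge0 (ler0n R k) (ltW N_gt0)) _ l1 lL.
  rewrite ler_pM2r ?invr_gt0 // ler_nat => /(_ kk').
  rewrite /centre -mulrBr natrB //.
  have -> : L ^+ 4 * (k'%:R - k%:R) = N%:R * (L ^+ 4 * (k'%:R / N%:R - k%:R / N%:R)) :> R.
    by field.
  by rewrite pmulr_rge0 // ler_pM2l.
have close i : (i <= g)%N ->
    `|(walked (runs J w (point i)))%:R - centre R n (point i)| <= eps / 8 * N%:R.
  move=> ig; have pK : (point i <= K)%N by exact: geq_minr.
  have [] := run_alive pK alive.
  have := ok i ig; rewrite /strays; case: (run _ _ _ (point i)) => [ [ [ o l] c']|] //=.
  rewrite -ltNge => lt _ _; rewrite ltW //.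
  rewrite -(ltr_pXn2r (_ : 0 < 2)%N) ?nnegrE // ?real_normK ?num_real //.
  by rewrite mulr_ge0 // divr_ge0 // ltW.
pose i := (m %/ h)%N.
have h0 : (0 < h)%N by [].
have ig : (i < g)%N.
  by rewrite /i ltn_divLR // mulnC (leq_ltn_trans mK) // /h ltn_ceil.
have pm : (point i <= m)%N.
  by rewrite geq_min leq_divM.
have mp : (m <= point i.+1)%N.
  by rewrite leq_min mK andbT ltnW // ltn_ceil.
have pK : (point i.+1 <= K)%N by exact: geq_minr.
have pp : (point i.+1 - point i <= h)%N.
  rewrite /point mulSn; move: (i * h)%N h K => x y z; clear; lia.
have [alive_p _] := run_alive pK alive.
have [_ c_up] := run_alive mp alive_p.
have [_ c_lo] := run_alive pm alive_m.
(* [gL] pays eps / 8 for K / g, and [NL4] as much for rounding the mesh up. *)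
have hL : L ^+ 4 * h%:R <= eps / 4 * N%:R.
  have hK : h%:R <= K%:R / g%:R + 1 :> R.
    rewrite /h -natr1 lerD2r ler_pdivlMr ?ltr0n // -natrM ler_nat; exact: leq_divM.
  have KNr : K%:R <= N%:R :> R by rewrite ler_nat ltnW.
  apply: le_trans (ler_wpM2l (exprn_ge0 4 K1) hK) _.
  rewrite mulrDr mulr1.
  have : L ^+ 4 * (K%:R / g%:R) <= eps / 8 * N%:R.
    rewrite mulrA ler_pdivrMr ?ltr0n //.
    apply: le_trans (ler_wpM2l (exprn_ge0 4 K1) KNr) _.
    have := ler_wpM2r (ltW N_gt0) gL; move: (L ^+ 4) (N%:R : R) => x y; nra.
  move: NL4; lra.
have /andP[m1 m2] := centre_mono _ _ pm mK.
have /andP[m3 m4] := centre_mono _ _ mp pK.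
have s1 : L ^+ 4 * (m - point i)%:R <= eps / 4 * N%:R.
  apply: le_trans hL; rewrite ler_wpM2l ?exprn_ge0 // ler_nat.
  by apply: leq_trans pp; exact: leq_sub2r.
have s2 : L ^+ 4 * (point i.+1 - m)%:R <= eps / 4 * N%:R.
  apply: le_trans hL; rewrite ler_wpM2l ?exprn_ge0 // ler_nat.
  by apply: leq_trans pp; exact: leq_sub2l.
have := close _ ig; have := close _ (ltnW ig).
rewrite !ler_norml => /andP[lo1 _] /andP[_ up1].
have cm : `|c%:R - centre R n m| <= 3 / 8 * eps * N%:R.
  have clo : (walked (runs J w (point i)))%:R <= c%:R :> R by rewrite ler_nat.
  have cup : c%:R <= (walked (runs J w (point i.+1)))%:R :> R by rewrite ler_nat.
  rewrite ler_norml; apply/andP; split; lra.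
have aN : 0 <= a * N%:R by exact: mulr_ge0.
have /andP[ma mb] := absz_ceilP aN.
have [l1 lL] := inv_le _ mK.
have am : a <= m%:R / N%:R by rewrite ler_pdivlMr.
have := limit_profile_lipschitz a0 am l1 lL.
have : m%:R / N%:R - a <= N%:R^-1.
  by rewrite lerBlDr ler_pdivrMr // mulrDl mulVf // addrC ltW.
move=> ba /andP[f0 f1].
have f2 : limit_profile (m%:R / N%:R) - limit_profile a <= eps / 8.
  apply: le_trans f1 _; apply: le_trans (ler_wpM2l (exprn_ge0 4 K1) ba) _.
  by rewrite ler_pdivrMr //; move: NL4; lra.
have cmN : `|N%:R^-1 * c%:R - limit_profile (m%:R / N%:R)| <= 3 / 8 * eps.
  have -> : N%:R^-1 * c%:R - limit_profile (m%:R / N%:R) = N%:R^-1 * (c%:R - centre R n m).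
    by rewrite mulrBr /centre mulKf.
  by rewrite normrM gtr0_norm ?invr_gt0 // ler_pdivrMl // mulrC.
move: cmN f0 f2; move: (N%:R^-1 * c%:R) (limit_profile _) (limit_profile a) => x y z.
rewrite !ler_norml => /andP[q1 q2] f0 f2; apply/andP; split; lra.
Qed.

(** Chebyshev's inequality; 64 is the square of the 8 in [strays]. *)
Lemma prob_strays m : (m <= K)%N ->
  (P [set w | strays m (runs J w m)] <= (64 * displacement_const L / (eps ^+ 2 * N%:R))%:E)%E.
Proof.
move=> mK; have mN : (m < N)%N by exact: leq_ltn_trans KN.
apply: le_trans (prob_run J source (strays m) mN) _; rewrite lee_fin.
have E := displacement_second_moment J KN NL mK.
apply: le_trans (_ : 64 / (eps * N%:R) ^+ 2 *
   expect J m (alive (fun _ c => (c%:R - centre R n m) ^+ 2)) <= _).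
  rewrite -expectZ; apply: ler_expect => // -[ [ [ o l] c]|] _ /=; last by rewrite mulr0.
  have c0 : 0 < (eps * N%:R) ^+ 2 by rewrite exprn_gt0 // mulr_gt0.
  case: (boolP ((eps / 8 * N%:R) ^+ 2 <= _)) => [h1|_] /=.
    have e8 : (eps / 8 * N%:R) ^+ 2 = (eps * N%:R) ^+ 2 / 64 by field.
    rewrite mulrAC ler_pdivlMr // mul1r; move: h1.
    by rewrite e8 ler_pdivrMr // [_ * 64]mulrC.
  by rewrite mulr_ge0 ?sqr_ge0 // divr_ge0 // ltW.
have c0 : 0 <= 64 / (eps * N%:R) ^+ 2 by rewrite divr_ge0 ?sqr_ge0.
apply: le_trans (ler_wpM2l c0 E) _.
rewrite le_eqVlt; apply/orP; left; apply/eqP.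
move: (N%:R : R) N_gt0 => x x0; by field; rewrite !gt_eqF.
Qed.

Lemma prob_dead : (P [set w | runs J w K == None] <= (N%:R^-1)%:E)%E.
Proof.
apply: le_trans (prob_run J source (fun st => st == None) KN) _; rewrite lee_fin.
apply: le_trans (expect_dead_le _ KN _) _; first by rewrite /J expn_gt0.
have KNr : K%:R <= N%:R :> R by rewrite ler_nat ltnW.
apply: le_trans (ler_wpM2r _ KNr) _; first by rewrite divr_ge0 ?exprn_ge0.
rewrite /J natrX le_eqVlt; apply/orP; left; apply/eqP.
by move: (N%:R : R) N_gt0 => x x0; field; rewrite gt_eqF.
Qed.

Lemma prob_deviates : (P deviates <=
  ((1 + g.+1%:R * (64 * displacement_const L / eps ^+ 2)) / N%:R)%:E)%E.
Proof.
(* Index 0 stands for a dead run, the others for the grid times. *)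
pose bad (o : 'I_g.+2) : set T :=
  if unlift ord0 o is Some i then [set w | strays (point i) (runs J w (point i))]
  else [set w | runs J w K == None].
have pK i : (point i <= K)%N by exact: geq_minr.
apply: (@le_trans _ _ (\sum_o P (bad o))%E).
  apply: measure_le_sum; first exact: measurable_deviates.
    rewrite /bad => o; case: unlift => [i|] /=; last first.
      exact: (measurable_run _ source (fun st => st == None) KN).
    apply: (measurable_run _ source (fun st => strays (point i) st)).
    exact: leq_ltn_trans (pK i) KN.
  move=> w Dw; have [dead|alive] := eqVneq (runs J w K) None.
    by exists ord0 => //; rewrite /bad unlift_none /= dead.
  apply: contrapT => no; apply: (grid_deviates alive) Dw => i ig.
  apply/negP => bad_i; apply: no; exists (lift ord0 (Ordinal ig)) => //.
  by rewrite /bad liftK.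
rewrite big_ord_recl {1}/bad unlift_none mulrDl EFinD mul1r; apply: leeD; first exact: prob_dead.
apply: (@le_trans _ _ (\sum_(i < g.+1) (64 * displacement_const L / (eps ^+ 2 * N%:R))%:E)%E).
  by apply: lee_sum => i _; rewrite /bad liftK; exact: prob_strays.
rewrite sumEFin lee_fin sumr_const card_ord -[leLHS]mulr_natl.
rewrite le_eqVlt; apply/orP; left; apply/eqP.
by move: (N%:R : R) N_gt0 => x x0; field; rewrite !gt_eqF.
Qed.

End one_circle.

Unset Implicit Arguments.

(* The circle in position n of each family has n.+1 sites: there is no
   uniformly distributed site on a circle with 0 sites. *)
Theorem theorem2p1 (R : realType)
    (d : nat -> measure_display) (T : forall n : nat, measurableType (d n))
    (P : forall n : nat, probability (T n) R)
    (drop : forall n : nat, nat -> T n -> 'I_n.+1)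
    (step : forall n : nat, nat -> nat -> T n -> bool)
    (source : forall n : nat, drop_push_source (P n) (drop n) (step n))
    (eta eps : R) (eta01 : 0 < eta < 1) (eps0 : 0 < eps) :
  (fun n : nat => P n [set w : T n |
      (eps%:E <= sup_deviation (fun k => drop n k w)
                               (fun k j => step n k j w) eta)%E])
    @ \oo --> (0 : \bar R)%E.
Proof.
have /andP[eta0 eta1] := eta01.
(* N - K is at least eta N - 1, hence at least eta N / 2 as soon as eta N >= 2. *)
pose L := 2 / eta; have L0 : 0 <= L by rewrite divr_ge0 // ltW.
pose g := (`|Num.ceil (8 * L ^+ 4 / eps)|%N).+1.
have L40 : 0 <= 8 * L ^+ 4 / eps.
  by apply: divr_ge0; [rewrite mulr_ge0 // exprn_ge0 | exact: ltW].
have gL : 8 * L ^+ 4 <= eps * g%:R.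
  rewrite [leRHS]mulrC -ler_pdivrMr //; have /andP[c _] := absz_ceilP L40.
  by apply: le_trans c _; rewrite ler_nat.
pose C := 1 + g.+1%:R * (64 * displacement_const L / eps ^+ 2).
apply: (@squeeze_cvge _ _ _ _ (fun=> 0%E) _ (fun n => (C * harmonic n)%:E)).
- near=> n; rewrite measure_ge0 /= /harmonic.
  have N_gt0 : 0 < n.+1%:R :> R by [].
  have n_big : 2 + 8 * L ^+ 4 / eps + 2 / eta <= n.+1%:R.
    apply: le_trans (_ : n%:R <= _); last by rewrite ler_nat.
    by near: n; exact: nbhs_infty_ger.
  have e2 : 0 <= 2 / eta by rewrite divr_ge0 // ltW.
  have NL4 : 8 * L ^+ 4 <= eps * n.+1%:R.
    by rewrite [leRHS]mulrC -ler_pdivrMr //; lra.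
  have en : 2 <= eta * n.+1%:R by rewrite [leRHS]mulrC -ler_pdivrMr //; lra.
  have e1n : 0 <= (1 - eta) * n.+1%:R by rewrite mulr_ge0 // subr_ge0 ltW.
  have /andP[_ Kn] := absz_ceilP e1n.
  have KN : (`|Num.ceil ((1 - eta) * n.+1%:R)| < n.+1)%N.
    by rewrite -(ltr_nat R); apply: lt_le_trans Kn _; lra.
  have NL : n.+1%:R <= L * (n.+1 - `|Num.ceil ((1 - eta) * n.+1%:R)|)%:R.
    rewrite natrB ?(ltnW KN) // /L mulrAC ler_pdivlMr //; lra.
  exact: (prob_deviates (source n) eta01 eps0 KN NL (ltn0Sn _) gL NL4).
- exact: cvg_cst.
- apply: cvg_EFin; first by near=> n.
  rewrite -(mulr0 C); apply: cvgMl_tmp; exact: cvg_harmonic.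
Unshelve. all: by end_near.
Qed.
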